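(* Let $X\neq\{0\}$ be a complex Banach space with open unit ball $\mathbb{B}$ and let $\frac12\le\lambda\le 1$. Let $F$ be a locally biholomorphic mapping on $\mathbb{B}$ such that, for each $k=1,2,3$, there is a complex-valued homogeneous polynomial $H_{F,k}:X\to\mathbb{C}$ of degree $k$ with $$\frac{D^{k+1}F(0)(x^{k+1})}{(k+1)!}=H_{F,k}(x)\,x\qquad\text{for all }x\in X .$$ If $F\in\widehat{\mathcal{F}}_{\lambda}(\mathbb{B})$, then for every $x_0\in X$ with $\|x_0\|=1$ (and every $T_{x_0}\in T(x_0)$), $$|H_2(2)(F)|\le\frac{(1+2\lambda)^2(17-10\lambda)}{192(3-2\lambda)},\qquad\text{where } H_2(2)(F)=A_2A_4-A_3^2 .$$ The inequality is sharp: for every $\lambda\in[\frac12,1]$ there exist such an $F$, $x_0$ and $T_{x_0}$ for which equality holds.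
   Context: $X$ is a complex Banach space with norm $\|\cdot\|$ and $\mathbb{B}=\{x\in X:\|x\|<1\}$. For $x\in X\setminus\{0\}$, $T(x)$ is the set of bounded linear functionals $T_x:X\to\mathbb{C}$ with $T_x(x)=\|x\|$ and $\|T_x\|=1$. $D^nF(x)$ denotes the $n$th Fréchet derivative of $F$ at $x$ (a bounded symmetric $n$-linear map $X^n\to X$), and $D^nF(0)(x^n)=D^nF(0)(x,\ldots,x)$. A holomorphic map $F:\mathbb{B}\to X$ is normalized if $F(0)=0$ and $DF(0)=I$; it is locally biholomorphic if $DF(x)$ is invertible with bounded inverse for every $x\in\mathbb{B}$. For $\frac12\le\lambda\le1$, $\widehat{\mathcal{F}}_{\lambda}(\mathbb{B})$ is the class of normalized locally biholomorphic maps $F:\mathbb{B}\to X$ such that $$\operatorname{Re}\left\{T_x\left(\frac{(DF(x))^{-1}\bigl(D^2F(x)(x,x)+DF(x)x\bigr)}{\|x\|}\right)\right\}\ge\frac12-\lambda$$ for every $x\in\mathbb{B}\setminus\{0\}$ and every $T_x\in T(x)$. For $\|x_0\|=1$ and $T_{x_0}\in T(x_0)$, put $A_n=\frac{1}{n!}T_{x_0}\bigl(D^nF(0)(x_0,\ldots,x_0)\bigr)$ for $n=2,3,4$. *)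

(* Defs.v *)
From HB Require Import structures.
From mathcomp Require Import all_boot all_order all_algebra.
From mathcomp Require Import all_classical all_reals all_analysis.
From mathcomp Require Export complex.

Set Implicit Arguments.
Unset Strict Implicit.
Unset Printing Implicit Defensive.

Import Order.TTheory GRing.Theory Num.Theory.
Import numFieldNormedType.Exports.

Local Open Scope classical_set_scope.
Local Open Scope complex_scope.
Local Open Scope ring_scope.

Section Frechet.
Variables (K : numFieldType) (X Y : normedModType K).

Definition multilinear n (L : ('I_n -> X) -> Y) : Prop :=
  forall (v : 'I_n -> X) (i : 'I_n), linear (fun u : X => L (@dfwith _ (fun=> X) v i u)).

Definition bounded_multilinear n (L : ('I_n -> X) -> Y) : Prop :=
  multilinear L /\
  exists M : K, forall v, `|L v| <= M * \prod_(i < n) `|v i|.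

(* Continuity is not required. *)
Definition homogeneous_poly k (P : X -> Y) : Prop :=
  exists2 L : ('I_k -> X) -> Y, multilinear L & forall x, P x = L (fun=> x).

(* The argument list (h, v_0, ..., v_(n-1)). *)
Definition arg_cons n (h : X) (v : 'I_n -> X) : 'I_n.+1 -> X :=
  fun i => if unlift ord0 i is Some j then v j else h.

(* G takes values in the n-linear maps; L is its Frechet derivative at x for
   the operator norm, a bounded linear map from X to the bounded n-linear maps
   being identified with a bounded n.+1-linear map. The last inequality,
   required for all v, says that the operator norm of
   G (x + h) - G x - L (h, -) is at most e * |h|. *)
Definition is_multilinear_derivative n (G : X -> ('I_n -> X) -> Y) (x : X)
    (L : ('I_n.+1 -> X) -> Y) : Prop :=
  bounded_multilinear L /\
  forall e : K, 0 < e -> \forall h \near (0 : X), forall v : 'I_n -> X,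
    `|G (x + h) v - G x v - L (arg_cons h v)|
      <= e * `|h| * \prod_(i < n) `|v i|.

(* The n-th Frechet derivative D^n F(x); it is the zero map by convention at
   the points where it does not exist. *)
Fixpoint Dn n (F : X -> Y) (x : X) : ('I_n -> X) -> Y :=
  match n with
  | 0 => fun=> F x
  | m.+1 => xget (fun=> 0) [set L | is_multilinear_derivative (@Dn m F) x L]
  end.

End Frechet.

Section Banach.
Variables (R : realType) (X : completeNormedModType R[i]).

Definition unit_ball : set X := [set x | `|x| < 1].

(* Norms are R[i]-valued (with zero imaginary part), whence the complex.Re. *)
Definition opnorm (T : X -> R[i]^o) : R :=
  sup [set complex.Re `|T v| | v in [set v : X | `|v| <= 1]].

(* T(x) *)
Definition support_functionals (x : X) : set (X -> R[i]^o) :=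
  [set T : X -> R[i]^o | [/\ linear T, continuous T, T x = `|x| & opnorm T = 1]].

(* Maps on the unit ball are total functions X -> X whose values outside of
   the ball are irrelevant: the ball is open, so that the derivatives at its
   points only depend on the restriction to the ball. Differentiability is
   over the complex scalars R[i]. *)
Definition holomorphic_on_ball (F : X -> X) : Prop :=
  forall x, unit_ball x -> differentiable F x.

Definition normalized (F : X -> X) : Prop := F 0 = 0 /\ 'd F 0 =1 id.

(* (DF(x))^-1; this is the inverse map as soon as DF(x) is bijective. *)
Definition Dinv (F : X -> X) (x : X) : X -> X := pinv setT ('d F x).

Definition locally_biholomorphic (F : X -> X) : Prop :=
  holomorphic_on_ball F /\
  forall x, unit_ball x -> bijective ('d F x) /\ continuous (Dinv F x).

Definition class_F (lambda : R) (F : X -> X) : Prop :=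
  [/\ normalized F, locally_biholomorphic F
    & forall x, unit_ball x -> x != 0 ->
      forall T, support_functionals x T ->
      1 / 2 - lambda <=
      complex.Re (T (`|x|^-1 *: Dinv F x (Dn F x (fun _ : 'I_2 => x) + 'd F x x)))].

Definition radial_terms (F : X -> X) : Prop :=
  forall k, (1 <= k <= 3)%N ->
  exists2 H : X -> R[i]^o, homogeneous_poly k H &
    forall x, (k.+1`!%:R)^-1 *: Dn F 0 (fun _ : 'I_k.+1 => x) = H x *: x.

Definition coef (F : X -> X) (x0 : X) (T : X -> R[i]^o) (n : nat) : R[i] :=
  (n`!%:R)^-1 * T (Dn F 0 (fun _ : 'I_n => x0)).

Definition hankel22 (F : X -> X) (x0 : X) (T : X -> R[i]^o) : R[i] :=
  coef F x0 T 2 * coef F x0 T 4 - coef F x0 T 3 ^+ 2.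

End Banach.

(* Main.v *)
(* Fix a unit vector x0 and a support functional T. The function
     p(z) = 1 + z T(DF(z x0)^-1 D^2 F(z x0)(x0, x0))
   is holomorphic on the unit disc, Re p >= 1/2 - lambda, and since the Taylor terms of F up to
   order 4 are radial, p agrees up to o(z^3) with 1 + z G'/G where
   G = 1 + 2 A2 z + 3 A3 z^2 + 4 A4 z^3. The upper bound is thus a coefficient problem for
   functions of positive real part. Positivity of their Toeplitz matrices turns, by a Cayley
   transform, into contractivity of the 3x3 Toeplitz matrix of a Schur function, whose first
   three Schur parameters reduce the bound to a polynomial inequality in two real variables.

   Contour integrals are replaced by averages over the 2^n-th roots of unity: Goursat's quartering
   argument, applied to Riemann sums, shows that these averages converge to the values given by
   Cauchy's formula.

   Equality holds for F(x) = h(T x) x, where (z h(z))' = (1 - 2 t z + z^2)^(- mu),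
   mu = lambda + 1/2 and t^2 = 1 / (4 (2 - mu)); for this F the Schur parameters are t, -1. *)
From HB Require Import structures.
Require Import Defs.
From mathcomp Require Import all_boot all_order all_algebra.
From mathcomp Require Import all_classical all_reals all_analysis.
From mathcomp Require Import ring lra.
Import Order.TTheory GRing.Theory Num.Theory.
Import numFieldNormedType.Exports.
Local Open Scope classical_set_scope.
Local Open Scope complex_scope.
Local Open Scope ring_scope.
Set Implicit Arguments.
Unset Strict Implicit.
Unset Printing Implicit Defensive.

(** * Real-valued norms *)

(** With [mu = lambda + 1/2], the function [P = (p + lambda - 1/2) / mu] has [P(0) = 1] and
    [Re P >= 0], so [(P - 1) / (P + 1) = z b(z)] for a Schur function [b], whose first coefficients
    are [b0], [b1], [b2]. Finite Toeplitz matrices need only an expansion of [p] with remainder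
    [o(z^3)], never a power series; they are obtained on circles of radius [r < 1], and [r] tends to
    1 at the end. When the second Schur parameter has modulus 1, the bound exceeds the estimated
    quantity by a multiple of [(t^2 - 1 / (4 (2 - mu)))^2] with [t = |b0|]; this dictates [t]. The
    parameters [t, -1] mean [b = (t - z) / (1 - t z)], hence [P = (1 - z^2) / (1 - 2 t z + z^2)],
    and solving [1 + z G'/G = 1 - mu + mu P] yields the power [- mu]. The delicate point of the
    example is that [h] has no zero in the disc, without which [F] is not locally biholomorphic.
    Balls of [X] need not be compact. Compactness enters only for plane squares, through a single
    quartering lemma that serves Goursat's theorem, the mean value inequality and closed discs. *)

Section RealNorm.
Context {R : realType}.
Local Notation C := R[i].

(** The order of [R[i]] is only partial; estimates are moved to the real field, where [lra] and
    [nra] apply. *)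
Definition nrm {V : normedZmodType C} (x : V) : R := complex.Re `|x|.

Context {V : normedZmodType C}.
Implicit Types x y : V.

Lemma normE x : `|x| = (nrm x)%:C.
Proof.
rewrite /nrm; have := normr_ge0 x; rewrite lecE /= => /andP[/eqP h _].
by case: `|x| h => a b /= ->.
Qed.

Lemma nrm_ge0 x : 0 <= nrm x.
Proof. by have := normr_ge0 x; rewrite normE lecR. Qed.

Lemma nrm0 : nrm (0 : V) = 0.
Proof. by rewrite /nrm normr0. Qed.

Lemma nrm_eq0 x : nrm x = 0 -> x = 0.
Proof. by move=> h; apply/eqP; rewrite -normr_eq0 normE h. Qed.

Lemma nrm_gt0 x : x != 0 -> 0 < nrm x.
Proof. by rewrite -normr_gt0 normE ltcR. Qed.

Lemma nrmN x : nrm (- x) = nrm x.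
Proof. by rewrite /nrm normrN. Qed.

Lemma nrmD x y : nrm (x + y) <= nrm x + nrm y.
Proof. by have := ler_normD x y; rewrite !normE -rmorphD lecR. Qed.

Lemma nrmB x y : nrm (x - y) <= nrm x + nrm y.
Proof. by rewrite -(nrmN y) nrmD. Qed.

Lemma nrmBC x y : nrm (x - y) = nrm (y - x).
Proof. by rewrite -nrmN opprB. Qed.

Lemma nrm_tri z x y : nrm (x - y) <= nrm (x - z) + nrm (z - y).
Proof. by rewrite -[x - y](subrKA z) nrmD. Qed.

Lemma nrm_sum (I : Type) (r : seq I) (P : pred I) (F : I -> V) :
  nrm (\sum_(i <- r | P i) F i) <= \sum_(i <- r | P i) nrm (F i).
Proof.
elim/big_rec2: _ => [|i y x _ h]; first by rewrite nrm0.
by rewrite (le_trans (nrmD _ _))// lerD2l.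
Qed.

End RealNorm.

Section RealNormC.
Context {R : realType}.
Local Notation C := R[i].

Lemma nrmM (a b : C) : nrm (a * b) = nrm a * nrm b.
Proof. by rewrite /nrm normrM !normE /= mul0r subr0. Qed.

Lemma nrm1 : nrm (1 : C) = 1.
Proof. by rewrite /nrm normr1. Qed.

Lemma nrmV (a : C) : nrm a^-1 = (nrm a)^-1.
Proof.
have [->|a0] := eqVneq a 0; first by rewrite invr0 nrm0 invr0.
have h := nrm_gt0 a0.
by apply: (mulIf (lt0r_neq0 h)); rewrite -nrmM !mulVf ?nrm1// gt_eqF.
Qed.

Lemma nrmX (a : C) n : nrm (a ^+ n) = nrm a ^+ n.
Proof. by elim: n => [|n ih]; rewrite ?expr0 ?nrm1// !exprS nrmM ih. Qed.

Lemma natC (n : nat) : (n%:R : R)%:C = n%:R :> C.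
Proof. exact: rmorph_nat. Qed.

Lemma nrm_real (a : R) : nrm a%:C = `|a|.
Proof. by rewrite /nrm normc_def /= expr0n addr0 sqrtr_sqr. Qed.

Lemma nrm_neq0 (V : normedZmodType C) (x : V) : 0 < nrm x -> x != 0.
Proof. by apply: contraTneq => ->; rewrite nrm0 ltxx. Qed.

Lemma realC_neq0 (a : R) : 0 < a -> a%:C != 0 :> C.
Proof. by move=> a0; apply: nrm_neq0; rewrite nrm_real gtr0_norm. Qed.

Lemma circle_neq0 (r : R) (w : C) : 0 < r -> nrm w = 1 -> r%:C * w != 0.
Proof. by move=> r0 w1; apply: nrm_neq0; rewrite nrmM w1 mulr1 nrm_real gtr0_norm. Qed.

Lemma Re_mul_real (w : C) (a : R) : complex.Re (w * a%:C) = complex.Re w * a.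
Proof. by case: w => x y /=; rewrite mulr0 subr0. Qed.

Lemma nrm_nat n : nrm (n%:R : C) = n%:R.
Proof.
have -> : (n%:R : C) = (n%:R : R)%:C by rewrite rmorph_nat.
by rewrite nrm_real ger0_norm.
Qed.

Lemma nrmZ (Y : normedModType C) (a : C) (y : Y) : nrm (a *: y) = nrm a * nrm y.
Proof. by rewrite /nrm normrZ !normE /= mul0r subr0. Qed.

Lemma sqr_nrm (a : C) : nrm a ^+ 2 = complex.Re a ^+ 2 + complex.Im a ^+ 2.
Proof. by rewrite /nrm normc_def /= sqr_sqrtr// addr_ge0// sqr_ge0. Qed.

Lemma mul_conj (a : C) : a * a^*%C = (nrm a ^+ 2)%:C.
Proof. by rewrite -sqr_normc normE rmorphXn. Qed.

Lemma nrm_conj (a : C) : nrm a^*%C = nrm a.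
Proof. by rewrite /nrm normcJ. Qed.

Lemma Re_le_nrm (a : C) : `|complex.Re a| <= nrm a.
Proof.
rewrite -(ler_pXn2r (ltn0Sn 1)) ?nnegrE ?nrm_ge0// sqr_nrm real_normK ?num_real//.
by rewrite lerDl sqr_ge0.
Qed.

Lemma Im_le_nrm (a : C) : `|complex.Im a| <= nrm a.
Proof.
rewrite -(ler_pXn2r (ltn0Sn 1)) ?nnegrE ?nrm_ge0// sqr_nrm real_normK ?num_real//.
by rewrite lerDr sqr_ge0.
Qed.

Lemma nrm_le_ReIm (a : C) : nrm a <= `|complex.Re a| + `|complex.Im a|.
Proof.
rewrite -(ler_pXn2r (ltn0Sn 1)) ?nnegrE ?nrm_ge0 ?addr_ge0//.
rewrite sqr_nrm -(real_normK (num_real (complex.Re a))).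
rewrite -(real_normK (num_real (complex.Im a))).
have := normr_ge0 (complex.Re a); have := normr_ge0 (complex.Im a); nra.
Qed.

Lemma lec_mul_real (z : C) (a b : R) : a%:C <= z * b%:C -> a <= complex.Re z * b.
Proof. by case: z => x y; rewrite lecE /= !mulr0 subr0 => /andP[]. Qed.

Lemma ReIm_complex (a : C) : a = (complex.Re a)%:C + 'i%C * (complex.Im a)%:C.
Proof. by case: a => x y; apply/eqP; rewrite eq_complex /=; apply/andP; split; apply/eqP; ring. Qed.

End RealNormC.

(** * Identities in modules *)

Section ModuleExpr.
Context {K : pzRingType} {V : lmodType K}.

(** Syntax for a proof by reflection: an equality of vectors is checked one atom at a time, which
    leaves scalar identities for [ring] and [field]. *)
Inductive mexpr : Type :=
| MVar of nat
| MZero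
| MAdd of mexpr & mexpr
| MOpp of mexpr
| MScale of K & mexpr.

Fixpoint meval (s : seq V) (e : mexpr) : V :=
  match e with
  | MVar i => s`_i
  | MZero => 0
  | MAdd e1 e2 => meval s e1 + meval s e2
  | MOpp e1 => - meval s e1
  | MScale k e1 => k *: meval s e1
  end.

Fixpoint mcoef (i : nat) (e : mexpr) : K :=
  match e with
  | MVar j => if eqn i j then 1 else 0
  | MZero => 0
  | MAdd e1 e2 => mcoef i e1 + mcoef i e2
  | MOpp e1 => - mcoef i e1
  | MScale k e1 => k * mcoef i e1
  end.

Lemma meval_mcoef s e : meval s e = \sum_(i < size s) mcoef i e *: s`_i.
Proof.
elim: e => [j| |e1 ih1 e2 ih2|e1 ih1|k e1 ih1] /=.
- have [js|js] := ltnP j (size s).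
    rewrite (bigD1 (Ordinal js))//= eqnE eqxx scale1r big1 ?addr0// => i ij.
    by case: eqP => [e|_]; [rewrite -val_eqE /= e eqxx in ij|rewrite scale0r].
  rewrite nth_default// big1// => i _.
  case: eqnP => [e|_]; last by rewrite scale0r.
  by have := ltn_ord i; rewrite e ltnNge js.
- by rewrite big1// => i _; rewrite scale0r.
- by rewrite ih1 ih2 -big_split; apply: eq_bigr => i _; rewrite scalerDl.
- by rewrite ih1 -sumrN; apply: eq_bigr => i _; rewrite scaleNr.
- by rewrite ih1 scaler_sumr; apply: eq_bigr => i _; rewrite scalerA.
Qed.

(** Recursion on [n], rather than a quantifier over indices, so that the condition computes to a
    concrete conjunction of scalar goals. *)
Fixpoint mcoefs_eq (n : nat) (e1 e2 : mexpr) : Prop :=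
  if n is m.+1 then mcoef m e1 = mcoef m e2 /\ mcoefs_eq m e1 e2 else True.

Lemma meval_eq s e1 e2 : mcoefs_eq (size s) e1 e2 -> meval s e1 = meval s e2.
Proof.
rewrite !meval_mcoef => h; apply: eq_bigr => i _; congr (_ *: _).
elim: (size s) i h => [[]//|n ih i [h1 h2]].
have [->//|ni] := eqVneq (i : nat) n.
have il : (i < n)%N by rewrite ltn_neqAle ni -ltnS ltn_ord.
exact: (ih (Ordinal il)).
Qed.

End ModuleExpr.

Ltac mod_index x s :=
  match s with
  | x :: _ => constr:(0%N)
  | _ :: ?s' => let n := mod_index x s' in constr:(S n)
  end.
Ltac mod_atom x s :=
  match s with
  | _ => let n := mod_index x s in s
  | _ => constr:(x :: s)
  end.
Ltac mod_atoms t s :=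
  lazymatch t with
  | GRing.add ?a ?b => let s1 := mod_atoms b s in mod_atoms a s1
  | GRing.opp ?a => mod_atoms a s
  | GRing.scale _ ?a => mod_atoms a s
  | GRing.zero => s
  | _ => mod_atom t s
  end.
Ltac mod_reify t s :=
  lazymatch t with
  | GRing.add ?a ?b =>
      let e1 := mod_reify a s in let e2 := mod_reify b s in open_constr:(MAdd e1 e2)
  | GRing.opp ?a => let e := mod_reify a s in open_constr:(MOpp e)
  | GRing.scale ?k ?a => let e := mod_reify a s in open_constr:(MScale k e)
  | GRing.zero => open_constr:(MZero)
  | _ => let n := mod_index t s in open_constr:(MVar n)
  end.
(* Reduces an identity between linear combinations of vectors to the equality of the coefficients. *)
Ltac module_eq :=
  lazymatch goal with
  | |- @eq ?T ?a ?b =>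
      let s1 := mod_atoms b (@nil T) in
      let s := mod_atoms a s1 in
      let e1 := mod_reify a s in
      let e2 := mod_reify b s in
      refine (@meval_eq _ _ s e1 e2 _);
      cbn [mcoefs_eq size mcoef eqn Nat.eqb];
      repeat (split; last first)
  end.

(** * Complex derivatives *)

Section Derivatives.
Context {R : realType}.
Local Notation C := R[i].

(** Only the first-order condition; linearity and boundedness of [L] are kept apart. One-variable
    derivatives are then the case [X = C^o], with [L] a multiple of the identity. *)
Definition tangent {X Y : normedModType C} (f : X -> Y) (x : X) (L : X -> Y) : Prop :=
  forall e : R, 0 < e -> exists2 r : R, 0 < r &
    forall y, nrm (y - x) < r -> nrm (f y - f x - L (y - x)) <= e * nrm (y - x).

Definition bounded_by {X Y : normedModType C} (L : X -> Y) (M : R) : Prop :=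
  0 <= M /\ forall h, nrm (L h) <= M * nrm h.

Definition frechet {X Y : normedModType C} (f : X -> Y) (x : X) (L : X -> Y) : Prop :=
  [/\ linear L, exists M, bounded_by L M & tangent f x L].

Definition cderiv {Y : normedModType C} (f : C -> Y) (a : C) (d : Y) : Prop :=
  tangent (X := C^o) f a (fun h => h *: d).

Definition cont_at {X Y : normedModType C} (f : X -> Y) (x : X) : Prop :=
  forall e : R, 0 < e -> exists2 r : R, 0 < r &
    forall y, nrm (y - x) < r -> nrm (f y - f x) <= e.

Section Lipschitz.
Context {X Y : normedModType C}.
Implicit Types (f : X -> Y) (L : X -> Y).

Lemma bounded_scale (Y' : normedModType C) (d : Y') :
  bounded_by (fun h : C^o => h *: d) (nrm d).
Proof. by split; [exact: nrm_ge0|move=> h; rewrite nrmZ mulrC]. Qed.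

Lemma tangent_lip f x L M : tangent f x L -> bounded_by L M ->
  exists2 r : R, 0 < r &
    forall y, nrm (y - x) < r -> nrm (f y - f x) <= (M + 1) * nrm (y - x).
Proof.
move=> fL [M0 hM]; have [r r0 hr] := fL 1 ltr01; exists r => // y /hr h.
have := nrmD (f y - f x - L (y - x)) (L (y - x)); rewrite subrK.
by have := hM (y - x); lra.
Qed.

Lemma tangent_cont f x L M : tangent f x L -> bounded_by L M -> cont_at f x.
Proof.
move=> fL LM e e0; have [r r0 hr] := tangent_lip fL LM.
have M1 : 0 < M + 1 by case: LM; lra.
exists (Num.min r (e / (M + 1))); first by rewrite lt_min r0 divr_gt0.
move=> y; rewrite lt_min => /andP[/hr h]; rewrite ltr_pdivlMr//; lra.
Qed.

End Lipschitz.

Section General.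
Context {X Y Z : normedModType C}.
Implicit Types (f : X -> Y) (L : X -> Y).

Lemma tangent_cst (y : Y) (x : X) : tangent (fun=> y) x (fun=> 0).
Proof.
move=> e e0; exists 1 => // z _.
by rewrite !subrr nrm0 mulr_ge0 ?nrm_ge0// ltW.
Qed.

Lemma tangent_linear (L : X -> Y) x : linear L -> tangent L x L.
Proof.
move=> lL e e0; exists 1 => // z _.
have -> : L (z - x) = L z - L x by rewrite addrC -scaleN1r lL scaleN1r addrC.
by rewrite subrr nrm0 mulr_ge0 ?nrm_ge0// ltW.
Qed.

Lemma tangentD f g (x : X) L K : tangent f x L -> tangent g x K ->
  tangent (fun y => f y + g y) x (fun h => L h + K h).
Proof.
move=> fL gK e e0; have e2 : 0 < e / 2 by rewrite divr_gt0.
have [r r0 hr] := fL _ e2; have [s s0 hs] := gK _ e2.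
exists (Num.min r s); first by rewrite lt_min r0.
move=> y; rewrite lt_min => /andP[/hr h1 /hs h2].
rewrite [X in nrm X](_ : _ = (f y - f x - L (y - x)) + (g y - g x - K (y - x))).
  by have := nrmD (f y - f x - L (y - x)) (g y - g x - K (y - x)); lra.
by module_eq; ring.
Qed.

Lemma tangent_ext f g (x : X) L K : (exists2 r : R, 0 < r & forall y, nrm (y - x) < r -> f y = g y) ->
  (forall h, L h = K h) -> tangent f x L -> tangent g x K.
Proof.
move=> [r r0 fg] LK fL e e0; have [s s0 hs] := fL _ e0.
exists (Num.min r s); first by rewrite lt_min r0.
move=> y; rewrite lt_min => /andP[/fg h1 /hs]; rewrite h1 LK fg//.
by rewrite subrr nrm0.
Qed.

Lemma tangent_comp f (g : Y -> Z) x L K M N :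
  tangent f x L -> bounded_by L M -> tangent g (f x) K -> linear K -> bounded_by K N ->
  tangent (fun y => g (f y)) x (fun h => K (L h)).
Proof.
move=> fL LM gK lK KN e e0.
have [M0 hM] := LM; have [N0 hN] := KN.
have [r r0 hr] := tangent_lip fL LM.
(* [e1] pays for the error of [g], whose increment has size at most [(M + 1) |y - x|]; [e2] pays for
   the error of [f] after [K] has magnified it by at most [N]. *)
have e1 : 0 < e / 2 / (M + 1) by rewrite !divr_gt0//; lra.
have e2 : 0 < e / 2 / (N + 1) by rewrite !divr_gt0//; lra.
have [s s0 hs] := gK _ e1.
have [t t0 ht] := fL _ e2.
have M1 : 0 < M + 1 by lra.
exists (Num.min r (Num.min t (s / (M + 1)))); first by rewrite !lt_min r0 t0 divr_gt0.
move=> y; rewrite !lt_min => /and3P[/hr h1 /ht h2]; rewrite ltr_pdivlMr// => h3.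
have h4 : nrm (f y - f x) < s by lra.
have := hs _ h4.
have KB u v : K (u - v) = K u - K v by rewrite addrC -scaleN1r lK scaleN1r addrC.
set a := K (L (y - x)).
rewrite [g (f y) - _ - a](_ : _ = (g (f y) - g (f x) - K (f y - f x))
  + K (f y - f x - L (y - x))); last first.
  by rewrite (KB (f y - f x) (L (y - x))) -/a; module_eq; ring.
move=> h5; apply: (le_trans (nrmD _ _)).
have h6 := hN (f y - f x - L (y - x)).
have n0 := nrm_ge0 (y - x).
have : e / 2 / (M + 1) * nrm (f y - f x) <= e / 2 * nrm (y - x).
  rewrite -[leLHS]mulrA ler_wpM2l//; first lra.
  by rewrite mulrC ler_pdivrMr// mulrC.
have : N * nrm (f y - f x - L (y - x)) <= e / 2 * nrm (y - x).
  apply: (le_trans (ler_wpM2l N0 h2)).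
  have -> : N * (e / 2 / (N + 1) * nrm (y - x)) = N / (N + 1) * (e / 2 * nrm (y - x)) by field; lra.
  apply: ler_piMl; first by apply: mulr_ge0 => //; clear -e0; lra.
  by clear -N0; rewrite ler_pdivrMr; lra.
clear -h5 h6; lra.
Qed.

Lemma tangent_scale (k : X -> C^o) f x A L M N :
  tangent k x A -> bounded_by A M -> tangent f x L -> bounded_by L N ->
  tangent (fun y => k y *: f y) x (fun h => A h *: f x + k x *: L h).
Proof.
move=> kA AM fL LN e e0.
have [r r0 hr] := tangent_lip kA AM.
have [s s0 hs] := tangent_lip fL LN.
have [M0 hM] := AM; have [N0 hN] := LN.
pose B := nrm (f x) + nrm (k x) + 1.
have fx0 := nrm_ge0 (f x); have kx0 := nrm_ge0 (k x).
have B0 : 0 < B by rewrite /B; lra.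
have eB : 0 < e / 2 / B by rewrite !divr_gt0.
have [t t0 ht] := kA _ eB; have [u u0 hu] := fL _ eB.
(* The product of the two increments is at most [D |y - x|^2], hence negligible for
   [|y - x| < e / 2 / D]. The constant [B] handles the two first-order errors. *)
pose D := (M + 1) * (N + 1).
have D0 : 0 < D by rewrite mulr_gt0//; lra.
exists (Num.min (Num.min r s) (Num.min (Num.min t u) (e / 2 / D))).
  by rewrite !lt_min r0 s0 t0 u0 !divr_gt0.
move=> y; rewrite !lt_min => /andP[/andP[/hr h1 /hs h2] /andP[/andP[/ht h3 /hu h4]]].
rewrite ltr_pdivlMr// => h5.
rewrite [X in nrm X](_ : _ = (k y - k x - A (y - x)) *: f x +
  k x *: (f y - f x - L (y - x)) + (k y - k x) *: (f y - f x)); last first.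
  by module_eq; ring.
apply: (le_trans (nrmD _ _)); apply: (le_trans (lerD (nrmD _ _) (lexx _))).
rewrite !nrmZ.
have n0 := nrm_ge0 (y - x).
have j1 : nrm (k y - k x - A (y - x)) * nrm (f x) <= e / 2 / B * nrm (y - x) * nrm (f x).
  by rewrite ler_wpM2r.
have j2 : nrm (k x) * nrm (f y - f x - L (y - x)) <= nrm (k x) * (e / 2 / B * nrm (y - x)).
  by rewrite ler_wpM2l.
have j3 : nrm (k y - k x) * nrm (f y - f x) <=
    ((M + 1) * nrm (y - x)) * ((N + 1) * nrm (y - x)).
  by rewrite ler_pM// nrm_ge0.
have j4 : ((M + 1) * nrm (y - x)) * ((N + 1) * nrm (y - x)) <= e / 2 * nrm (y - x).
  have -> : ((M + 1) * nrm (y - x)) * ((N + 1) * nrm (y - x)) =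
    nrm (y - x) * D * nrm (y - x) by rewrite /D; ring.
  by rewrite ler_wpM2r// ltW.
have j5 : e / 2 / B * nrm (y - x) * (nrm (f x) + nrm (k x)) <= e / 2 * nrm (y - x).
  have -> : e / 2 / B * nrm (y - x) * (nrm (f x) + nrm (k x)) =
    (nrm (f x) + nrm (k x)) / B * (e / 2 * nrm (y - x)) by field; rewrite gt_eqF.
  apply: ler_piMl; first by apply: mulr_ge0 => //; clear -e0; lra.
  by rewrite ler_pdivrMr// /B; clear -fx0 kx0; lra.
clear -j1 j2 j3 j4 j5; lra.
Qed.

Lemma linearB0 (L : X -> Y) : linear L ->
  [/\ L 0 = 0, forall u v, L (u - v) = L u - L v, forall u v, L (u + v) = L u + L v
    & forall (a : C) u, L (a *: u) = a *: L u].
Proof.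
move=> lL; have L0 : L 0 = 0.
  by have := lL (-1) 0 0; rewrite scaler0 addr0 scaleN1r addNr.
split=> // [u v|u v|a u].
- by rewrite addrC -scaleN1r lL scaleN1r addrC.
- by have := lL 1 u v; rewrite !scale1r.
- by have := lL a u 0; rewrite L0 !addr0.
Qed.

Lemma tangent_unique f x L K : linear L -> linear K -> tangent f x L -> tangent f x K ->
  forall h, L h = K h.
Proof.
move=> lL lK fL fK h; apply/eqP; rewrite -subr_eq0; apply: contraT => n0.
have h0 : h != 0.
  apply/negP => /eqP hh; move: n0; rewrite hh; apply/negP; rewrite negbK.
  by case: (linearB0 lL) => -> _ _ _; case: (linearB0 lK) => -> _ _ _; rewrite subrr.
have nh := nrm_gt0 h0; have nn := nrm_gt0 n0.
(* With this [e], the two errors at [t h] add up to at most two thirds of [t |L h - K h|], which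
   contradicts the triangle inequality. *)
pose e := nrm (L h - K h) / (3 * nrm h).
have e0 : 0 < e by rewrite divr_gt0// mulr_gt0.
have [r r0 hr] := fL _ e0; have [s s0 hs] := fK _ e0.
pose t := Num.min r s / (2 * nrm h).
have m0 : 0 < Num.min r s by rewrite lt_min r0.
have t0 : 0 < t by rewrite divr_gt0// mulr_gt0.
have tnh : nrm (t%:C *: h) = Num.min r s / 2.
  by rewrite nrmZ nrm_real gtr0_norm// /t; field; rewrite gt_eqF.
have yx : x + t%:C *: h - x = t%:C *: h by rewrite addrC addKr.
have := hr (x + t%:C *: h); have := hs (x + t%:C *: h).
rewrite yx tnh.
have [m1 m2] : Num.min r s <= r /\ Num.min r s <= s by rewrite !ge_min !lexx orbT.
move=> /(_ ltac:(lra)) a1 /(_ ltac:(lra)) a2.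
have := nrmB (f (x + t%:C *: h) - f x - K (t%:C *: h)) (f (x + t%:C *: h) - f x - L (t%:C *: h)).
rewrite [X in nrm X](_ : _ = t%:C *: (L h - K h)); last first.
  case: (linearB0 lL) => _ _ _ ->; case: (linearB0 lK) => _ _ _ ->.
  by module_eq; ring.
rewrite nrmZ nrm_real gtr0_norm//.
have -> : t * nrm (L h - K h) = 3 * (e * (Num.min r s / 2)).
  by rewrite /t /e; field; rewrite gt_eqF.
have : 0 < e * (Num.min r s / 2) by rewrite mulr_gt0// divr_gt0.
by lra.
Qed.

End General.

Lemma scale_linear (Y : normedModType C) (d : Y) : linear (fun h : C^o => h *: d).
Proof. by move=> k u v; rewrite scalerDl -scalerA. Qed.

Lemma cderiv_cst (Y : normedModType C) (y : Y) a : cderiv (fun=> y) a 0.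
Proof.
apply: (tangent_ext _ _ (tangent_cst (X := C^o) y a)); first by exists 1.
by move=> h; rewrite scaler0.
Qed.

Section OneVariable.
Context {Y : normedModType C}.
Implicit Types (f g : C -> Y) (a : C).

Lemma cderiv_cont f a d : cderiv f a d -> cont_at (X := C^o) f a.
Proof. by move=> fd; apply: tangent_cont fd (bounded_scale d). Qed.

Lemma cderivD f g a d e : cderiv f a d -> cderiv g a e -> cderiv (fun z => f z + g z) a (d + e).
Proof.
move=> fd ge; apply: (tangent_ext _ _ (tangentD fd ge)); first by exists 1.
by move=> h; rewrite scalerDr.
Qed.

Lemma cderiv_scale (k : C -> C^o) f a c d : cderiv k a c -> cderiv f a d ->
  cderiv (fun z => k z *: f z) a (c *: f a + k a *: d).
Proof.
move=> kc fd.
apply: (tangent_ext _ _ (tangent_scale kc (bounded_scale _) fd (bounded_scale _))).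
  by exists 1.
by move=> h /=; rewrite scalerDr !scalerA [k a * h]mulrC.
Qed.

Lemma cderivZ (k : C) f a d : cderiv f a d -> cderiv (fun z => k *: f z) a (k *: d).
Proof. by move=> /(cderiv_scale (cderiv_cst (k : C^o) a)); rewrite scale0r add0r. Qed.

Lemma cderiv_comp (k : C -> C^o) f a c d : cderiv k a c -> cderiv f (k a) d ->
  cderiv (fun z => f (k z)) a (c *: d).
Proof.
move=> kc fd.
apply: (tangent_ext _ _ (tangent_comp (g := (f : C^o -> Y)) kc (bounded_scale _) fd
  (scale_linear _) (bounded_scale _))).
  by exists 1.
by move=> h /=; rewrite -scalerA.
Qed.

Lemma cderiv_eq f a d e : cderiv f a d -> d = e -> cderiv f a e.
Proof. by move=> ? <-. Qed.

Lemma cderiv_ext f g a d : (exists2 r : R, 0 < r & forall y, nrm (y - a) < r -> f y = g y) ->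
  cderiv f a d -> cderiv g a d.
Proof. by move=> fg; apply: tangent_ext. Qed.

Lemma cderiv_unique f a d e : cderiv f a d -> cderiv f a e -> d = e.
Proof.
move=> fd fe.
by have := tangent_unique (scale_linear d) (scale_linear e) fd fe 1; rewrite !scale1r.
Qed.

End OneVariable.

Lemma cderiv_id a : cderiv (Y := C^o) id a 1.
Proof.
move=> e e0; exists 1 => // z _.
by rewrite /= [_ *: _]mulr1 subrr nrm0 mulr_ge0 ?nrm_ge0// ltW.
Qed.

Lemma cderivM (f g : C -> C^o) a (c d : C) : cderiv f a c -> cderiv g a d ->
  cderiv (Y := C^o) (fun z => f z * g z) a (c * g a + f a * d).
Proof. exact: cderiv_scale. Qed.

Lemma cderiv_inv (a : C) : a != 0 -> cderiv (Y := C^o) (fun z => z^-1) a (- (a ^- 2)).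
Proof.
move=> a0 e e0; have na := nrm_gt0 a0.
(* The first bound gives [|z| >= |a| / 2]; the second then makes the exact remainder
   [(z - a)^2 / (a^2 z)] at most [e |z - a|]. *)
pose r := Num.min (nrm a / 2) (e * nrm a ^+ 3 / 2).
have e3 : 0 < e * nrm a ^+ 3 / 2 by rewrite divr_gt0// mulr_gt0// exprn_gt0.
exists r; first by rewrite lt_min divr_gt0.
move=> z; rewrite lt_min => /andP[h1 h2].
have nz : nrm a / 2 <= nrm z.
  have := nrmD (a - z) z; rewrite subrK nrmBC; lra.
have z0 : z != 0 by apply: contraTneq nz => ->; rewrite nrm0 -ltNge; lra.
have nz0 := nrm_gt0 z0.
rewrite [X in nrm X](_ : _ = (z - a) * ((z - a) * (a ^- 2 * z^-1))); last first.
  by rewrite /GRing.scale /=; field; rewrite z0.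
rewrite nrmM mulrC ler_wpM2r ?nrm_ge0// !nrmM !nrmV nrmX.
rewrite mulrA ler_pdivrMr// ler_pdivrMr ?exprn_gt0//.
have := ler_wpM2l (ltW e0) nz; have : 0 < nrm a ^+ 2 by rewrite exprn_gt0.
by rewrite exprS in h2 *; nra.
Qed.

End Derivatives.

(** * Goursat's theorem *)

Section Cousin.
Context {R : realType}.

Lemma half_expn_lt (d : R) : 0 < d -> exists n, 2^-1 ^+ n < d.
Proof.
move=> d0; exists (Num.truncn d^-1).
rewrite exprVn invf_plt ?posrE ?exprn_gt0//.
apply: (lt_le_trans (truncnS_gt _)).
by rewrite -natrX ler_nat ltn_expl.
Qed.

Lemma half_expn_mul (A e : R) : 0 <= A -> 0 < e ->
  exists N, forall n, (N <= n)%N -> A * 2^-1 ^+ n <= e.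
Proof.
move=> A0 e0; have [|N hN] := @half_expn_lt (e / (A + 1)); first by rewrite divr_gt0//; lra.
exists N => n Nn; have h : (2^-1 : R) ^+ n <= 2^-1 ^+ N.
  by rewrite ler_wiXn2l// ?invr_ge0// invf_le1// ler1n.
move: hN; rewrite ltr_pdivlMr; last lra.
have : 0 <= (2^-1 : R) ^+ n by rewrite exprn_ge0// invr_ge0.
by nra.
Qed.

Lemma nested_intervals (s l : nat -> R) :
  (forall n, s n <= s n.+1) -> (forall n, s n.+1 + l n.+1 <= s n + l n) ->
  (forall n, 0 <= l n) -> exists x, forall n, s n <= x <= s n + l n.
Proof.
move=> si sl l0.
have smono m n : (m <= n)%N -> s m <= s n.
  by move=> /subnK <-; elim: (n - m)%N => [|k ih]//; rewrite addSn (le_trans ih).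
have slmono m n : (m <= n)%N -> s n + l n <= s m + l m.
  by move=> /subnK <-; elim: (n - m)%N => [|k ih]//; rewrite addSn (le_trans (sl _)).
have sb m n : s m <= s n + l n.
  case: (leqP m n) => mn; first by rewrite (le_trans (smono _ _ mn))// lerDl.
  by rewrite (le_trans _ (slmono _ _ (ltnW mn)))// lerDl.
exists (sup (range s)) => n; apply/andP; split.
  by apply: ub_le_sup; [exists (s 0%N + l 0%N) => _ [m _ <-]|exists n].
by apply: ge_sup; [exists (s 0%N), 0%N|move=> _ [m _ <-]].
Qed.

(* Otherwise, repeated quartering produces a nested sequence of squares without P,
   and the squares close to their common point contradict the local hypothesis. *)
Lemma cousin_square (P : R -> R -> R -> Prop) :
  (forall s t l : R, 0 < l -> P s t (l / 2) -> P (s + l / 2) t (l / 2) ->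
     P s (t + l / 2) (l / 2) -> P (s + l / 2) (t + l / 2) (l / 2) -> P s t l) ->
  (forall s t : R, 0 <= s <= 1 -> 0 <= t <= 1 -> exists2 d : R, 0 < d &
     forall a b l : R, 0 < l < d -> a <= s <= a + l -> b <= t <= b + l ->
       0 <= a -> a + l <= 1 -> 0 <= b -> b + l <= 1 -> P a b l) ->
  P 0 0 1.
Proof.
move=> Pquarter Plocal; apply: contrapT => nP.
pose good (q : R * R) (l : R) := P q.1 q.2 l.
(* Selects the first quarter on which [P] fails. If three quarters are good, the last one has to be
   bad, so it is taken without a test. *)
pose next (q : R * R) (l : R) : R * R :=
  if pselect (good q (l / 2)) then
    if pselect (good (q.1 + l / 2, q.2) (l / 2)) then
      if pselect (good (q.1, q.2 + l / 2) (l / 2)) then (q.1 + l / 2, q.2 + l / 2)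
      else (q.1, q.2 + l / 2)
    else (q.1 + l / 2, q.2)
  else q.
pose len n : R := 2^-1 ^+ n.
have len0 n : 0 < len n by rewrite exprn_gt0// invr_gt0.
have lenS n : len n.+1 = len n / 2 by rewrite /len exprSr.
pose q := fix q n := if n is m.+1 then next (q m) (len m) else (0, 0).
have bad n : ~ good (q n) (len n).
  elim: n => [|n ih]; first by rewrite /good /len expr0.
  rewrite lenS /= /next.
  case: pselect => //= h1; case: pselect => //= h2; case: pselect => //= h3 h4.
  by apply: ih; apply: Pquarter.
have nextq n : ((q n.+1).1 = (q n).1 \/ (q n.+1).1 = (q n).1 + len n / 2) /\
               ((q n.+1).2 = (q n).2 \/ (q n.+1).2 = (q n).2 + len n / 2).
  rewrite /= /next; case: pselect => //= h1; last by split; left.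
  case: pselect => //= h2; last by split; [right|left].
  by case: pselect => //= h3; split; [right|right|left|right].
have l0 n : 0 < len n / 2 by rewrite divr_gt0.
have lh n : len n = len n / 2 + len n / 2 by rewrite -splitr.
have [s hs] : exists s, forall n, (q n).1 <= s <= (q n).1 + len n.
  apply: (nested_intervals _ _ (fun n => ltW (len0 n))) => n; rewrite ?lenS;
    have := l0 n; have := lh n; case: (nextq n).1 => ->; lra.
have [t ht] : exists t, forall n, (q n).2 <= t <= (q n).2 + len n.
  apply: (nested_intervals _ _ (fun n => ltW (len0 n))) => n; rewrite ?lenS;
    have := l0 n; have := lh n; case: (nextq n).2 => ->; lra.
have q01 n : (0 <= (q n).1 /\ (q n).1 + len n <= 1) /\
             (0 <= (q n).2 /\ (q n).2 + len n <= 1).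
  elim: n => [|n [[ih1 ih2] [ih3 ih4]]]; first by rewrite /= /len expr0 add0r.
  by rewrite lenS; have := l0 n; have := lh n; case: (nextq n) => [[->|->] [->|->]];
    split; lra.
have s01 : 0 <= s <= 1 by have := hs 0%N; rewrite /= /len expr0; lra.
have t01 : 0 <= t <= 1 by have := ht 0%N; rewrite /= /len expr0; lra.
have [d d0 hd] := Plocal s t s01 t01.
have [n nd] := half_expn_lt d0.
have [[a1 a2] [a3 a4]] := q01 n.
by apply: (bad n); apply: hd => //; rewrite len0.
Qed.

End Cousin.

Section Goursat.
Context {R : realType} {Y : normedModType R[i]}.
Local Notation C := R[i].

Definition lipschitz_path (g : R -> C) (L : R) :=
  forall x y, nrm (g x - g y) <= L * `|x - y|.

(** Left-endpoint Riemann sum of [f(z) dz] along [g] over [[a, a + l]]. The number of steps is a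
    power of 2, so that halving the interval is exact. *)
Definition path_sum (f : C -> Y) (g : R -> C) n (a l : R) : Y :=
  \sum_(k < 2 ^ n) (g (a + k.+1%:R * (l / 2 ^+ n)) - g (a + k%:R * (l / 2 ^+ n)))
    *: f (g (a + k%:R * (l / 2 ^+ n))).

Lemma path_sum_half f g n (a l : R) :
  path_sum f g n.+1 a l = path_sum f g n a (l / 2) + path_sum f g n (a + l / 2) (l / 2).
Proof.
rewrite /path_sum.
have e1 : (2 ^ n.+1 = 2 ^ n + 2 ^ n)%N by rewrite expnS mul2n addnn.
rewrite -(big_mkord predT (fun k => (g (a + k.+1%:R * (l / 2 ^+ n.+1)) -
  g (a + k%:R * (l / 2 ^+ n.+1))) *: f (g (a + k%:R * (l / 2 ^+ n.+1))))).
rewrite e1 (big_cat_nat (leq0n _) (leq_addr _ _)) /= big_mkord.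
have e2 : l / 2 ^+ n.+1 = l / 2 / 2 ^+ n by rewrite exprS invfM mulrA.
have p0 : (2 ^+ n : R) != 0 by rewrite expf_neq0.
congr (_ + _); first by rewrite e2.
rewrite -{1}[(2 ^ n)%N]add0n big_addn addnK big_mkord.
apply: eq_bigr => k _.
have e3 (j : nat) : a + (j + 2 ^ n)%:R * (l / 2 ^+ n.+1) =
    a + l / 2 + j%:R * (l / 2 / 2 ^+ n).
  by rewrite e2 natrD natrX; field; rewrite p0.
by rewrite -addSn !e3.
Qed.

(* [fa + (w - a) d] has the exact primitive [w fa + (w^2 / 2 - a w) d]; Riemann sums of an affine
   function miss its integral by the sum of the squares of the steps. *)
Lemma path_sum_affine f g (L : R) n (a l : R) (w0 : C) (fa d : Y) (E : R) :
  let Phi w := w *: fa + (w ^+ 2 / 2 - w0 * w) *: d in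
  0 <= L -> lipschitz_path g L -> 0 < l ->
  (forall x : R, a <= x <= a + l -> nrm (f (g x) - fa - (g x - w0) *: d) <= E) ->
  nrm (path_sum f g n a l - (Phi (g (a + l)) - Phi (g a)))
    <= L * l * E + (L * l) ^+ 2 * nrm d / 2 ^+ n.
Proof.
move=> Phi L0 gL l0 hE.
have p0 : (0 : R) < 2 ^+ n by rewrite exprn_gt0.
have ln0 : 0 <= l / 2 ^+ n by apply: divr_ge0; apply: ltW.
pose x k := a + k%:R * (l / 2 ^+ n).
have -> : Phi (g (a + l)) - Phi (g a) =
    \sum_(k < 2 ^ n) (Phi (g (x k.+1)) - Phi (g (x k))).
  rewrite -(big_mkord predT (fun k => Phi (g (x k.+1)) - Phi (g (x k)))).
  rewrite telescope_sumr// /x mul0r addr0.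
  suff -> : (2 ^ n)%:R * (l / 2 ^+ n) = l by [].
  by rewrite natrX mulrCA mulfV ?mulr1 ?gt_eqF.
rewrite /path_sum -sumrB.
have -> : L * l * E + (L * l) ^+ 2 * nrm d / 2 ^+ n = \sum_(k < 2 ^ n)
   (L * (l / 2 ^+ n) * E + (L * (l / 2 ^+ n)) ^+ 2 * nrm d).
  rewrite sumr_const card_ord -[RHS]mulr_natl natrX; field; by rewrite gt_eqF.
apply: (le_trans (nrm_sum _ _ _)); apply: ler_sum => k _.
rewrite -/(x k) -/(x k.+1).
have step : nrm (g (x k.+1) - g (x k)) <= L * (l / 2 ^+ n).
  apply: (le_trans (gL _ _)); rewrite ler_wpM2l// /x.
  rewrite [_ - _](_ : _ = l / 2 ^+ n); last by rewrite -natr1; field; rewrite gt_eqF.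
  by rewrite ger0_norm.
have xk : a <= x k <= a + l.
  rewrite /x; apply/andP; split; first by rewrite lerDl mulr_ge0.
  rewrite lerD2l mulrCA ger_pMr// ler_pdivrMr// mul1r -natrX ler_nat.
  exact: ltnW.
set w := g (x k); set w' := g (x k.+1).
have -> : (w' - w) *: f w - (Phi w' - Phi w) =
   (w' - w) *: (f w - fa - (w - w0) *: d) - ((w' - w) ^+ 2 / 2) *: d.
  by rewrite /Phi; module_eq; field.
apply: (le_trans (nrmB _ _)); rewrite !nrmZ nrmM nrmX nrmV nrm_nat.
have nd := nrm_ge0 d; have h2 := hE _ xk.
apply: lerD; first by apply: ler_pM => //; exact: nrm_ge0.
rewrite ler_wpM2r//.
have : nrm (w' - w) ^+ 2 <= (L * (l / 2 ^+ n)) ^+ 2.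
  by rewrite ler_pXn2r// ?nnegrE ?nrm_ge0// mulr_ge0.
by have := sqr_ge0 (nrm (w' - w)); lra.
Qed.

(** Riemann sums for the integral over the counterclockwise boundary of [[s, s + l] x [t, t + l]],
    carried along by [G]. All sides have the same level [n], so the inner sides of four quarters
    cancel exactly. *)
Definition square_sum (f : C -> Y) (G : R -> R -> C) n (s t l : R) : Y :=
  path_sum f (G^~ t) n s l + path_sum f (G (s + l)) n t l
  - path_sum f (G^~ (t + l)) n s l - path_sum f (G s) n t l.

Lemma square_sum_quarter f G n (s t l : R) :
  square_sum f G n.+1 s t l =
    square_sum f G n s t (l / 2) + square_sum f G n (s + l / 2) t (l / 2) +
    square_sum f G n s (t + l / 2) (l / 2) +
    square_sum f G n (s + l / 2) (t + l / 2) (l / 2).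
Proof.
rewrite /square_sum !path_sum_half.
have e (x : R) : x + l / 2 + l / 2 = x + l by rewrite -addrA -splitr.
by rewrite !e; module_eq; ring.
Qed.

(** The bound [e l^2] is additive under quartering, so it needs proof only on small squares around a
    given point. There [f] is affine up to an error [o(l)]; the affine part has a primitive, whose
    increments cancel around the square. *)
Lemma goursat f G (L : R) : 0 <= L ->
  (forall t : R, lipschitz_path (G^~ t) L) -> (forall s : R, 0 <= s <= 1 -> lipschitz_path (G s) L) ->
  (forall s t : R, 0 <= s <= 1 -> 0 <= t <= 1 -> exists d, cderiv f (G s t) d) ->
  forall e : R, 0 < e ->
    exists N, forall n, (N <= n)%N -> nrm (square_sum f G n 0 0 1) <= e.
Proof.
move=> L0 LG1 LG2 fd e e0.
have [N hN] : exists N, forall n, (N <= n)%N ->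
    nrm (square_sum f G n 0 0 1) <= e * 1 ^+ 2; last first.
  by exists N => n /hN; rewrite expr1n mulr1.
apply: (cousin_square (P := fun s t l : R => exists N, forall n, (N <= n)%N ->
  nrm (square_sum f G n s t l) <= e * l ^+ 2)).
  move=> s t l l0 [N1 h1] [N2 h2] [N3 h3] [N4 h4].
  (* Each quartering uses up one level of subdivision, hence the successor. *)
  exists (maxn (maxn N1 N2) (maxn N3 N4)).+1 => -[//|n].
  rewrite ltnS !geq_max => /andP[/andP[n1 n2] /andP[n3 n4]].
  rewrite square_sum_quarter.
  have -> : e * l ^+ 2 = e * (l / 2) ^+ 2 + e * (l / 2) ^+ 2 + e * (l / 2) ^+ 2 +
    e * (l / 2) ^+ 2 by field.
  apply: (le_trans (nrmD _ _)); apply: lerD (h4 _ n4).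
  apply: (le_trans (nrmD _ _)); apply: lerD (h3 _ n3).
  by apply: (le_trans (nrmD _ _)); apply: lerD (h1 _ n1) (h2 _ n2).
move=> s t s01 t01; have [d hd] := fd _ _ s01 t01.
(* The four sides contribute [4 L l E = 8 L^2 (e / K) l^2], at most [(e / 2) l^2] for this [K]. The
   other half of [e l^2] is for the discretization error, made small by [N]. *)
pose K := 16 * L ^+ 2 + 1.
have K0 : 0 < K by rewrite ltr_wpDl// mulr_ge0// sqr_ge0.
have eK : 0 < e / K by rewrite divr_gt0.
have [r r0 hr] := hd _ eK.
exists (r / (2 * L + 1)); first by rewrite divr_gt0// ltr_wpDl// mulr_ge0.
move=> a b l /andP[l0 ld] sa tb a0 al1 _ _.
have Ll : 2 * L * l < r.
  apply: (@le_lt_trans _ _ ((2 * L + 1) * l)); first by rewrite ler_pM2r//; lra.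
  by rewrite mulrC -ltr_pdivlMr// ltr_wpDl// mulr_ge0.
have near x y : a <= x <= a + l -> b <= y <= b + l ->
    nrm (G x y - G s t) <= 2 * L * l.
  move=> xa yb; apply: (le_trans (nrm_tri (G s y) _ _)).
  have h1 : `|x - s| <= l by rewrite ler_norml; lra.
  have h2 : `|y - t| <= l by rewrite ler_norml; lra.
  have := LG1 y x s; have := LG2 s s01 y t.
  have := ler_wpM2l L0 h1; have := ler_wpM2l L0 h2; lra.
pose E := e / K * (2 * L * l).
have err x y : a <= x <= a + l -> b <= y <= b + l ->
    nrm (f (G x y) - f (G s t) - (G x y - G s t) *: d) <= E.
  move=> xa yb; have h := near _ _ xa yb.
  apply: (le_trans (hr _ _)); first exact: le_lt_trans h Ll.
  by rewrite ler_pM2l.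
have q0 : 0 <= L ^+ 2 * nrm d by rewrite mulr_ge0 ?sqr_ge0 ?nrm_ge0.
have [N hN] := @half_expn_mul R (4 * (L ^+ 2 * nrm d)) (e / 2) (mulr_ge0 (ler0n R 4) q0) (divr_gt0 e0 (ltr0Sn R 1)).
exists N => n Nn.
pose Phi w := w *: f (G s t) + (w ^+ 2 / 2 - G s t * w) *: d.
pose B := L * l * E + (L * l) ^+ 2 * nrm d / 2 ^+ n.
have [a01 al01] : 0 <= a <= 1 /\ 0 <= a + l <= 1 by clear -a0 al1 l0; split; lra.
have al : a <= a + l by rewrite lerDl ltW.
have bl : b <= b + l by rewrite lerDl ltW.
have ea : a <= a <= a + l by rewrite lexx.
have ea' : a <= a + l <= a + l by rewrite lexx al.
have eb : b <= b <= b + l by rewrite lexx.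
have eb' : b <= b + l <= b + l by rewrite lexx bl.
have p1 := path_sum_affine n L0 (LG1 b) l0 (fun x xa => err x b xa eb).
have p2 := path_sum_affine n L0 (LG2 (a + l) al01) l0 (fun y yb => err _ y ea' yb).
have p3 := path_sum_affine n L0 (LG1 (b + l)) l0 (fun x xa => err x _ xa eb').
have p4 := path_sum_affine n L0 (LG2 a a01) l0 (fun y yb => err _ y ea yb).
rewrite -/B /= -!/(Phi _) in p1 p2 p3 p4.
have -> : square_sum f G n a b l =
   (path_sum f (G^~ b) n a l - (Phi (G (a + l) b) - Phi (G a b)))
   + (path_sum f (G (a + l)) n b l - (Phi (G (a + l) (b + l)) - Phi (G (a + l) b)))
   - (path_sum f (G^~ (b + l)) n a l - (Phi (G (a + l) (b + l)) - Phi (G a (b + l))))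
   - (path_sum f (G a) n b l - (Phi (G a (b + l)) - Phi (G a b))).
  by rewrite /square_sum; move: (Phi) => Phi'; module_eq; ring.
have B4 : 4 * B <= e * l ^+ 2.
  have -> : 4 * B = 8 * L ^+ 2 / K * (e * l ^+ 2) +
      4 * (L ^+ 2 * nrm d) * 2^-1 ^+ n * l ^+ 2.
    by rewrite /B /E exprVn; field; rewrite expf_neq0//= gt_eqF.
  have h1 : 8 * L ^+ 2 / K <= 1 / 2.
    by rewrite ler_pdivrMr// /K; have h := sqr_ge0 L; clear -h; lra.
  have h2 := hN n Nn.
  have l2 := sqr_ge0 l.
  have := ler_wpM2r (mulr_ge0 (ltW e0) l2) h1.
  by have := ler_wpM2r l2 h2; clear -l2; lra.
apply: (le_trans (nrmB _ _)).
apply: (le_trans (lerD (nrmB _ _) (lexx _))).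
apply: (le_trans (lerD (lerD (nrmD _ _) (lexx _)) (lexx _))).
clear -B4 p1 p2 p3 p4; lra.
Qed.

End Goursat.

(** * Cauchy's formula as a limit of averages *)

Section Circle.
Context {R : realType}.
Local Notation C := R[i].

Definition cis (x : R) : C := Complex (cos x) (sin x).

Lemma cis0 : cis 0 = 1.
Proof. by rewrite /cis cos0 sin0. Qed.

Lemma cisD x y : cis (x + y) = cis x * cis y.
Proof.
apply/eqP; rewrite /cis eq_complex /= cosD sinD; apply/andP; split; apply/eqP; ring.
Qed.

Lemma nrm_cis x : nrm (cis x) = 1.
Proof.
by apply/eqP; rewrite -(@eqrXn2 _ 2) ?nrm_ge0 ?ler01// sqr_nrm /= cos2Dsin2 expr1n.
Qed.

Lemma mvt (f df : R -> R) : (forall x : R, is_derive x (1 : R) f (df x)) ->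
  forall x y, exists2 c, `|c - y| <= `|x - y| & f x - f y = df c * (x - y).
Proof.
move=> fdf.
have h a b : a <= b -> exists2 c, a <= c <= b & f b - f a = df c * (b - a).
  move=> ab; have [|c] := MVT_segment ab (fun x _ => fdf x).
    by apply: derivable_within_continuous => x _; case: (fdf x).
  by rewrite in_itv /= => cab e; exists c.
move=> x y; case: (leP y x) => [/h|/ltW/h] [c cxy e]; exists c => //.
- by rewrite !ger0_norm; lra.
- by rewrite !ler0_norm; lra.
- by rewrite -opprB e; ring.
Qed.

Lemma cis_lipschitz x y : nrm (cis x - cis y) <= 2 * `|x - y|.
Proof.
apply: (le_trans (nrm_le_ReIm _)); rewrite /=.
have [c _ ->] := mvt (@is_derive_cos R) x y; have [d _ ->] := mvt (@is_derive_sin R) x y.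
rewrite !normrM normrN.
have := ler_wpM2r (normr_ge0 (x - y)) (sin_max c).
by have := ler_wpM2r (normr_ge0 (x - y)) (cos_max d); lra.
Qed.

Lemma cis_2pi x : cis (x + 2 * pi) = cis x.
Proof. by rewrite /cis mulr_natl cosD2pi sinD2pi. Qed.

(** The [2 ^ n]-th roots of unity, left unsimplified so as to match the sample points of [path_sum]
    on [[0, 1]]. *)
Definition circ n (k : nat) : C := cis (2 * pi * (0 + k%:R * (1 / 2 ^+ n))).

Lemma nrm_circ n k : nrm (circ n k) = 1.
Proof. exact: nrm_cis. Qed.

Lemma circS n k : circ n k.+1 = circ n 1 * circ n k.
Proof. by rewrite /circ -cisD -natr1; congr cis; ring. Qed.

Lemma circE n k : circ n k = circ n 1 ^+ k.
Proof.
elim: k => [|k ih]; last by rewrite circS ih exprS.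
by rewrite /circ mul0r addr0 mulr0 cis0 expr0.
Qed.

(* The chord polygon with [2 ^ n] vertices reaches [-1] after [2 ^ (n - 1)] steps. *)
Lemma nrm_circ1_sub n : 4 <= 2 ^+ n.+1 * nrm (circ n.+1 1 - 1).
Proof.
have hpi : circ n.+1 (2 ^ n) = - 1.
  rewrite /circ add0r natrX.
  have -> : 2 * pi * (2 ^+ n * (1 / 2 ^+ n.+1)) = pi :> R.
    by rewrite exprS; field; rewrite expf_neq0.
  by rewrite /cis cospi sinpi; apply/eqP; rewrite eq_complex /= oppr0 !eqxx.
have step m : nrm (circ n.+1 m - 1) <= m%:R * nrm (circ n.+1 1 - 1).
  elim: m => [|m ih]; first by rewrite circE expr0 subrr nrm0 mul0r.
  apply: (le_trans (nrm_tri (circ n.+1 m) _ _)).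
  rewrite -natr1 mulrDl mul1r addrC lerD//.
  rewrite circS -[X in _ - X]mul1r -mulrBl nrmM nrm_circ mulr1.
  exact: lexx.
have := step (2 ^ n)%N; rewrite hpi.
rewrite -opprD nrmN -(natrD _ 1 1) nrm_nat natrX exprS; lra.
Qed.

End Circle.

Section Average.
Context {R : realType}.
Local Notation C := R[i].

Definition seqlim {Y : normedModType C} (u : nat -> Y) (l : Y) : Prop :=
  forall e : R, 0 < e -> exists N, forall n, (N <= n)%N -> nrm (u n - l) <= e.

Definition avg {Y : normedModType C} (f : C -> Y) (n : nat) : Y :=
  (2 ^+ n)^-1 *: \sum_(k < 2 ^ n) f (circ n k).

Section AverageModule.
Context {Y : normedModType C}.
Implicit Types (f g : C -> Y) (u v : nat -> Y).

Lemma seqlimD u v l m : seqlim u l -> seqlim v m -> seqlim (fun n => u n + v n) (l + m).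
Proof.
move=> ul vm e e0; have [N hN] := ul (e / 2) ltac:(lra).
have [M hM] := vm (e / 2) ltac:(lra).
exists (maxn N M) => n; rewrite geq_max => /andP[/hN h1 /hM h2].
rewrite [X in nrm X](_ : _ = (u n - l) + (v n - m)); last by module_eq; ring.
by have := nrmD (u n - l) (v n - m); lra.
Qed.

Lemma seqlimZ (a : C) u l : seqlim u l -> seqlim (fun n => a *: u n) (a *: l).
Proof.
move=> ul e e0; have a0 := nrm_ge0 a.
have [|N hN] := ul (e / (nrm a + 1)); first by rewrite divr_gt0//; lra.
exists N => n /hN; rewrite -scalerBr nrmZ ler_pdivlMr. 2: lra.
move=> h; apply: le_trans h; rewrite mulrC ler_wpM2l ?nrm_ge0//; lra.
Qed.

Lemma seqlim_cst (l : Y) : seqlim (fun=> l) l.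
Proof. by move=> e e0; exists 0%N => n _; rewrite subrr nrm0 ltW. Qed.

Lemma seqlim_le u l (M : R) N0 :
  (forall n, (N0 <= n)%N -> nrm (u n) <= M) -> seqlim u l -> nrm l <= M.
Proof.
move=> uM ul; apply/ler_addgt0Pr => e e0; have [N hN] := ul e e0.
have h1 := hN _ (leq_maxl N N0); have h2 := uM _ (leq_maxr N N0).
rewrite -[l](subrK (u (maxn N N0))).
by have := nrmD (l - u (maxn N N0)) (u (maxn N N0)); rewrite nrmBC; lra.
Qed.

Lemma seqlim_eq u v l : (forall n, u n = v n) -> seqlim u l -> seqlim v l.
Proof. by move=> uv ul e /ul[N hN]; exists N => n /hN; rewrite uv. Qed.

Lemma seqlim_unique u l m : seqlim u l -> seqlim u m -> l = m.
Proof.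
move=> ul um; apply/eqP; rewrite -subr_eq0; apply/eqP/nrm_eq0/eqP.
rewrite eq_le nrm_ge0 andbT; apply/ler_addgt0Pr => e e0.
have [N hN] := ul (e / 2) ltac:(lra); have [M hM] := um (e / 2) ltac:(lra).
have h1 := hN _ (leq_maxl N M); have h2 := hM _ (leq_maxr N M).
by have := nrm_tri (u (maxn N M)) l m; rewrite (nrmBC l (u _)); lra.
Qed.

Lemma avg_eq f g n : (forall w, nrm w = 1 -> f w = g w) -> avg f n = avg g n.
Proof.
by move=> fg; rewrite /avg; congr (_ *: _); apply: eq_bigr => k _; rewrite fg// nrm_circ.
Qed.

Lemma avgD f g n : avg (fun w => f w + g w) n = avg f n + avg g n.
Proof. by rewrite /avg big_split scalerDr. Qed.

Lemma avgZ (a : C) f n : avg (fun w => a *: f w) n = a *: avg f n.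
Proof.
rewrite /avg [X in _ *: X](_ : _ = a *: \sum_(k < 2 ^ n) f (circ n k)).
  by rewrite !scalerA mulrC.
by rewrite scaler_sumr.
Qed.

Lemma expn2_neq0 n : (2 ^+ n : C) != 0.
Proof. by rewrite expf_neq0. Qed.

Lemma avg_cst (y : Y) n : avg (fun=> y) n = y.
Proof.
rewrite /avg sumr_const card_ord.
rewrite [y *+ _](_ : _ = (2 ^ n)%:R *: y); last by rewrite scaler_nat.
by rewrite scalerA natrX mulVf ?expn2_neq0// scale1r.
Qed.

Lemma nrm_avg f n (M : R) : (forall w, nrm w = 1 -> nrm (f w) <= M) -> nrm (avg f n) <= M.
Proof.
move=> fM; rewrite /avg nrmZ nrmV nrmX nrm_nat ler_pdivrMl ?exprn_gt0//.
apply: (le_trans (nrm_sum _ _ _)).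
apply: (@le_trans _ _ (\sum_(k < 2 ^ n) M)).
  by apply: ler_sum => k _; apply: fM; rewrite nrm_circ.
by rewrite sumr_const card_ord -[leLHS]mulr_natl natrX.
Qed.

(** All steps of the inscribed polygon are [rho w] times the same number [circ n 1 - 1]. The Riemann
    sum is therefore an average times a factor that depends on neither [f] nor the circle; a lower
    bound for that factor is enough to compare two circles. *)
Lemma path_sum_circle f (a rho : C) n :
  path_sum f (fun t => a + rho * cis (2 * pi * t)) n 0 1 =
  (2 ^+ n * (circ n 1 - 1)) *: avg (fun w => (rho * w) *: f (a + rho * w)) n.
Proof.
rewrite /avg scalerA mulrAC mulfV ?expn2_neq0// mul1r scaler_sumr.
apply: eq_bigr => k _; rewrite -/(circ n k) -/(circ n k.+1) (circS n k) scalerA; congr (_ *: _).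
by ring.
Qed.

(* Goursat's theorem for the annulus between the circle of radius [r] and a small circle
   around [a], swept out by the linear homotopy between them. *)
Theorem cauchy_mean f (a : C) (r : R) : nrm a < r ->
  (forall z, nrm z <= r -> z != a -> exists d, cderiv f z d) -> cont_at (X := C^o) f a ->
  seqlim (avg (fun w => (r%:C * w / (r%:C * w - a)) *: f (r%:C * w))) (f a).
Proof.
move=> ar fd fa e e0.
have [d0 d00 hd0] := fa (e / 2) ltac:(lra).
(* The small circle lies where [f] is within [e / 2] of [f a], and inside the closed disc of radius
   [r]. *)
pose d := Num.min (d0 / 2) (r - nrm a).
have dlt : 0 < d by rewrite lt_min; apply/andP; split; lra.
have dd0 : d < d0 by rewrite gt_min; apply/orP; left; lra.
have dr : nrm a + d <= r.
  have : d <= r - nrm a by rewrite ge_min lexx orbT.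
  lra.
have r0 : 0 < r by have := nrm_ge0 a; lra.
pose rho (s : R) : C := ((1 - s) * r + s * d)%:C.
pose G (s t : R) : C := s%:C * a + rho s * cis (2 * pi * t).
pose g (z : C) := (z - a)^-1 *: f z.
pose L := nrm a + r + d + 4 * pi * r.
have pi0 : 0 < pi :> R := pi_gt0 R.
have pr0 : 0 < pi * r by rewrite mulr_gt0.
have na := nrm_ge0 a.
have L0 : 0 <= L by rewrite /L; lra.
have LG1 t : lipschitz_path (G^~ t) L.
  move=> x y; rewrite /= /G /rho.
  rewrite [X in nrm X](_ : _ = (x - y)%:C * (a + (d - r)%:C * cis (2 * pi * t))); last first.
    by rewrite !(rmorphD, rmorphB, rmorphM) /= rmorph1; ring.
  rewrite nrmM nrm_real mulrC ler_wpM2r//.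
  apply: (le_trans (nrmD _ _)); rewrite nrmM nrm_cis mulr1 nrm_real.
  have : `|d - r| <= d + r by rewrite ler_norml; lra.
  rewrite /L; lra.
have LG2 s : 0 <= s <= 1 -> lipschitz_path (G s) L.
  move=> /andP[s0 s1] x y; rewrite /= /G.
  rewrite [X in nrm X](_ : _ = rho s * (cis (2 * pi * x) - cis (2 * pi * y))); last by ring.
  rewrite nrmM nrm_real.
  have dler : d <= r by lra.
  have h1 : `|(1 - s) * r + s * d| <= r by rewrite ger0_norm; nra.
  have h2 := cis_lipschitz (2 * pi * x) (2 * pi * y).
  have h3 : `|2 * pi * x - 2 * pi * y| = 2 * pi * `|x - y|.
    by rewrite -mulrBr normrM ger0_norm//; lra.
  rewrite h3 in h2.
  have h4 : 0 <= `|x - y| by [].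
  apply: (@le_trans _ _ (r * (2 * (2 * pi * `|x - y|)))).
    by apply: ler_pM => //; exact: nrm_ge0.
  have -> : r * (2 * (2 * pi * `|x - y|)) = 4 * (pi * r) * `|x - y| by ring.
  by rewrite ler_wpM2r// /L; lra.
(* [G s t - a = rho s * cis (2 pi t) - (1 - s) a], and [rho s = (1 - s) r + s d] exceeds
   [(1 - s) |a|]: the homotopy never meets [a]. *)
have Ga s t : 0 <= s <= 1 -> G s t != a /\ nrm (G s t) <= r.
  move=> /andP[s0 s1].
  have sr : 0 <= (1 - s) * r + s * d by nra.
  split.
    rewrite -subr_eq0 /G.
    apply/eqP => h0.
    have : rho s * cis (2 * pi * t) = (1 - s)%:C * a.
      apply/eqP; rewrite -subr_eq0 -h0; apply/eqP.
      by rewrite rmorphB rmorph1; ring.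
    move=> /(congr1 nrm); rewrite !nrmM nrm_cis mulr1 !nrm_real !ger0_norm ?subr_ge0//.
    nra.
  apply: (le_trans (nrmD _ _)); rewrite !nrmM nrm_cis mulr1 !nrm_real !ger0_norm//.
  nra.
have gd s t : 0 <= s <= 1 -> 0 <= t <= 1 -> exists d, cderiv g (G s t) d.
  move=> s01 _; have [Gna Gr] := Ga s t s01.
  have [c hc] := fd _ Gr Gna.
  have kd : cderiv (Y := C^o) (fun z => z - a) (G s t) 1.
    by apply: (cderiv_eq (cderivD (cderiv_id _) (cderiv_cst (- a : C^o) _))); rewrite addr0.
  have := cderiv_comp kd (cderiv_inv _); rewrite subr_eq0 => /(_ Gna) kd'.
  by eexists; apply: (cderiv_scale kd' hc).
have [N hN] := goursat L0 LG1 LG2 gd (e := 2 * e) ltac:(lra).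
exists N.+1 => -[//|n]; rewrite ltnS => Nn.
have := hN n.+1 ltac:(exact: leqW).
have G0 : G 0 = fun t => 0 + r%:C * cis (2 * pi * t).
  by apply/funext => t; rewrite /G /rho; congr (_ + _%:C * _); rewrite ?rmorph0 ?mul0r//; ring.
have G1 : G (0 + 1) = fun t => a + d%:C * cis (2 * pi * t).
  by apply/funext => t; rewrite /G /rho add0r rmorph1 mul1r; congr (_ + _%:C * _); ring.
(* By periodicity the two radial sides coincide, and their contributions cancel. *)
have Gper : G^~ (0 + 1) = G^~ 0.
  by apply/funext => s; rewrite /G add0r mulr1 mulr0 -[X in cis X]add0r cis_2pi.
rewrite /square_sum Gper G0 G1 !path_sum_circle.
set om := _ * (_ - 1).
set A := avg _ _; set B := avg _ _.
have -> : path_sum g (G^~ 0) n.+1 0 1 + om *: A - path_sum g (G^~ 0) n.+1 0 1 - om *: B =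
  om *: (A - B) by module_eq; ring.
have -> : B = avg (fun w => (r%:C * w / (r%:C * w - a)) *: f (r%:C * w)) n.+1.
  by apply: avg_eq => w _; rewrite /g add0r scalerA.
set B' := avg _ _.
have -> : A = avg (fun w => f (a + d%:C * w)) n.+1.
  apply: avg_eq => w w1; rewrite /g scalerA addrC addrA addNr add0r mulfV ?scale1r//.
  exact: circle_neq0.
have hA : nrm (avg (fun w => f (a + d%:C * w)) n.+1 - f a) <= e / 2.
  rewrite -[X in _ - X](avg_cst (f a) n.+1) -scaleN1r -avgZ -avgD.
  apply: nrm_avg => w w1; rewrite scaleN1r; apply: hd0.
  by rewrite addrC addKr nrmM w1 mulr1 nrm_real gtr0_norm.
move: hA; set A' := avg _ _ => hA.
rewrite nrmZ nrmM nrmX nrm_nat => h.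
have h4 := @nrm_circ1_sub R n.
have hB : nrm (A' - B') <= e / 2.
  have := nrm_ge0 (A' - B'); nra.
by have := nrm_tri A' B' (f a); rewrite (nrmBC B' A'); lra.
Qed.

End AverageModule.
End Average.

(** * Cauchy estimates *)

Section CauchyEstimates.
Context {R : realType} {Y : normedModType R[i]}.
Local Notation C := R[i].
Implicit Types f : C -> Y.

Definition holo_disc f (r : R) := forall z, nrm z <= r -> exists d, cderiv f z d.

Lemma cauchy_mean0 f (r : R) : 0 < r ->
  (forall z, nrm z <= r -> z != 0 -> exists d, cderiv f z d) -> cont_at (X := C^o) f 0 ->
  seqlim (avg (fun w => f (r%:C * w))) (f 0).
Proof.
move=> r0 fd f0.
have := @cauchy_mean R Y f 0 r; rewrite nrm0 => /(_ r0 fd f0).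
apply: seqlim_eq => n; apply: avg_eq => w w1.
by rewrite subr0 mulfV ?scale1r ?circle_neq0.
Qed.

(** The divided difference at 0, completed by the derivative: differentiable off 0 and continuous at
    0, which is exactly what [cauchy_mean0] asks for. *)
Definition dslope f (d : Y) (z : C) : Y := if z == 0 then d else z^-1 *: (f z - f 0).

Lemma dslope_deriv f d z : z != 0 -> (exists c, cderiv f z c) ->
  exists c, cderiv (dslope f d) z c.
Proof.
move=> z0 [c fc].
have h := cderiv_scale (cderiv_inv z0) (cderivD fc (cderiv_cst (- f 0) z)).
eexists; apply: (cderiv_ext _ h); exists (nrm z); first exact: nrm_gt0.
move=> y; rewrite nrmBC => yz; rewrite /dslope ifN//.
by apply: contraTneq yz => ->; rewrite subr0 ltxx.
Qed.

Lemma dslope_cont f d : cderiv f 0 d -> cont_at (X := C^o) (dslope f d) 0.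
Proof.
move=> fd e e0; have [r r0 hr] := fd e e0; exists r => // z.
rewrite /dslope eqxx subr0; have [-> _|z0] := eqVneq z 0; first by rewrite subrr nrm0 ltW.
have nz := nrm_gt0 z0.
move=> zr; have := hr z; rewrite subr0 => /(_ zr).
have -> : f z - f 0 - z *: d = z *: (z^-1 *: (f z - f 0) - d).
  by rewrite scalerBr scalerA mulfV// scale1r.
by rewrite nrmZ mulrC ler_pM2r.
Qed.

Lemma dslope_mean f d (r : R) : 0 < r -> holo_disc f r -> cderiv f 0 d ->
  seqlim (avg (fun w => (r%:C * w)^-1 *: (f (r%:C * w) - f 0))) d.
Proof.
move=> r0 fr fd.
have h := cauchy_mean0 r0 (fun z zr z0 => dslope_deriv d z0 (fr z zr)) (dslope_cont fd).
rewrite [X in seqlim _ X](_ : _ = d) in h; last by rewrite /dslope eqxx.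
apply: seqlim_eq h => n; apply: avg_eq => w w1; by rewrite /dslope ifN ?circle_neq0.
Qed.

Lemma cauchy_bound0 f (r M : R) : 0 < r -> holo_disc f r ->
  (forall z, nrm z = r -> nrm (f z) <= M) -> nrm (f 0) <= M.
Proof.
move=> r0 fr fM.
have [d fd] : exists d, cderiv f 0 d by apply: fr; rewrite nrm0 ltW.
apply: (@seqlim_le _ _ _ _ _ 0) (cauchy_mean0 r0 (fun z zr _ => fr z zr) (cderiv_cont fd)).
move=> n _; apply: nrm_avg => w w1; apply: fM.
by rewrite nrmM w1 mulr1 nrm_real gtr0_norm.
Qed.

Lemma cauchy_bound1 f (r M : R) (d : Y) : 0 < r -> holo_disc f r ->
  (forall z, nrm z = r -> nrm (f z) <= M) -> cderiv f 0 d -> nrm d <= 2 * M / r.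
Proof.
move=> r0 fr fM fd.
have f0 := cauchy_bound0 r0 fr fM.
apply: (@seqlim_le _ _ _ _ _ 0) (dslope_mean r0 fr fd).
move=> n _; apply: nrm_avg => w w1.
have nz : nrm (r%:C * w) = r by rewrite nrmM w1 mulr1 nrm_real gtr0_norm.
have ri : 0 <= r^-1 by rewrite invr_ge0 ltW.
rewrite nrmZ nrmV nz mulrC ler_wpM2r//.
by apply: (le_trans (nrmB _ _)); have := fM _ nz; lra.
Qed.

(** For [g = f - f 0 - z d], the averages of [g] and of [g / z] tend to 0, so they may be subtracted
    from Cauchy's formula for [g a]. This replaces the kernel by [z / (z - a) - 1 - a / z = a^2 / (z
    (z - a))], of second order in [a]. On the circle [|g| <= 4 M] and [|z - a| >= r / 2], whence the
    constant 8. *)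
Lemma cauchy_bound2 f (r M : R) (d : Y) (a : C) : 0 < r -> holo_disc f r ->
  (forall z, nrm z = r -> nrm (f z) <= M) -> cderiv f 0 d -> nrm a <= r / 2 ->
  nrm (f a - f 0 - a *: d) <= 8 * M * nrm a ^+ 2 / r ^+ 2.
Proof.
move=> r0 fr fM fd ar.
pose g z := f z + (- f 0) + - (z *: d).
have gd z c : cderiv f z c -> cderiv g z (c + 0 + - d).
  move=> fc; apply: cderivD; first by apply: cderivD => //; exact: cderiv_cst.
  have := cderivZ (-1) (cderiv_scale (cderiv_id z) (cderiv_cst d z)).
  rewrite scaler0 addr0 scale1r scaleN1r; apply: cderiv_ext; exists 1 => // y _.
  by rewrite scaleN1r.
have gr : holo_disc g r by move=> z /fr[c /gd]; eexists; eassumption.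
have g0 : g 0 = 0 by rewrite /g scale0r subr0 subrr.
have gd0 : cderiv g 0 0 by apply: (cderiv_eq (gd _ _ fd)); rewrite addr0 subrr.
have f0 := cauchy_bound0 r0 fr fM.
have d0 := cauchy_bound1 r0 fr fM fd.
have M0 : 0 <= M by have := nrm_ge0 (f 0); lra.
have gM z : nrm z = r -> nrm (g z) <= 4 * M.
  move=> zr; apply: (le_trans (nrmB _ _)).
  apply: (le_trans (lerD (nrmB _ _) (lexx _))); rewrite nrmZ zr.
  have := fM _ zr; have : r * nrm d <= 2 * M by rewrite mulrC -ler_pdivlMr.
  lra.
have ar' : nrm a < r by lra.
have ca : cont_at (X := C^o) g a.
  by have [c fc] := fr a (ltW ar'); exact: cderiv_cont (gd _ _ fc).
have c0 : cont_at (X := C^o) g 0 by exact: cderiv_cont gd0.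
have l1 := cauchy_mean ar' (fun z zr _ => gr z zr) ca.
have l2 := cauchy_mean0 r0 (fun z zr _ => gr z zr) c0.
have l3 := dslope_mean r0 gr gd0.
rewrite g0 in l2 l3.
have := seqlimD (seqlimD l1 (seqlimZ (-1) l2)) (seqlimZ (- a) l3).
rewrite !scaler0 !addr0 => l4.
have -> : f a - f 0 - a *: d = g a by [].
apply: (@seqlim_le _ _ _ _ _ 0) l4 => n _.
rewrite -!avgZ -!avgD; apply: nrm_avg => w w1.
have nz : nrm (r%:C * w) = r by rewrite nrmM w1 mulr1 nrm_real gtr0_norm.
set z := r%:C * w in nz *.
have z0 : z != 0 by apply/eqP => h; move: nz; rewrite h nrm0; lra.
have nza : r / 2 <= nrm (z - a).
  by have := nrmD (z - a) a; rewrite subrK nz; lra.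
have za0 : z - a != 0 by apply/eqP => h; move: nza; rewrite h nrm0; lra.
rewrite subr0.
have -> : (z / (z - a)) *: g z + -1 *: g z + - a *: (z^-1 *: g z) =
  (a ^+ 2 * (z^-1 * (z - a)^-1)) *: g z.
  by module_eq; field; rewrite ?z0 ?za0.
rewrite nrmZ nrmM nrmX nrmM !nrmV nz.
have h1 : (nrm (z - a))^-1 <= (r / 2)^-1 by rewrite lef_pV2 ?posrE//; lra.
have h2 := gM _ nz.
have -> : 8 * M * nrm a ^+ 2 / r ^+ 2 = nrm a ^+ 2 * (r^-1 * (r / 2)^-1) * (4 * M).
  by field; rewrite gt_eqF.
have ri : 0 <= r^-1 by rewrite invr_ge0 ltW.
apply: ler_pM; [|exact: nrm_ge0| |exact: h2].
- by rewrite !mulr_ge0 ?sqr_ge0 ?invr_ge0 ?nrm_ge0 ?(ltW r0).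
- by rewrite ler_wpM2l ?sqr_ge0// ler_wpM2l.
Qed.

End CauchyEstimates.

(** * Completeness and limits of sequences *)

Section Complete.
Context {R : realType} {Y : completeNormedModType R[i]}.

Lemma seqlim_cauchy (u : nat -> Y) :
  (forall e : R, 0 < e -> exists N, forall m n, (N <= m)%N -> (N <= n)%N ->
     nrm (u m - u n) <= e) -> exists l, seqlim u l.
Proof.
move=> uc.
have real_gt0 (e : R[i]) : 0 < e -> 0 < complex.Re e /\ e = (complex.Re e)%:C.
  rewrite ltcE /= => /andP[/eqP h1 h2]; split=> //.
  by case: e h1 h2 => a b /= -> _.
have cu : cauchy (u @ \oo).
  apply: cauchy_exP => e /real_gt0[e0 ee].
  have [N hN] := uc (complex.Re e / 2) ltac:(lra).
  exists (u N), N => // n /= Nn.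
  rewrite -ball_normE /ball_ /= normE ee ltcR.
  have := hN N n (leqnn _) Nn; lra.
have /cvgrPdist_le ul : u @ \oo --> lim (u @ \oo) by apply/cauchy_cvgP.
exists (lim (u @ \oo)) => e e0.
have [|N _ hN] := ul e%:C; first by rewrite ltcR.
by exists N => n /hN; rewrite normE lecR nrmBC.
Qed.

End Complete.

(** * Cauchy estimates for maps between normed spaces *)

Section FrechetCauchy.
Context {R : realType} {X Y : normedModType R[i]}.
Local Notation C := R[i].
Implicit Types f g : X -> Y.

Lemma frechet_ray g (x h : X) (z : C) L : frechet g (x + z *: h) L ->
  cderiv (fun z => g (x + z *: h)) z (L h).
Proof.
case=> lL [M LM] gL.
have k : tangent (X := C^o) (fun z : C^o => x + z *: h) z (fun k => k *: h).
  move=> e e0; exists 1 => // w _.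
  rewrite [X in nrm X](_ : _ = 0) ?nrm0 ?mulr_ge0 ?nrm_ge0 ?(ltW e0)//.
  by module_eq; ring.
have := tangent_comp k (bounded_scale h) gL lL LM.
apply: tangent_ext; first by exists 1.
by move=> w; have [_ _ _ ->] := linearB0 lL.
Qed.

Definition holo_ball g (x : X) (r : R) :=
  forall y, nrm (y - x) < r -> exists L, frechet g y L.

Lemma holo_ball_ray g x h (r s : R) : holo_ball g x s -> r * nrm h < s ->
  holo_disc (fun z => g (x + z *: h)) r.
Proof.
move=> gx rh z zr; have [|L gL] := gx (x + z *: h).
  rewrite addrC addKr nrmZ; apply: le_lt_trans rh.
  by rewrite ler_wpM2r// nrm_ge0.
by exists (L h); apply: frechet_ray.
Qed.

(** On the complex line through [x] in the direction [h], the one-variable estimate applies on the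
    disc of radius [r / (2 |h|)]. *)
Lemma frechet_bound1 g x L (r M : R) : 0 < r -> holo_ball g x r ->
  (forall y, nrm (y - x) < r -> nrm (g y) <= M) -> frechet g x L ->
  bounded_by L (4 * M / r).
Proof.
move=> r0 gx gM gL.
have M0 : 0 <= M by have := gM x; rewrite subrr nrm0 => /(_ r0); have := nrm_ge0 (g x); lra.
split=> [|h]; first by rewrite !mulr_ge0 ?invr_ge0 ?(ltW r0).
have [->|h0] := eqVneq h 0.
  by have [lL _ _] := gL; have [-> _ _ _] := linearB0 lL; rewrite !nrm0 mulr0.
have nh := nrm_gt0 h0.
have s0 : 0 < r / 2 / nrm h by rewrite !divr_gt0.
have sh : r / 2 / nrm h * nrm h < r by rewrite divfK ?gt_eqF//; lra.
have hz z : nrm z = r / 2 / nrm h -> nrm (g (x + z *: h)) <= M.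
  by move=> zr; apply: gM; rewrite addrC addKr nrmZ zr.
have := cauchy_bound1 s0 (holo_ball_ray gx sh) hz (d := L h).
have -> : 2 * M / (r / 2 / nrm h) = 4 * M / r * nrm h.
  by field; rewrite !gt_eqF.
by apply; apply: frechet_ray; rewrite scale0r addr0.
Qed.

Lemma frechet_bound2 g x L (r M : R) h : 0 < r -> holo_ball g x r ->
  (forall y, nrm (y - x) < r -> nrm (g y) <= M) -> frechet g x L -> nrm h <= r / 4 ->
  nrm (g (x + h) - g x - L h) <= 32 * M / r ^+ 2 * nrm h ^+ 2.
Proof.
move=> r0 gx gM gL hr.
have [h00|h0] := eqVneq h 0.
  have [lL _ _] := gL; have [L0 _ _ _] := linearB0 lL.
  by rewrite h00 L0 addr0 !subrr !(nrm0 (V := X), nrm0 (V := Y)) expr0n mulr0.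
have nh := nrm_gt0 h0.
have s0 : 0 < r / 2 / nrm h by rewrite !divr_gt0.
have sh : r / 2 / nrm h * nrm h < r by rewrite divfK ?gt_eqF//; lra.
have hz z : nrm z = r / 2 / nrm h -> nrm (g (x + z *: h)) <= M.
  by move=> zr; apply: gM; rewrite addrC addKr nrmZ zr.
have := cauchy_bound2 s0 (holo_ball_ray gx sh) hz (d := L h) (a := 1).
rewrite nrm1 scale0r addr0 !scale1r expr1n mulr1.
have -> : 8 * M / (r / 2 / nrm h) ^+ 2 = 32 * M / r ^+ 2 * nrm h ^+ 2.
  by field; rewrite !gt_eqF.
apply; first by apply: frechet_ray; rewrite scale0r addr0.
by rewrite ler_pdivlMr// ler_pdivlMr//; lra.
Qed.

Lemma frechetD f g x L K : frechet f x L -> frechet g x K ->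
  frechet (fun y => f y + g y) x (fun h => L h + K h).
Proof.
move=> [lL [M [M0 LM]] fL] [lK [N [N0 KN]] gK]; split.
- by move=> a u v; rewrite lL lK; module_eq; ring.
- exists (M + N); split=> [|h]; first by rewrite addr_ge0.
  by apply: (le_trans (nrmD _ _)); rewrite mulrDl lerD.
- exact: tangentD.
Qed.

Lemma frechetZ (a : C) f x L : frechet f x L -> frechet (fun y => a *: f y) x (fun h => a *: L h).
Proof.
move=> [lL [M LM] fL]; have [M0 hM] := LM; split.
- by move=> k u v; rewrite lL; module_eq; ring.
- exists (nrm a * M); split=> [|h]; first by rewrite mulr_ge0 ?nrm_ge0.
  by rewrite nrmZ -mulrA ler_wpM2l ?nrm_ge0.
- have b0 : bounded_by (fun _ : X => 0 : C^o) 0.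
    by split=> // h; rewrite nrm0 mul0r.
  apply: (tangent_ext _ _ (tangent_scale (tangent_cst (a : C^o) x) b0 fL LM)); first by exists 1.
  by move=> h; rewrite scale0r add0r.
Qed.

Lemma frechet_shift f (x v : X) L : frechet f (x + v) L -> frechet (fun y => f (y + v)) x L.
Proof.
move=> [lL bL fL]; split=> // e /fL[r r0 hr]; exists r => // y.
by have := hr (y + v); rewrite opprD addrACA subrr addr0.
Qed.

Lemma frechet_unique f x L K : frechet f x L -> frechet f x K -> L = K.
Proof.
by move=> [lL _ fL] [lK _ fK]; apply/funext; apply: (tangent_unique lL lK fL fK).
Qed.

Definition Der g (x : X) : X -> Y := xget (fun=> 0) [set L | frechet g x L].

Lemma Der_frechet g x : (exists L, frechet g x L) -> frechet g x (Der g x).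
Proof. by move=> h; exact: (xgetPex (fun=> 0) h). Qed.

Lemma DerE g x L : frechet g x L -> Der g x = L.
Proof. by move=> gL; apply: (frechet_unique (Der_frechet _) gL); exists L. Qed.

Definition open_domain (U : set X) :=
  forall x, U x -> exists2 r : R, 0 < r & forall y, nrm (y - x) < r -> U y.

Definition holo_on (U : set X) g := forall x, U x -> exists L, frechet g x L.

(** Continuity at [x] bounds [g] near [x]. In infinite dimension nothing more than such a local
    bound can be expected, and it suffices for the Cauchy estimates. *)
Lemma holo_on_bounded (U : set X) g x : open_domain U -> holo_on U g -> U x ->
  exists2 r : R, 0 < r & exists2 M, 0 <= M &
    forall y, nrm (y - x) < r -> U y /\ nrm (g y) <= M.
Proof.
move=> oU gU xU; have [r r0 hr] := oU _ xU.
have [L [_ [M LM] gL]] := gU _ xU.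
have [s s0 hs] := tangent_cont gL LM ltr01.
exists (Num.min r s); first by rewrite lt_min r0.
exists (nrm (g x) + 1); first by rewrite addr_ge0 ?nrm_ge0.
move=> y; rewrite lt_min => /andP[/hr yU /hs h]; split=> //.
by have := nrmD (g y - g x) (g x); rewrite subrK; lra.
Qed.

End FrechetCauchy.

Section DirectionalDerivative.
Context {R : realType} {X : normedModType R[i]} {Y : completeNormedModType R[i]}.
Local Notation C := R[i].

(* The difference quotients [g_t y = (g (y + t v) - g y) / t] converge to [Dg(y) v] at the
   rate [O(t)] uniformly near [x], and the Cauchy estimates transfer this to their derivatives. *)
Theorem holo_on_Der (U : set X) (g : X -> Y) (v : X) : open_domain U -> holo_on U g ->
  holo_on U (fun y => Der g y v).
Proof.
move=> oU gU x xU.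
have [r4 r40 [M M0 hM]] := holo_on_bounded oU gU xU.
pose r := r4 / 4.
have r0 : 0 < r by rewrite divr_gt0.
have hM4 y : nrm (y - x) < 4 * r -> U y /\ nrm (g y) <= M.
  by move=> h; apply: hM; rewrite /r in h; lra.
have DF y : nrm (y - x) < 4 * r -> frechet g y (Der g y).
  by move=> h; apply: Der_frechet; apply: gU; apply: (hM4 y h).1.
have near2 y w : nrm (y - x) < 2 * r -> nrm w < 2 * r -> nrm (y + w - x) < 4 * r.
  by move=> h1 h2; rewrite addrAC; have := nrmD (y - x) w; lra.
have hb y : nrm (y - x) < 2 * r -> holo_ball g y (2 * r).
  move=> yx z zy; exists (Der g z); apply: DF.
  by have := near2 y (z - y) yx zy; rewrite [y + _]addrC subrK.
have bb y : nrm (y - x) < 2 * r -> forall z, nrm (z - y) < 2 * r -> nrm (g z) <= M.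
  move=> yx z zy; apply: (hM4 z _).2.
  by have := near2 y (z - y) yx zy; rewrite [y + _]addrC subrK.
have r20 : 0 < 2 * r by lra.
have nv := nrm_ge0 v.
(* Scaled so that [|t v| <= r / 2], which keeps [y + t v] in the ball where [g] is bounded; the
   geometric decay turns every [O(t)] into a limit through [half_expn_mul]. *)
pose t (n : nat) : R := r / 2 / (nrm v + 1) * 2^-1 ^+ n.
have p2 n : 0 < (2^-1 : R) ^+ n by rewrite exprn_gt0// invr_gt0.
have p2le n : (2^-1 : R) ^+ n <= 1 by rewrite exprn_ile1// ?invr_ge0// invf_le1// ler1n.
have v1 : 0 < nrm v + 1 by lra.
have t0 n : 0 < t n by rewrite mulr_gt0// !divr_gt0.
have tle n : t n <= r / 2 / (nrm v + 1).
  by rewrite /t ler_piMr// ltW// !divr_gt0.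
have tv n : nrm ((t n)%:C *: v) <= r / 2.
  rewrite nrmZ nrm_real gtr0_norm//.
  apply: (@le_trans _ _ (r / 2 / (nrm v + 1) * (nrm v + 1))).
    by apply: ler_pM; rewrite ?(ltW (t0 n))//; lra.
  by rewrite divfK// gt_eqF.
pose C1 := 8 * M / r ^+ 2 * nrm v ^+ 2.
have C10 : 0 <= C1 by rewrite !mulr_ge0 ?invr_ge0 ?exprn_ge0// ltW.
pose gq n y := (t n)%:C^-1 *: (g (y + (t n)%:C *: v) - g y).
have tn0 n : (t n)%:C != 0 :> C.
  exact: realC_neq0.
have gqD n y : nrm (y - x) < 2 * r -> nrm (gq n y - Der g y v) <= C1 * t n.
  move=> yx; have yx4 : nrm (y - x) < 4 * r by lra.
  have := frechet_bound2 r20 (hb y yx) (bb y yx) (DF y yx4) (h := (t n)%:C *: v).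
  have [_ _ _ ->] : [/\ Der g y 0 = 0, forall a b, Der g y (a - b) = Der g y a - Der g y b,
     forall a b, Der g y (a + b) = Der g y a + Der g y b
    & forall (a : C) b, Der g y (a *: b) = a *: Der g y b].
    by apply: linearB0; case: (DF y yx4).
  have -> : g (y + (t n)%:C *: v) - g y - (t n)%:C *: Der g y v =
      (t n)%:C *: (gq n y - Der g y v).
    by rewrite scalerBr scalerA mulfV// scale1r.
  rewrite !nrmZ nrm_real gtr0_norm// => h.
  have := h ltac:(have := tv n; rewrite nrmZ nrm_real gtr0_norm//; lra).
  have -> : 32 * M / (2 * r) ^+ 2 * (t n * nrm v) ^+ 2 = t n * (C1 * t n).
    by rewrite /C1; field; rewrite gt_eqF.
  by rewrite ler_pM2l.
pose A n h := (t n)%:C^-1 *: (Der g (x + (t n)%:C *: v) h - Der g x h).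
have gqF n y : nrm (y - x) < r ->
    frechet (gq n) y (fun h => (t n)%:C^-1 *: (Der g (y + (t n)%:C *: v) h +
      -1 *: Der g y h)).
  move=> yx.
  have yx4 : nrm (y - x) < 4 * r by lra.
  have yt : nrm (y + (t n)%:C *: v - x) < 4 * r.
    by apply: near2; [lra|have := tv n; lra].
  have := frechetZ ((t n)%:C^-1) (frechetD (frechet_shift (DF _ yt)) (frechetZ (-1) (DF _ yx4))).
  by congr frechet; apply/funext => z; rewrite /gq scaleN1r.
have xx : nrm (x - x) < r by rewrite subrr nrm0.
have xx2 : nrm (x - x) < 2 * r by rewrite subrr nrm0.
have AF n : frechet (gq n) x (A n).
  have := gqF n x xx; congr frechet; apply/funext => h.
  by rewrite /A scaleN1r.
have Acauchy m n h : nrm (A m h - A n h) <= 4 * (C1 * (t m + t n)) / r * nrm h.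
  have hF y : nrm (y - x) < r -> exists L, frechet (fun z => gq m z + -1 *: gq n z) y L.
    by move=> yx; eexists; apply: frechetD (gqF m y yx) (frechetZ _ (gqF n y yx)).
  have hB y : nrm (y - x) < r -> nrm (gq m y + -1 *: gq n y) <= C1 * (t m + t n).
    move=> yx; have yx2 : nrm (y - x) < 2 * r by lra.
    rewrite scaleN1r; apply: (le_trans (nrm_tri (Der g y v) _ _)).
    rewrite mulrDr; apply: lerD; first exact: gqD.
    by rewrite nrmBC; apply: gqD.
  have [_ /(_ h)] := frechet_bound1 r0 hF hB (frechetD (AF m) (frechetZ (-1) (AF n))).
  by rewrite scaleN1r.
have C2 (h : X) : 0 <= 4 * C1 / r * nrm h.
  by apply: mulr_ge0; [apply: divr_ge0; [exact: mulr_ge0|exact: ltW]|exact: nrm_ge0].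
pose q := r / 2 / (nrm v + 1).
have q0 : 0 <= q by rewrite ltW// !divr_gt0.
have Alim h : exists l, seqlim (fun n => A n h) l.
  apply: seqlim_cauchy => e e0.
  have [N hN] := @half_expn_mul R (4 * C1 / r * nrm h * q) (e / 2) (mulr_ge0 (C2 h) q0) ltac:(lra).
  exists N => m n Nm Nn; apply: (le_trans (Acauchy m n h)).
  have -> : 4 * (C1 * (t m + t n)) / r * nrm h =
     4 * C1 / r * nrm h * q * 2^-1 ^+ m + 4 * C1 / r * nrm h * q * 2^-1 ^+ n.
    by rewrite /t -/q; field; rewrite gt_eqF.
  by have := hN m Nm; have := hN n Nn; clear -e0; lra.
pose B h := xget 0 [set l | seqlim (fun n => A n h) l].
have AB h : seqlim (fun n => A n h) (B h) by apply: (xgetPex 0 (Alim h)).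
have lA n : linear (A n) by case: (AF n).
have lB : linear B.
  move=> a u w; apply: (seqlim_unique (AB _)).
  apply: seqlim_eq (seqlimD (seqlimZ a (AB u)) (AB w)) => n.
  by rewrite lA.
have Der_b y : nrm (y - x) < r -> nrm (Der g y v) <= 4 * M / (2 * r) * nrm v.
  move=> yx; have yx2 : nrm (y - x) < 2 * r by lra.
  have yx4 : nrm (y - x) < 4 * r by lra.
  by have [_] := frechet_bound1 r20 (hb y yx2) (bb y yx2) (DF y yx4).
pose M' := 4 * M / (2 * r) * nrm v + C1 * q.
have M'0 : 0 <= M' by apply: addr_ge0; apply: mulr_ge0 => //; apply: divr_ge0; [exact: mulr_ge0|exact: ltW].
have gqb n y : nrm (y - x) < r -> nrm (gq n y) <= M'.
  move=> yx; have := Der_b y yx; have := gqD n y ltac:(lra).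
  have : C1 * t n <= C1 * q by rewrite ler_wpM2l.
  rewrite /M'; have := nrmD (gq n y - Der g y v) (Der g y v); rewrite subrK; clear -C10; lra.
have gqh n : holo_ball (gq n) x r by move=> y yx; eexists; apply: gqF.
have hAb n h := (frechet_bound1 r0 (gqh n) (gqb n) (AF n)).2 h.
have gql y : nrm (y - x) < 2 * r -> seqlim (fun n => gq n y) (Der g y v).
  move=> yx e e0; have [N hN] := @half_expn_mul R (C1 * q) e (mulr_ge0 C10 q0) e0.
  exists N => n Nn; apply: (le_trans (gqD n y yx)).
  have -> : C1 * t n = C1 * q * 2^-1 ^+ n by rewrite /t /q; ring.
  exact: hN.
exists B; split=> //.
  exists (4 * M' / r); split=> [|h]; first by apply: divr_ge0; [exact: mulr_ge0|exact: ltW].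
  by apply: (@seqlim_le _ _ _ _ _ 0) (AB h) => n _; apply: hAb.
(* The quadratic remainder estimate for [gq n] has a constant independent of [n], so it passes to
   the limit in [g] and in [A] at once. *)
have rem h : nrm h <= r / 4 -> nrm (Der g (x + h) v - Der g x v - B h) <=
    32 * M' / r ^+ 2 * nrm h ^+ 2.
  move=> hr.
  have xh : nrm (x + h - x) < 2 * r by rewrite addrC addKr; lra.
  have := seqlimD (seqlimD (gql _ xh) (seqlimZ (-1) (gql _ xx2))) (seqlimZ (-1) (AB h)).
  rewrite !scaleN1r => l; apply: (@seqlim_le _ _ _ _ _ 0) l => n _.
  rewrite !scaleN1r; exact: (frechet_bound2 r0 (gqh n) (gqb n) (AF n)).
move=> e e0; pose D := 32 * M' / r ^+ 2.
have D0 : 0 <= D by apply: divr_ge0; [exact: mulr_ge0|exact: exprn_ge0 (ltW r0)].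
exists (Num.min (r / 4) (e / (D + 1))).
  by rewrite lt_min !divr_gt0//; clear -D0; lra.
move=> y; rewrite lt_min => /andP[h1]; rewrite ltr_pdivlMr; last by clear -D0; lra.
move=> h2; have := rem (y - x) (ltW h1).
rewrite [x + _]addrC subrK -/D => h; apply: (le_trans h).
have n0 := nrm_ge0 (y - x).
rewrite expr2 mulrA ler_wpM2r//; clear -h2 n0 D0; lra.
Qed.

End DirectionalDerivative.

(** * Higher derivatives *)

Section HigherDerivatives.
Context {R : realType} {X : normedModType R[i]} {Y : completeNormedModType R[i]}.
Local Notation C := R[i].

Lemma gt0_real (e : C) : 0 < e -> 0 < complex.Re e /\ e = (complex.Re e)%:C.
Proof.
rewrite ltcE /= => /andP[/eqP h1 h2]; split=> //.
by case: e h1 h2 => a b /= -> _.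
Qed.

Lemma near0P (P : X -> Prop) :
  (\forall h \near (0 : X), P h) <-> exists2 r : R, 0 < r & forall h, nrm h < r -> P h.
Proof.
split=> [/nbhs_ballP[e /= /gt0_real[e0 ee] he]|[r r0 hr]].
  exists (complex.Re e) => // h hr; apply: he.
  by rewrite -ball_normE /ball_ /= sub0r normrN normE ee ltcR.
apply/nbhs_ballP; exists r%:C; first by rewrite /= ltcR.
move=> h; rewrite -ball_normE /ball_ /= sub0r normrN normE ltcR; exact: hr.
Qed.

Lemma prod_normE n (v : 'I_n -> X) : \prod_(i < n) `|v i| = (\prod_(i < n) nrm (v i))%:C.
Proof. by rewrite rmorph_prod; apply: eq_bigr => i _; rewrite normE. Qed.

Lemma prod_nrm_ge0 n (v : 'I_n -> X) : 0 <= \prod_(i < n) nrm (v i).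
Proof. by apply: prodr_ge0 => i _; exact: nrm_ge0. Qed.

Definition arg_tail n (w : 'I_n.+1 -> X) : 'I_n -> X := fun j => w (lift ord0 j).

Lemma arg_tail_cons n (h : X) (v : 'I_n -> X) : arg_tail (arg_cons h v) = v.
Proof. by apply/funext => j; rewrite /arg_tail /arg_cons liftK. Qed.

Lemma arg_head_cons n (h : X) (v : 'I_n -> X) : arg_cons h v ord0 = h.
Proof. by rewrite /arg_cons unlift_none. Qed.

Lemma arg_consE n (w : 'I_n.+1 -> X) : arg_cons (w ord0) (arg_tail w) = w.
Proof.
by apply/funext => i; rewrite /arg_cons /arg_tail; case: unliftP => [j ->|->].
Qed.

Lemma dfwith_ord0 n (w : 'I_n.+1 -> X) u :
  @dfwith _ (fun=> X) w ord0 u = arg_cons u (arg_tail w).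
Proof.
apply/funext => i; rewrite /arg_cons /arg_tail; case: unliftP => [j ->|->].
  by rewrite dfwithout// (negbT (eq_liftF _ _)).
by rewrite dfwithin.
Qed.

Lemma dfwith_lift n (w : 'I_n.+1 -> X) j u :
  @dfwith _ (fun=> X) w (lift ord0 j) u =
  arg_cons (w ord0) (@dfwith _ (fun=> X) (arg_tail w) j u).
Proof.
apply/funext => i; rewrite /arg_cons; case: unliftP => [k ->|->].
  have [<-|jk] := eqVneq j k; first by rewrite !dfwithin.
  by rewrite !dfwithout// (inj_eq lift_inj).
by rewrite dfwithout// eq_sym (negbT (eq_liftF _ _)).
Qed.

Lemma bounded_multilinearE n (L : ('I_n -> X) -> Y) : bounded_multilinear L ->
  exists2 M : R, 0 <= M & forall v, nrm (L v) <= M * \prod_(i < n) nrm (v i).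
Proof.
move=> [_ [M hM]]; exists `|complex.Re M| => // v.
have := hM v; rewrite prod_normE normE => /lec_mul_real /le_trans; apply.
by rewrite ler_wpM2r ?prod_nrm_ge0// ler_norm.
Qed.

Lemma frechet_ext (f g : X -> Y) (x : X) L :
  (exists2 r : R, 0 < r & forall y, nrm (y - x) < r -> f y = g y) ->
  frechet f x L -> frechet g x L.
Proof. by move=> fg [lL bL fL]; split=> //; apply: tangent_ext fL. Qed.

Lemma multilinear_derivative_frechet n (G : X -> ('I_n -> X) -> Y) x L v :
  is_multilinear_derivative G x L -> frechet (G^~ v) x (fun h => L (arg_cons h v)).
Proof.
move=> [bL hL]; have [M M0 hM] := bounded_multilinearE bL; split.
- by have := bL.1 (arg_cons 0 v) ord0; under eq_fun do rewrite dfwith_ord0 arg_tail_cons.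
- exists (M * \prod_(i < n) nrm (v i)); split=> [|h].
    by rewrite mulr_ge0 ?prod_nrm_ge0.
  have := hM (arg_cons h v); rewrite big_ord_recl arg_head_cons.
  rewrite mulrA mulrAC; congr (_ <= _ * _ * _).
  by apply: eq_bigr => i _; rewrite -[in RHS](arg_tail_cons h v).
- move=> e e0.
  have P0 := prod_nrm_ge0 v; set P := \prod_(i < n) _ in P0.
  have e1 : 0 < (e / (P + 1))%:C :> C by rewrite ltcR divr_gt0//; lra.
  have /near0P[r r0 hr] := hL _ e1; exists r => // y /hr /(_ v).
  rewrite [x + _]addrC subrK prod_normE !normE -!rmorphM lecR => /le_trans; apply.
  rewrite -/P -mulrA [nrm _ * P]mulrC mulrA ler_wpM2r ?nrm_ge0//.
  by rewrite mulrAC ler_pdivrMr; [rewrite ler_pM2l; lra|lra].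
Qed.

(** For fixed [v] this is a derivative of a single map. Linearity in [v] follows from uniqueness of
    derivatives, and the Cauchy estimates bound the derivative and the remainder by multiples of the
    product of the [|v i|], which is differentiability for the operator norm. *)
Lemma is_multilinear_derivative_Der n (U : set X) (G : X -> ('I_n -> X) -> Y) x (r M : R) :
  (forall v, holo_on U (G^~ v)) -> (forall y, U y -> multilinear (G y)) ->
  0 < r -> 0 <= M -> (forall y, nrm (y - x) < r -> U y) ->
  (forall y v, nrm (y - x) < r -> nrm (G y v) <= M * \prod_(i < n) nrm (v i)) ->
  is_multilinear_derivative G x (fun w => Der (G^~ (arg_tail w)) x (w ord0)).
Proof.
move=> hG lG r0 M0 rU GM.
have xU : U x by apply: rU; rewrite subrr nrm0.
have DG v : frechet (G^~ v) x (Der (G^~ v) x) by apply: Der_frechet; apply: hG.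
have hb v : holo_ball (G^~ v) x r by move=> y /rU; apply: hG.
split; first split.
- move=> v i; case: (unliftP ord0 i) => [j ->|->] a u w; last first.
    rewrite !dfwith_ord0 !arg_tail_cons !arg_head_cons.
    by case: (DG (arg_tail v)) => lD _ _; rewrite lD.
  rewrite !dfwith_lift !arg_tail_cons !arg_head_cons.
  have -> // : Der (G^~ (@dfwith _ (fun=> X) (arg_tail v) j (a *: u + w))) x =
     (fun h => a *: Der (G^~ (@dfwith _ (fun=> X) (arg_tail v) j u)) x h +
       Der (G^~ (@dfwith _ (fun=> X) (arg_tail v) j w)) x h).
  apply: DerE; apply: frechet_ext (frechetD (frechetZ a (DG _)) (DG _)).
  by exists r => // y /rU /lG ->.
- exists (4 * M / r)%:C => v; rewrite prod_normE normE -rmorphM lecR.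
  have [_ /(_ (v ord0))] := frechet_bound1 r0 (hb _) (fun y => GM y (arg_tail v)) (DG _).
  move=> /le_trans; apply; rewrite big_ord_recl.
  by rewrite [leRHS](_ : _ = 4 * (M * \prod_(i < n) nrm (arg_tail v i)) / r * nrm (v ord0))//;
    rewrite /arg_tail; ring.
- move=> e /gt0_real[e0 ->]; set e' := complex.Re e in e0 *.
  pose D := 32 * M / r ^+ 2.
  have D0 : 0 <= D by apply: divr_ge0; [exact: mulr_ge0|exact: exprn_ge0 (ltW r0)].
  apply/near0P; exists (Num.min (r / 4) (e' / (D + 1))).
    by rewrite lt_min !divr_gt0//; lra.
  move=> h; rewrite lt_min => /andP[h1]; rewrite ltr_pdivlMr; last lra.
  move=> h2 v; rewrite prod_normE !normE -!rmorphM lecR arg_tail_cons arg_head_cons.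
  apply: (le_trans (frechet_bound2 r0 (hb _) (fun y => GM y v) (DG _) (ltW h1))).
  have P0 := prod_nrm_ge0 v; set P := \prod_(i < n) _ in P0 *.
  rewrite [leLHS](_ : _ = D * nrm h * nrm h * P); last by rewrite /D; ring.
  rewrite ler_wpM2r// ler_wpM2r ?nrm_ge0//.
  by have := nrm_ge0 h; lra.
Qed.

Lemma multilinear0 (G : ('I_0 -> X) -> Y) : multilinear G.
Proof. by move=> v []. Qed.

(** The invariant of the induction on the order: holomorphy for each fixed [v] together with a local
    bound in operator norm. Together they yield differentiability in operator norm. *)
Definition holo_multilinear (U : set X) n (G : X -> ('I_n -> X) -> Y) :=
  [/\ forall v, holo_on U (G^~ v), forall y, U y -> multilinear (G y)
    & forall x, U x -> exists2 r : R, 0 < r & exists2 M : R, 0 <= M & forall y, nrm (y - x) < r ->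
        U y /\ forall v, nrm (G y v) <= M * \prod_(i < n) nrm (v i)].

Lemma Dn_is_derivative (U : set X) (F : X -> Y) n : holo_multilinear U (@Dn _ _ _ n F) ->
  forall x, U x -> is_multilinear_derivative (@Dn _ _ _ n F) x (@Dn _ _ _ n.+1 F x).
Proof.
move=> [h1 h2 h3] x xU; have [r r0 [M M0 hM]] := h3 x xU.
apply: (xgetPex (fun=> 0)).
eexists; apply: (is_multilinear_derivative_Der h1 h2 r0 M0 (fun y yx => (hM y yx).1)).
by move=> y v /hM[_].
Qed.

(** The next derivative at [v] is the directional derivative, along [v ord0], of the current one at
    the tail of [v]. It is holomorphic by [holo_on_Der], and Cauchy estimates on half the radius
    renew the local bound. *)
Theorem Dn_holo (U : set X) (F : X -> Y) : open_domain U -> holo_on U F ->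
  forall n, holo_multilinear U (@Dn _ _ _ n F) /\
    forall x (v : 'I_n -> X), U x ->
      frechet (fun y => Dn F y v) x (fun h => Dn F x (arg_cons h v)).
Proof.
move=> oU hF.
elim=> [|n [hn h4]].
  have h : holo_multilinear U (@Dn _ _ _ 0 F).
    split=> //=; first by move=> y _; exact: multilinear0.
    move=> x xU; have [r r0 [M M0 hM]] := holo_on_bounded oU hF xU.
    exists r => //; exists M => // y /hM[yU h]; split=> // v.
    by rewrite big_ord0 mulr1.
  split=> // x v xU; exact: multilinear_derivative_frechet (Dn_is_derivative h xU).
have hS := Dn_is_derivative hn; have [h1 h2 h3] := hn.
have DE y (w : 'I_n.+1 -> X) : U y -> Dn F y w = Der (fun y => Dn F y (arg_tail w)) y (w ord0).
  move=> yU; have := DerE (h4 y (arg_tail w) yU) => ->.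
  by rewrite arg_consE.
have h : holo_multilinear U (@Dn _ _ _ n.+1 F).
  split.
  - move=> v x xU; have [r r0 hr] := oU x xU.
    have [L hL] := holo_on_Der (v ord0) oU (h1 (arg_tail v)) xU.
    exists L; apply: frechet_ext hL; exists r => // y /hr yU.
    by rewrite (DE y v yU).
  - by move=> y /hS[[]].
  - move=> x xU; have [r r0 [M M0 hM]] := h3 x xU.
    exists (r / 2); first by rewrite divr_gt0.
    exists (4 * M / (r / 2)).
      by apply: divr_ge0; [exact: mulr_ge0|apply: divr_ge0 => //; exact: ltW].
    move=> y yx; have yU : U y by apply: (hM y _).1; lra.
    split=> // v; rewrite DE//.
    have near z : nrm (z - y) < r / 2 -> nrm (z - x) < r.
      by move=> zy; have := nrm_tri y z x; lra.
    have hb : holo_ball (fun z => Dn F z (arg_tail v)) y (r / 2).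
      by move=> z /near /hM[zU _]; apply: h1.
    have hB z : nrm (z - y) < r / 2 ->
        nrm (Dn F z (arg_tail v)) <= M * \prod_(i < n) nrm (arg_tail v i).
      by move=> /near /hM[].
    have [_ /(_ (v ord0))] := frechet_bound1 (divr_gt0 r0 (ltr0Sn R 1)) hb hB (Der_frechet (h1 _ _ yU)).
    move=> /le_trans; apply; rewrite big_ord_recl.
    by rewrite [leRHS](_ : _ = 4 * (M * \prod_(i < n) nrm (arg_tail v i)) / (r / 2) * nrm (v ord0))//;
      rewrite /arg_tail; ring.
split=> // x v xU.
exact: multilinear_derivative_frechet (Dn_is_derivative h xU).
Qed.

End HigherDerivatives.

(** * Agreement with the differentials of the statement *)

Section Bridge.
Context {R : realType} {X Y : normedModType R[i]}.
Local Notation C := R[i].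

Lemma bounded_continuous (L : X -> Y) : linear L ->
  (exists M, bounded_by L M) <-> continuous L.
Proof.
move=> lL; have [L0 LB LD LZ] := linearB0 lL; split.
  move=> [M [M0 hM]] x; apply/cvgrPdist_le => e /gt0_real[e0 ->].
  set e' := complex.Re e in e0 *.
  suff [r r0 hr] : exists2 r : R, 0 < r & forall h, nrm h < r -> nrm (L h) <= e'.
    apply/nbhs_ballP; exists r%:C; first by rewrite /= ltcR.
    move=> y; rewrite -ball_normE /ball_ /= !normE ltcR lecR => /hr.
    by rewrite LB.
  exists (e' / (M + 1)); first by rewrite divr_gt0//; lra.
  move=> h; rewrite ltr_pdivlMr; last lra.
  by have := hM h; have := nrm_ge0 h; lra.
move=> cL; have /cvgrPdist_le/(_ 1 ltr01) := cL 0.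
move=> /near0P[r r0 hr]; exists (2 / r); split; first by rewrite divr_ge0 ?(ltW r0).
move=> h; have [->|h0] := eqVneq h 0.
  by rewrite L0 !(nrm0 (V := X), nrm0 (V := Y)) mulr0.
have nh := nrm_gt0 h0.
pose t := r / 2 / nrm h; have t0 : 0 < t by rewrite !divr_gt0.
have tn : nrm (t%:C *: h) = r / 2.
  by rewrite nrmZ nrm_real gtr0_norm// divfK// gt_eqF.
have := hr (t%:C *: h); rewrite tn L0 sub0r normrN normE lecR => /(_ ltac:(lra)).
rewrite LZ nrmZ nrm_real gtr0_norm// => h1.
have -> : 2 / r * nrm h = t^-1 by rewrite /t; field; rewrite !gt_eqF.
by rewrite -[t^-1]mul1r ler_pdivlMr// mulrC.
Qed.

Lemma differentiable_frechet (f : X -> Y) x : differentiable f x -> frechet f x ('d f x).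
Proof.
move=> fx; have ld : linear ('d f x) by exact: linearP.
split=> //; first by apply/(bounded_continuous ld); exact: diff_continuous.
move=> e e0; have /eqaddoP/(_ e%:C) := diff_locally fx.
rewrite ltcR => /(_ e0) /near0P[r r0 hr].
exists r => // y /hr; rewrite [X in `|X|](_ : _ = f y - f x - 'd f x (y - x)).
  by rewrite !normE -rmorphM lecR.
by rewrite -[LHS]/(f (y - x + x) - (f x + 'd f x (y - x))) subrK opprD addrA.
Qed.

Lemma frechet_differentiable (f : X -> Y) x L : frechet f x L ->
  differentiable f x /\ 'd f x = L :> (X -> Y).
Proof.
move=> [lL bL fL].
pose df : {linear X -> Y} := HB.pack L (GRing.isLinear.Build _ _ _ _ L lL).
have cL : continuous df by apply/(bounded_continuous lL).
have h : f \o shift x = cst (f x) + df +o_ 0 id.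
  apply/eqaddoP => e /gt0_real[e0 ->]; set e' := complex.Re e in e0 *.
  have [r r0 hr] := fL _ e0; apply/near0P; exists r => // k kr.
  have := hr (k + x); rewrite addrK => /(_ kr).
  rewrite -[(_ - _ : X -> Y) k]/(f (k + x) - (f x + L k)).
  by rewrite !normE -rmorphM lecR opprD addrA.
have E : 'd f x = L :> (X -> Y) by exact: (diff_unique cL h).
by split=> //; apply/diff_locallyP; rewrite E; split.
Qed.

End Bridge.

(** * The mean value inequality and the second-order Taylor formula *)

Section MeanValue.
Context {R : realType} {Y : normedModType R[i]}.
Local Notation C := R[i].

(** Bisection of the segment, obtained from [cousin_square] with a predicate that ignores its second
    coordinate. The slack [e] added to [K] absorbs the error of the linear approximation. *)
Lemma mean_value_bound (f : C -> Y) (a b : C) (K : R) :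
  (forall s : R, 0 <= s <= 1 -> exists2 d, cderiv f (a + s%:C * (b - a)) d & nrm d <= K) ->
  nrm (f b - f a) <= K * nrm (b - a).
Proof.
move=> fd.
have nba := nrm_ge0 (b - a).
pose g (s : R) := a + s%:C * (b - a).
have gB s t : g s - g t = (s - t)%:C * (b - a) by rewrite /g rmorphB; ring.
suff H : forall e : R, 0 < e -> nrm (f b - f a) <= (K + e) * nrm (b - a).
  apply/ler_addgt0Pr => e e0.
  have e1 : 0 < e / (nrm (b - a) + 1) by rewrite divr_gt0//; lra.
  apply: (le_trans (H _ e1)); rewrite mulrDl lerD2l mulrAC ler_pdivrMr; last lra.
  by rewrite ler_pM2l//; lra.
move=> e e0.
have := @cousin_square R (fun s _ l => nrm (f (g (s + l)) - f (g s)) <= (K + e) * (l * nrm (b - a))).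
rewrite /g rmorph0 mul0r addr0 add0r rmorph1 !mul1r subrKC; apply.
  move=> s t l l0 /= h1 h2 _ _.
  have := nrm_tri (f (g (s + l / 2))) (f (g (s + l))) (f (g s)).
  by rewrite -/(g _) -/(g _) -addrA -splitr in h2; rewrite -/(g _) -/(g _) in h1 *; lra.
move=> s t0 s01 _; have [d hd dK] := fd s s01; have [r r0 hr] := hd e e0.
exists (r / (nrm (b - a) + 1)); first by rewrite divr_gt0//; lra.
move=> a' t' l /andP[l0]; rewrite ltr_pdivlMr; last lra.
move=> lr /andP[h1 h2] _ _ _ _ _; rewrite -/(g _) -/(g _).
have near t : a' <= t <= a' + l ->
    nrm (f (g t) - f (g s)) <= (K + e) * (`|t - s| * nrm (b - a)).
  move=> ta; have gts : nrm (g t - g s) = `|t - s| * nrm (b - a).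
    by rewrite gB nrmM nrm_real.
  have tl : `|t - s| <= l by rewrite ler_norml; lra.
  have := hr (g t); rewrite -/(g s) gts => /(_ _) h.
  have {}h := h ltac:(apply: (le_lt_trans _ lr); apply: ler_pM => //; lra).
  have := nrmD (f (g t) - f (g s) - (g t - g s) *: d) ((g t - g s) *: d).
  rewrite subrK nrmZ gts => h'; apply: (le_trans h').
  have : `|t - s| * nrm (b - a) * nrm d <= `|t - s| * nrm (b - a) * K.
    by rewrite ler_wpM2l// mulr_ge0.
  lra.
have l1 : a' <= a' + l by rewrite lerDl ltW.
(* Since [s] lies between [a'] and [a' + l], its distances to the two endpoints add up to exactly
   [l]. *)
have k1 := near a' ltac:(by rewrite lexx); have k2 := near (a' + l) ltac:(by rewrite lexx andbT).
apply: (le_trans (nrm_tri (f (g s)) _ _)); rewrite [X in _ + X]nrmBC.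
apply: (le_trans (lerD k2 k1)).
have -> : `|a' - s| = s - a' by rewrite ler0_norm ?opprB// subr_le0.
have -> : `|a' + l - s| = a' + l - s by rewrite ger0_norm// subr_ge0.
by rewrite le_eqVlt; apply/orP; left; apply/eqP; ring.
Qed.

(** Subtracting the quadratic polynomial leaves a function with derivative
    [f' w - f' 0 - w d2 = o(w)], to which the mean value inequality applies. *)
Lemma taylor2 (f f' : C -> Y) (d2 : Y) :
  (exists2 r : R, 0 < r & forall z, nrm z < r -> cderiv f z (f' z)) -> cderiv f' 0 d2 ->
  forall e : R, 0 < e -> exists2 r : R, 0 < r & forall z, nrm z < r ->
    nrm (f z - (f 0 + z *: f' 0 + (z ^+ 2 / 2) *: d2)) <= e * nrm z ^+ 2.
Proof.
move=> [r r0 fr] f'd e e0; have [s s0 hs] := f'd e e0.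
exists (Num.min r s); first by rewrite lt_min r0.
move=> z; rewrite lt_min => /andP[zr zs].
pose g w := f w + -1 *: (w *: f' 0 + (2^-1 * (w * w)) *: d2).
have gd w : nrm w < r -> cderiv g w (f' w - f' 0 - w *: d2).
  move=> /fr fw.
  have h1 : cderiv (fun w => w *: f' 0) w (f' 0).
    apply: (cderiv_eq (cderiv_scale (cderiv_id w) (cderiv_cst (f' 0) w))).
    by rewrite scaler0 addr0 scale1r.
  have h2 := cderivM (cderiv_cst (2^-1 : C^o) w) (cderivM (cderiv_id w) (cderiv_id w)).
  have h3 := cderiv_scale h2 (cderiv_cst d2 w).
  apply: (cderiv_eq (cderivD fw (cderivZ (-1) (cderivD h1 h3)))).
  by rewrite !(mul0r, mul1r, mulr1, add0r) scaler0 addr0; module_eq; field.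
have : nrm (g z - g 0) <= (e * nrm z) * nrm (z - 0).
  apply: mean_value_bound => t t01.
  have tz : nrm (0 + t%:C * (z - 0)) <= nrm z.
    rewrite add0r subr0 nrmM nrm_real ger0_norm; last lra.
    by rewrite ler_piMl ?nrm_ge0//; lra.
  eexists; first by apply: gd; apply: le_lt_trans zr.
  have := hs (0 + t%:C * (z - 0)); rewrite [_ - 0]subr0 => /(_ (le_lt_trans tz zs)).
  by move=> /le_trans; apply; rewrite ler_pM2l.
rewrite subr0 -mulrA -expr2; congr (nrm _ <= _).
by rewrite /g; module_eq; ring.
Qed.

End MeanValue.

(** * Inverses of linear maps that depend on a complex parameter *)

Section InverseFamily.
Context {R : realType} {X : normedModType R[i]}.
Local Notation C := R[i].

(** For [w = B z v], [|w| <= b |A z0 w| <= b |v| + b K |z - z0| |w|], and the last term is absorbed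
    as soon as [|z - z0| <= 1 / (2 K b)]. *)
Lemma inverse_near (A B : C -> X -> X) (z0 : C) (K b : R) :
  0 < K -> 0 < b ->
  (exists2 r : R, 0 < r & forall z, nrm (z - z0) < r ->
     [/\ cancel (B z) (A z), cancel (A z) (B z)
       & forall v, nrm (A z v - A z0 v) <= K * nrm (z - z0) * nrm v]) ->
  (forall v, nrm (B z0 v) <= b * nrm v) ->
  exists2 r : R, 0 < r & forall z, nrm (z - z0) < r -> forall v, nrm (B z v) <= 2 * b * nrm v.
Proof.
move=> K0 b0 [r r0 hr] hb.
have Kb : 0 < 2 * K * b by rewrite !mulr_gt0.
exists (Num.min r (2 * K * b)^-1); first by rewrite lt_min r0 invr_gt0.
move=> z; rewrite lt_min => /andP[/hr[BA AB hA] hz] v.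
have [_ A0 _] := hr z0 ltac:(by rewrite subrr nrm0).
pose w := B z v; rewrite -/w.
have wE : w = B z0 (A z0 w) by rewrite A0.
have h1 := hb (A z0 w); rewrite -wE in h1.
have h2 := hA w; rewrite BA in h2.
have h3 := nrmD (A z0 w - v) v; rewrite subrK nrmBC in h3.
have h4 : 2 * K * b * nrm (z - z0) <= 1.
  by rewrite mulrC -ler_pdivlMr// mul1r ltW.
have nw := nrm_ge0 w.
have h5 : b * nrm (A z0 w) <= b * (K * nrm (z - z0) * nrm w) + b * nrm v.
  by rewrite -mulrDr ler_pM2l//; lra.
have h6 : 2 * (b * (K * nrm (z - z0) * nrm w)) <= nrm w.
  by have := ler_wpM2r nw h4; rewrite mul1r; lra.
lra.
Qed.

(* With [w = B z0 (u z0)], [B z (u z) - w = B z (m z)] where [m z = u z - A z w] vanishes at [z0]. *)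
Lemma inverse_deriv (A B : C -> X -> X) (z0 : C) (K b : R) (u : C -> X) (u' a' : X) :
  0 < K -> 0 < b -> (forall z, linear (A z)) ->
  (exists2 r : R, 0 < r & forall z, nrm (z - z0) < r ->
     [/\ cancel (B z) (A z), cancel (A z) (B z)
       & forall v, nrm (A z v - A z0 v) <= K * nrm (z - z0) * nrm v]) ->
  (forall v, nrm (B z0 v) <= b * nrm v) ->
  cderiv u z0 u' -> cderiv (fun z => A z (B z0 (u z0))) z0 a' ->
  cderiv (fun z => B z (u z)) z0 (B z0 (u' - a')).
Proof.
move=> K0 b0 lA hA hb ud ad.
have [s s0 hs] := inverse_near K0 b0 hA hb.
have [r r0 hr] := hA.
have [BA0 AB0 _] := hr z0 ltac:(by rewrite subrr nrm0).
set w := B z0 (u z0) in ad *.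
have md : cderiv (fun z => u z + -1 *: A z w) z0 (u' - a').
  by apply: (cderiv_eq (cderivD ud (cderivZ (-1) ad))); rewrite scaleN1r.
move: (u' - a') md => m' md.
move=> e e0.
pose N := nrm (B z0 m').
have N0 : 0 <= N := nrm_ge0 _.
have [t t0 ht] := md (e / 2 / (2 * b)) ltac:(rewrite !divr_gt0//; lra).
pose D := 2 * b * K * N + 1.
have D0 : 0 < D by rewrite ltr_wpDl// !mulr_ge0// ltW.
exists (Num.min (Num.min r s) (Num.min t (e / 2 / D))).
  by rewrite !lt_min r0 s0 t0 !divr_gt0.
move=> z; rewrite !lt_min => /andP[/andP[zr zs] /andP[zt zD]].
have [BA AB hz] := hr z zr.
have [_ AB' _ AZ] := linearB0 (lA z).
have AD p q : A z (p + q) = A z p + A z q by have [_ _ -> _] := linearB0 (lA z).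
have BB p q : B z (p - q) = B z p - B z q by rewrite -{1}[p]BA -{1}[q]BA -AB' AB.
have BD p q : B z (p + q) = B z p + B z q by rewrite -{1}[p]BA -{1}[q]BA -AD AB.
have BZ (k : C) p : B z (k *: p) = k *: B z p by rewrite -{1}[p]BA -AZ AB.
have BN p : B z (- p) = - B z p by rewrite -scaleN1r BZ scaleN1r.
have -> : B z (u z) - w - (z - z0) *: B z0 m' =
  B z (u z + -1 *: A z w - (u z0 + -1 *: A z0 w) - (z - z0) *: m') +
  (z - z0) *: B z (A z0 (B z0 m') - A z (B z0 m')).
  have -> : u z0 + -1 *: A z0 w = 0 by rewrite BA0 scaleN1r subrr.
  by rewrite subr0 BA0 !(BD, BN, BZ) !AB; module_eq; ring.
apply: (le_trans (nrmD _ _)); rewrite nrmZ.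
have h1 := hs z zs (u z + -1 *: A z w - (u z0 + -1 *: A z0 w) - (z - z0) *: m').
have h2 := ht z zt.
have b20 : 0 < 2 * b by rewrite mulr_gt0.
have nz := nrm_ge0 (z - z0).
have h3 : nrm (B z (A z0 (B z0 m') - A z (B z0 m'))) <= 2 * b * (K * nrm (z - z0) * N).
  by apply: (le_trans (hs z zs _)); rewrite ler_pM2l// nrmBC; apply: hz.
have h4 : 2 * b * (e / 2 / (2 * b) * nrm (z - z0)) = e / 2 * nrm (z - z0).
  by field; rewrite gt_eqF.
have h5 := ler_wpM2l (ltW b20) h2; rewrite h4 in h5.
have h6 : 2 * b * (K * nrm (z - z0) * N) <= e / 2.
  move: zD; rewrite ltr_pdivlMr// => zD.
  have -> : 2 * b * (K * nrm (z - z0) * N) = nrm (z - z0) * (2 * b * K * N) by ring.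
  by apply: (le_trans _ (ltW zD)); rewrite ler_wpM2l// /D lerDl.
have h7 := ler_wpM2l nz (le_trans h3 h6).
clear -h1 h5 h7; lra.
Qed.

End InverseFamily.

(** * The auxiliary function of the unit disc *)

Section AuxiliaryFunction.
Context {R : realType} {X : completeNormedModType R[i]}.
Local Notation C := R[i].
Implicit Types (F : X -> X) (T : X -> C^o).

Lemma unit_ballP (x : X) : unit_ball x <-> nrm x < 1.
Proof. by rewrite /unit_ball /= normE (_ : 1 = 1%:C)// ltcR. Qed.

Lemma open_unit_ball : open_domain (@unit_ball R X).
Proof.
move=> x /unit_ballP x1; exists (1 - nrm x); first by rewrite subr_gt0.
move=> y yx; apply/unit_ballP.
by have := nrmD (y - x) x; rewrite subrK; lra.
Qed.

Lemma holomorphic_holo_on F : holomorphic_on_ball F -> holo_on (@unit_ball R X) F.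
Proof. by move=> hF x /hF /differentiable_frechet h; exists ('d F x). Qed.

Lemma Dn1_diff F (x v : X) : holomorphic_on_ball F -> unit_ball x ->
  Dn F x (fun _ : 'I_1 => v) = 'd F x v.
Proof.
move=> hF xU; have v0 : 'I_0 -> X by case.
have [_ /(_ x v0 xU) h] := Dn_holo open_unit_ball (holomorphic_holo_on hF) 0.
have := frechet_unique h (differentiable_frechet (hF x xU)) => /(congr1 (fun L => L v)) <-.
congr (Dn F x _); apply/funext => i.
by rewrite (ord1 i) (arg_head_cons v v0).
Qed.

Definition ray_Dn F (x : X) n (z : C) : X := Dn F (z *: x) (fun _ : 'I_n => x).

Lemma ray_Dn_deriv F (x : X) n z : holomorphic_on_ball F -> unit_ball (z *: x) ->
  cderiv (ray_Dn F x n) z (ray_Dn F x n.+1 z).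
Proof.
move=> hF xU.
have [_ h] := Dn_holo open_unit_ball (holomorphic_holo_on hF) n.
have := frechet_ray (x := 0) (h := x) (z := z); rewrite add0r => /(_ _ _ _ (h _ (fun=> x) xU)).
have -> : arg_cons x (fun _ : 'I_n => x) = fun=> x.
  by apply/funext => i; rewrite /arg_cons; case: unliftP.
apply: cderiv_ext; exists 1 => // y _; by rewrite add0r.
Qed.

Lemma DinvK F x : bijective ('d F x) -> cancel (Dinv F x) ('d F x) /\ cancel ('d F x) (Dinv F x).
Proof.
move=> bF; split=> y.
  apply: pinvK; rewrite inE; have [g _ gK] := bF.
  by exists (g y) => //; rewrite gK.
by apply: pinvKV; rewrite ?inE//; move=> a b _ _; apply: bij_inj.
Qed.

Lemma Dinv_linear F x : bijective ('d F x) -> linear (Dinv F x).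
Proof.
move=> bF; have [BA AB] := DinvK bF; move=> a u v.
by apply: (bij_inj bF); rewrite linearP !BA.
Qed.

Lemma multilinear2_scale (L : ('I_2 -> X) -> X) (a : C) x : multilinear L ->
  L (fun=> a *: x) = a ^+ 2 *: L (fun=> x).
Proof.
move=> lL.
have step (v : 'I_2 -> X) (i : 'I_2) : v i = a *: x ->
    L v = a *: L (@dfwith _ (fun=> X) v i x).
  move=> vi; have [_ _ _ /(_ a x)] := linearB0 (lL v i); rewrite -vi => <-.
  congr L; apply/funext => j; have [<-|ij] := eqVneq i j; first by rewrite dfwithin.
  by rewrite dfwithout.
rewrite (step _ ord0)// (step _ ord_max) ?dfwithout// scalerA expr2; congr (_ *: L _).
apply/funext => j; have [<-|ij] := eqVneq ord_max j; first by rewrite dfwithin.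
rewrite dfwithout//; have -> : j = ord0.
  by apply/val_inj; case: j ij => -[|[|]].
by rewrite dfwithin.
Qed.

(** Gives access to the class condition at [z x0] for every complex [z]. The rotation [|z| / z]
    cancels against the factors [z] and [|z|] in that condition, so a single functional [T] serves
    the whole disc and the resulting function is holomorphic in [z]. *)
Lemma support_scale T (x : X) (z : C) : z != 0 -> `|x| = 1 ->
  support_functionals x T ->
  support_functionals (z *: x) (fun v => (`|z| / z) * T v).
Proof.
move=> z0 x1 [lT cT Tx Tn].
have [M LM] := (bounded_continuous lT).2 cT.
have nz : nrm (`|z| / z) = 1.
  by rewrite nrmM nrmV normE nrm_real ger0_norm ?nrm_ge0// mulfV// gt_eqF// nrm_gt0.
have lT' : linear (fun v => (`|z| / z) * T v : C^o).
  by move=> a u v; rewrite lT mulrDr; congr (_ + _); rewrite /GRing.scale /=; ring.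
split; first exact: lT'.
- apply/(bounded_continuous lT').
  by exists M; case: LM => M0 hM; split=> // h; rewrite nrmM nz mul1r.
- have [_ _ _ ->] := linearB0 lT.
  by rewrite Tx x1 normrZ x1 /GRing.scale /= !mulr1 mulfVK.
- rewrite -Tn /opnorm; congr sup.
  have e v : complex.Re `|(`|z| / z) * T v| = complex.Re `|T v|.
    by rewrite -!/(nrm _) nrmM nz mul1r.
  by apply/seteqP; split=> _ [v v1 <-]; exists v; rewrite // e.
Qed.

(** Here [beta] stands for [T (DF(z x0)^-1 x0)]. As [DF(z x0)^-1 x0] need not be a multiple of [x0],
    [beta] is known only through the first equation, which comes from [DF(z x0) x0 = (1 + 2 a2 z + 3
    a3 z^2) x0 + o(z^2)]; [t1] and [t2] are the images of such remainders. Multiplying by the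
    coefficient of [beta] eliminates it. *)
Lemma quotient_expansion (a2 a3 a4 : C) (e : R) : 0 < e ->
  exists2 ep : R, 0 < ep & exists2 r : R, 0 < r & forall z beta t1 t2 : C, nrm z < r ->
    (1 + 2 * a2 * z + 3 * a3 * z ^+ 2) * beta + t1 = 1 ->
    nrm t1 <= ep * nrm z ^+ 2 -> nrm t2 <= ep * nrm z ^+ 2 ->
    nrm (1 + z * ((2 * a2 + 6 * a3 * z + 12 * a4 * z ^+ 2) * beta + t2) -
      (1 + 2 * a2 * z + (6 * a3 - 4 * a2 ^+ 2) * z ^+ 2
       + (12 * a4 - 18 * a2 * a3 + 8 * a2 ^+ 3) * z ^+ 3)) <= e * nrm z ^+ 3.
Proof.
move=> e0.
pose W (z : C) := 1 + 2 * a2 * z + 3 * a3 * z ^+ 2.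
pose S (z : C) := 2 * a2 + 6 * a3 * z + 12 * a4 * z ^+ 2.
pose p2 := 6 * a3 - 4 * a2 ^+ 2.
pose p3 := 12 * a4 - 18 * a2 * a3 + 8 * a2 ^+ 3.
pose P (z : C) := 2 * a2 + p2 * z + p3 * z ^+ 2.
(* [P] is the quotient [S / W] up to third order: [W P = S + z^3 (c3 + c4 z)]. *)
pose c3 := 2 * a2 * p3 + 3 * a3 * p2.
pose c4 := 3 * a3 * p3.
pose S0 := 2 * nrm a2 + 6 * nrm a3 + 12 * nrm a4.
have nn2 := nrm_ge0 a2; have nn3 := nrm_ge0 a3; have nn4 := nrm_ge0 a4.
have S00 : 0 <= S0 by rewrite /S0; lra.
pose ep := e / 4 / (S0 + 2).
pose c := nrm c3 + nrm c4.
have c0 : 0 <= c by rewrite addr_ge0 ?nrm_ge0.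
pose w := 2 * (2 * nrm a2 + 3 * nrm a3) + 1.
have w0 : 0 < w by rewrite /w; lra.
exists ep; first by rewrite !divr_gt0//; lra.
exists (Num.min 1 (Num.min w^-1 (e / (4 * c + 1)))).
  by rewrite !lt_min ltr01 invr_gt0 w0 divr_gt0//; lra.
move=> z beta t1 t2; rewrite !lt_min => /and3P[z1 zw zc] e1 t1b t2b.
have nz := nrm_ge0 z; have nz2 := sqr_ge0 (nrm z).
have z2 : nrm z ^+ 2 <= nrm z by rewrite expr2 ler_piMl// ltW.
pose t := S z * beta + t2.
have key : W z * (t - P z) = - (S z * t1) + W z * t2 - z ^+ 3 * (c3 + c4 * z).
  have -> : t1 = 1 - W z * beta by rewrite -e1 addrAC subrr add0r.
  by rewrite /t /W /S /P /c3 /c4 /p3 /p2; ring.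
have Sz : nrm (S z) <= S0.
  rewrite /S /S0; apply: (le_trans (nrmD _ _)); apply: (le_trans (lerD (nrmD _ _) (lexx _))).
  rewrite !(nrmX, nrmM, nrm_nat) -!addrA lerD2l lerD// ler_piMr ?mulr_ge0// ltW//.
  exact: le_lt_trans z1.
have W1 : nrm (W z - 1) <= 1 / 2.
  have -> : W z - 1 = 2 * a2 * z + 3 * a3 * z ^+ 2 by rewrite /W; ring.
  apply: (le_trans (nrmD _ _)); rewrite !(nrmX, nrmM, nrm_nat).
  have h := ler_wpM2l nn3 z2; clear -h zw nz w0.
  by move: zw; rewrite -div1r ltr_pdivlMr// /w; lra.
have Wl : 1 / 2 <= nrm (W z).
  have h := nrmB (W z) (W z - 1); rewrite opprB addrC subrK nrm1 in h; clear -h W1; lra.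
have Wu : nrm (W z) <= 2.
  have h := nrmD (W z - 1) 1; rewrite subrK nrm1 in h; clear -h W1; lra.
have cb : nrm (c3 + c4 * z) <= c.
  by apply: (le_trans (nrmD _ _)); rewrite nrmM lerD2l ler_piMr ?nrm_ge0// ltW.
have kb : nrm (W z * (t - P z)) <= e / 2 * nrm z ^+ 2.
  rewrite key; apply: (le_trans (nrmB _ _)); apply: (le_trans (lerD (nrmD _ _) (lexx _))).
  rewrite nrmN !(nrmX, nrmM).
  have i1 : nrm (S z) * nrm t1 <= S0 * (ep * nrm z ^+ 2) by rewrite ler_pM ?nrm_ge0.
  have i2 : nrm (W z) * nrm t2 <= 2 * (ep * nrm z ^+ 2) by rewrite ler_pM ?nrm_ge0.
  have i3 : (S0 + 2) * (ep * nrm z ^+ 2) = e / 4 * nrm z ^+ 2.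
    by rewrite mulrA [_ * ep]mulrC /ep divfK// gt_eqF// ltr_wpDl.
  have i4 : nrm z ^+ 3 * nrm (c3 + c4 * z) <= e / 4 * nrm z ^+ 2.
    have -> : nrm z ^+ 3 * nrm (c3 + c4 * z) = nrm z * nrm (c3 + c4 * z) * nrm z ^+ 2 by ring.
    rewrite ler_wpM2r//; have h := ler_wpM2l nz cb; clear -h zc c0 nz.
    by move: zc; rewrite ltr_pdivlMr; lra.
  by clear -i1 i2 i3 i4; lra.
have -> : 1 + z * t - (1 + 2 * a2 * z + p2 * z ^+ 2 + p3 * z ^+ 3) = z * (t - P z).
  by rewrite /P; ring.
rewrite nrmM exprS mulrCA ler_wpM2l//.
rewrite nrmM in kb; have h := ler_wpM2r (nrm_ge0 (t - P z)) Wl.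
by clear -kb h; lra.
Qed.

Section Expansion.
Variables (lambda : R) (F : X -> X) (x0 : X) (T : X -> C^o).
Hypotheses (F_lb : locally_biholomorphic F) (F_rad : radial_terms F)
  (F_cl : class_F lambda F) (x01 : `|x0| = 1) (T_sup : support_functionals x0 T).

Let hF : holomorphic_on_ball F := F_lb.1.

Let ray_ball z : nrm z < 1 -> unit_ball (z *: x0).
Proof.
by move=> z1; apply/unit_ballP; rewrite nrmZ {2}/nrm x01 mulr1.
Qed.

Definition aux_function (z : C) : C := 1 + z * T (Dinv F (z *: x0) (ray_Dn F x0 2 z)).

Let nx0 : nrm x0 = 1. Proof. by rewrite /nrm x01. Qed.

Let lT : linear T. Proof. by case: T_sup. Qed.

Let Tx0 : T x0 = 1. Proof. by case: T_sup => _ _ -> _. Qed.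

Let T_bound : exists M, bounded_by T M.
Proof. by apply/(bounded_continuous lT); case: T_sup. Qed.

(** The second derivative exists in operator norm, so the Lipschitz bound for [DF] along the ray is
    uniform in [v]: [M] bounds the second derivative at [z0 x0], and the added 1 covers the
    remainder. *)
Let diff_lipschitz z0 : nrm z0 < 1 -> exists2 K : R, 0 < K & exists2 r : R, 0 < r &
  forall z, nrm (z - z0) < r ->
    [/\ cancel (Dinv F (z *: x0)) ('d F (z *: x0)), cancel ('d F (z *: x0)) (Dinv F (z *: x0))
      & forall v, nrm ('d F (z *: x0) v - 'd F (z0 *: x0) v) <= K * nrm (z - z0) * nrm v].
Proof.
move=> z1; have xU := ray_ball z1.
have [hm _] := Dn_holo open_unit_ball (holomorphic_holo_on hF) 1.
have [bL hL] := Dn_is_derivative hm xU.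
have [M M0 hM] := bounded_multilinearE bL.
exists (M + 1); first lra.
have /near0P[r r0 hr] := hL 1 ltr01.
have [s s0 hs] := open_unit_ball xU.
exists (Num.min r s); first by rewrite lt_min r0.
move=> z; rewrite lt_min => /andP[zr zs].
have nzz : nrm (z *: x0 - z0 *: x0) = nrm (z - z0) by rewrite -scalerBl nrmZ nx0 mulr1.
have zU : unit_ball (z *: x0) by apply: hs; rewrite nzz.
have [BA AB] := DinvK (F_lb.2 _ zU).1.
split=> // v.
have := hr (z *: x0 - z0 *: x0); rewrite nzz => /(_ zr (fun=> v)).
rewrite subrKC big_ord1 mul1r !normE -rmorphM lecR nzz.
rewrite !Dn1_diff// => h1.
have h2 := hM (arg_cons (z *: x0 - z0 *: x0) (fun _ : 'I_1 => v)).
rewrite big_ord_recl big_ord1 arg_head_cons -[lift ord0 ord0]/(lift ord0 _) in h2.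
rewrite nzz in h2.
have h3 : arg_cons (z *: x0 - z0 *: x0) (fun _ : 'I_1 => v) (lift ord0 ord0) = v.
  by rewrite /arg_cons liftK.
rewrite h3 in h2.
set w := Dn F _ _ in h1 h2.
have := nrmD ('d F (z *: x0) v - 'd F (z0 *: x0) v - w) w.
by rewrite subrK; lra.
Qed.

Let Dinv_bound z : nrm z < 1 ->
  exists2 b : R, 0 < b & forall v, nrm (Dinv F (z *: x0) v) <= b * nrm v.
Proof.
move=> z1; have [bF cF] := F_lb.2 _ (ray_ball z1).
have [b [b0 hb]] := (bounded_continuous (Dinv_linear bF)).2 cF.
exists (b + 1); first lra.
by move=> v; have := hb v; have := nrm_ge0 v; lra.
Qed.

Lemma aux_function_deriv z : nrm z < 1 -> exists d, cderiv (Y := C^o) aux_function z d.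
Proof.
move=> z1; have [K K0 hA] := diff_lipschitz z1; have [b b0 hb] := Dinv_bound z1.
have ud := ray_Dn_deriv 2 hF (ray_ball z1).
pose w := Dinv F (z *: x0) (ray_Dn F x0 2 z).
have [L hL] := holo_on_Der w open_unit_ball (holomorphic_holo_on hF) (ray_ball z1).
have ad : cderiv (fun z => 'd F (z *: x0) w) z (L x0).
  have := frechet_ray (x := 0) (h := x0) (z := z); rewrite add0r => /(_ _ _ _ hL).
  apply: cderiv_ext; have [r r0 hr] := open_unit_ball (ray_ball z1).
  exists r => // y yz; rewrite add0r.
  have yU : unit_ball (y *: x0).
    by apply: hr; rewrite -scalerBl nrmZ nx0 mulr1.
  by rewrite (DerE (differentiable_frechet (hF yU))).
have qd := inverse_deriv K0 b0 (fun z => linearP ('d F (z *: x0))) hA hb ud ad.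
have [M LM] := T_bound.
have Tqd : cderiv (Y := C^o) (fun z => T (Dinv F (z *: x0) (ray_Dn F x0 2 z))) z
   (T (Dinv F (z *: x0) (ray_Dn F x0 3 z - L x0))).
  apply: (tangent_ext _ _ (tangent_comp qd (bounded_scale _) (tangent_linear _ lT) lT LM)).
    by exists 1.
  by move=> h; have [_ _ _ ->] := linearB0 lT.
eexists; exact: (cderivD (cderiv_cst (1 : C^o) z) (cderivM (cderiv_id z) Tqd)).
Qed.

Lemma aux_function_Re z : nrm z < 1 -> z != 0 -> 1 / 2 - lambda <= complex.Re (aux_function z).
Proof.
move=> z1 z0; have xU := ray_ball z1.
have [_ _ hcl] := F_cl.
have x0n0 : x0 != 0 by apply: nrm_neq0; rewrite nx0.
have := hcl _ xU _ _ (support_scale z0 x01 T_sup).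
rewrite scaler_eq0 (negbTE z0) (negbTE x0n0) => /(_ isT).
have [bF _] := F_lb.2 _ xU.
have lB := Dinv_linear bF; have [_ _ BD BZ] := linearB0 lB.
have [_ AB] := DinvK bF.
have [[_ hm _] _] := Dn_holo open_unit_ball (holomorphic_holo_on hF) 2.
rewrite (multilinear2_scale z x0 (hm _ xU)) BD BZ AB.
have [_ _ TD TZ] := linearB0 lT.
rewrite !(TZ, TD) Tx0 normrZ x01 mulr1.
congr (_ <= complex.Re _); rewrite /aux_function /GRing.scale /= /ray_Dn.
have nz : `|z| != 0 by rewrite normr_eq0.
by field; rewrite z0 nz.
Qed.

Let a n := coef F x0 T n.

Let ray_Dn0 n : (2 <= n <= 4)%N -> ray_Dn F x0 n 0 = (n`!%:R * a n) *: x0.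
Proof.
case: n => // k k3; have [H _ hH] := F_rad k3.
have f0 : k.+1`!%:R != 0 :> C by rewrite pnatr_eq0 -lt0n fact_gt0.
rewrite /a /coef /ray_Dn scale0r mulrA mulfV// mul1r.
have E : Dn F 0 (fun _ : 'I_k.+1 => x0) = (k.+1`!%:R * H x0) *: x0.
  by rewrite -scalerA -hH scalerA mulfV// scale1r.
rewrite {1}E; congr (_ *: _); rewrite E.
by have [_ _ _ ->] := linearB0 lT; rewrite Tx0 [_ *: _]mulr1.
Qed.

Let ray_Dn10 : ray_Dn F x0 1 0 = x0.
Proof.
rewrite /ray_Dn scale0r Dn1_diff//; last by apply/unit_ballP; rewrite nrm0.
by have [[_ DF0] _ _] := F_cl; exact: DF0.
Qed.

Lemma aux_function_expansion (e : R) : 0 < e -> exists2 r : R, 0 < r & forall z, nrm z < r ->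
  nrm (aux_function z - (1 + 2 * a 2 * z + (6 * a 3 - 4 * a 2 ^+ 2) * z ^+ 2
    + (12 * a 4 - 18 * a 2 * a 3 + 8 * a 2 ^+ 3) * z ^+ 3)) <= e * nrm z ^+ 3.
Proof.
move=> e0; have rd2 := ray_Dn0 (n := 2) isT; have rd3 := ray_Dn0 (n := 3) isT.
have rd4 := ray_Dn0 (n := 4) isT.
move: (a 2) (a 3) (a 4) rd2 rd3 rd4 => a2 a3 a4 rd2 rd3 rd4.
have z01 : nrm (0 : C) < 1 by rewrite nrm0.
have [K K0 hA] := diff_lipschitz z01; have [b b0 hb] := Dinv_bound z01.
have [s s0 hs] := inverse_near K0 b0 hA hb.
have [M [M0 hM]] := T_bound.
have [ep ep0 [r0 r00 quot]] := quotient_expansion a2 a3 a4 e0.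
have bM : 0 <= 2 * b * M by rewrite !mulr_ge0// ltW.
(* Applying [T] after the inverse differential enlarges a remainder by at most the factor
   [2 b M]. *)
pose eta := ep / (2 * b * M + 1).
have eta0 : 0 < eta by rewrite divr_gt0// ltr_wpDl.
have dn n : exists2 r : R, 0 < r & forall z, nrm z < r ->
    cderiv (ray_Dn F x0 n) z (ray_Dn F x0 n.+1 z).
  by exists 1 => // z /ray_ball; apply: ray_Dn_deriv.
have d0 n : cderiv (ray_Dn F x0 n) 0 (ray_Dn F x0 n.+1 0).
  by apply: ray_Dn_deriv => //; apply: ray_ball.
have [r1 r10 h1] := taylor2 (dn 1%N) (d0 2) eta0.
have [r2 r20 h2] := taylor2 (dn 2) (d0 3) eta0.
exists (Num.min (Num.min (Num.min 1 s) (Num.min r1 r2)) r0).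
  by rewrite !lt_min ltr01 s0 r10 r20.
move=> z; rewrite !lt_min => /andP[/andP[/andP[z1 zs] /andP[zr1 zr2]] zr0].
have xU := ray_ball z1.
have [bF _] := F_lb.2 _ xU.
have [_ _ BD BZ] := linearB0 (Dinv_linear bF).
have [_ AB] := DinvK bF.
have [_ _ TD TZ] := linearB0 lT.
pose W := 1 + 2 * a2 * z + 3 * a3 * z ^+ 2.
pose S := 2 * a2 + 6 * a3 * z + 12 * a4 * z ^+ 2.
pose B := Dinv F (z *: x0).
pose u1 := ray_Dn F x0 1 z - W *: x0.
pose u2 := ray_Dn F x0 2 z - S *: x0.
have u1e : nrm u1 <= eta * nrm z ^+ 2.
  apply: le_trans (h1 z zr1).
  rewrite ray_Dn10 ?rd2 ?rd3 ?rd4 -[2`!]/2%N -[3`!]/6%N.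
  rewrite [leLHS](_ : _ = nrm (ray_Dn F x0 1 z - (x0 + z *: ((2%:R * a2) *: x0) +
    (z ^+ 2 / 2) *: ((6%:R * a3) *: x0))))//.
  by congr nrm; rewrite /u1 /W; module_eq; field.
have u2e : nrm u2 <= eta * nrm z ^+ 2.
  apply: le_trans (h2 z zr2).
  rewrite ?rd2 ?rd3 ?rd4 -[2`!]/2%N -[3`!]/6%N -[4`!]/24%N.
  rewrite [leLHS](_ : _ = nrm (ray_Dn F x0 2 z - ((2%:R * a2) *: x0 + z *: ((6%:R * a3) *: x0) +
    (z ^+ 2 / 2) *: ((24%:R * a4) *: x0))))//.
  by congr nrm; rewrite /u2 /S; module_eq; field.
have tb u : nrm u <= eta * nrm z ^+ 2 -> nrm (T (B u)) <= ep * nrm z ^+ 2.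
  move=> hu; apply: (le_trans (hM _)).
  have hB : nrm (B u) <= 2 * b * nrm u by apply: hs; rewrite subr0.
  apply: (le_trans (ler_wpM2l M0 hB)); rewrite mulrA [M * _]mulrC.
  apply: (le_trans (ler_wpM2l bM hu)); rewrite mulrA ler_wpM2r ?sqr_ge0//.
  by rewrite mulrCA ler_piMr ?(ltW ep0)// ler_pdivrMr ?ltr_wpDl// mul1r lerDl.
have e1 : W * T (B x0) + T (B u1) = 1.
  rewrite -Tx0 -[x0 in RHS](AB x0) -/B -Dn1_diff// -/(ray_Dn F x0 1 z).
  have -> : ray_Dn F x0 1 z = W *: x0 + u1 by rewrite subrKC.
  by rewrite /B (BD (W *: x0)) BZ TD TZ.
have e2 : T (B (ray_Dn F x0 2 z)) = S * T (B x0) + T (B u2).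
  have -> : ray_Dn F x0 2 z = S *: x0 + u2 by rewrite subrKC.
  by rewrite /B (BD (S *: x0)) BZ TD TZ.
rewrite /aux_function -/B e2.
exact: quot zr0 e1 (tb _ u1e) (tb _ u2e).
Qed.

End Expansion.
End AuxiliaryFunction.

(** * Toeplitz positivity *)

Section Coefficients.
Context {R : realType}.
Local Notation C := R[i].

Lemma cderiv_expn k (z : C) : exists d, cderiv (Y := C^o) (fun z => z ^+ k) z d.
Proof.
elim: k => [|k [d hd]].
  exists 0; apply: cderiv_ext (cderiv_cst (1 : C^o) z).
  by exists 1 => // y _; rewrite expr0.
eexists; apply: cderiv_ext (cderivM (cderiv_id z) hd).
by exists 1 => // y _; rewrite exprS.
Qed.

Lemma cderiv_poly (c : nat -> C) k (z : C) :
  exists d, cderiv (Y := C^o) (fun z => \sum_(j < k) c j * z ^+ j) z d.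
Proof.
elim: k => [|k [d hd]].
  exists 0; apply: cderiv_ext (cderiv_cst (0 : C^o) z).
  by exists 1 => // y _; rewrite big_ord0.
have [d' hd'] := cderiv_expn k z.
eexists; apply: cderiv_ext (cderivD hd (cderivM (cderiv_cst (c k : C^o) z) hd')).
by exists 1 => // y _; rewrite big_ord_recr.
Qed.

Lemma conj_circle (w : C) : nrm w = 1 -> w^*%C = w^-1.
Proof.
move=> w1; have w0 : w != 0 by apply: nrm_neq0; rewrite w1.
by apply: (mulfI w0); rewrite mul_conj w1 expr1n mulfV.
Qed.

Lemma avg_conj (f : C -> C^o) n : avg (fun w => (f w)^*%C : C^o) n = (avg f n)^*%C.
Proof.
rewrite /avg /GRing.scale /= rmorphM rmorph_sum /= fmorphV rmorphXn.
by rewrite (rmorph_nat _ 2).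
Qed.

Lemma avg_pow k : (0 < k)%N -> seqlim (Y := C^o) (avg (fun w : C => w ^+ k : C^o)) 0.
Proof.
move=> k0; have := @cauchy_mean0 R C^o (fun z => z ^+ k) 1 ltr01 (fun z _ _ => cderiv_expn k z).
have [d hd] := cderiv_expn k 0; move=> /(_ (cderiv_cont hd)).
rewrite expr0n gtn_eqF//; apply: seqlim_eq => n.
by apply: avg_eq => w _; rewrite mul1r.
Qed.

Lemma avg_powV k : (0 < k)%N -> seqlim (Y := C^o) (avg (fun w : C => w ^- k : C^o)) 0.
Proof.
move=> k0 e /(avg_pow k0)[N hN]; exists N => n /hN; rewrite !subr0.
rewrite -nrm_conj -avg_conj; congr (nrm _ <= _).
  apply: (avg_eq (Y := C^o)) => w w1.
by rewrite rmorphXn /= conj_circle// exprVn.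
Qed.

Definition expands (p : C -> C) (c : nat -> C) k := forall e : R, 0 < e ->
  exists2 r : R, 0 < r & forall z, nrm z < r ->
    nrm (p z - \sum_(j < k.+1) c j * z ^+ j) <= e * nrm z ^+ k.

Lemma expands_le p c k m : (m <= k)%N -> expands p c k -> expands p c m.
Proof.
move=> /subnK <-; elim: (k - m)%N => [//|j ih h]; apply: ih => e e0.
set l := (j + m)%N in h *.
have [r r0 hr] := h (e / 2) ltac:(lra).
have cn := nrm_ge0 (c l.+1).
exists (Num.min (Num.min r 1) (e / 2 / (nrm (c l.+1) + 1))).
  by rewrite !lt_min r0 ltr01 !divr_gt0//; lra.
move=> z; rewrite !lt_min => /andP[/andP[/hr h1 z1]]; rewrite ltr_pdivlMr; last lra.
move=> z2; have nz := nrm_ge0 z.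
rewrite big_ord_recr /= opprD addrA in h1.
have := nrmD (p z - \sum_(j < l.+1) c j * z ^+ j - c l.+1 * z ^+ l.+1) (c l.+1 * z ^+ l.+1).
rewrite subrK nrmM nrmX => h3; apply: (le_trans h3).
have h4 : nrm z ^+ l.+1 <= nrm z ^+ l by rewrite ler_wiXn2l// ltW.
have h5 : nrm (c l.+1) * nrm z ^+ l.+1 <= e / 2 * nrm z ^+ l.
  by rewrite exprS mulrA ler_wpM2r ?exprn_ge0//; lra.
by have := ler_wpM2l (ltW (ltac:(lra) : 0 < e / 2)) h4; lra.
Qed.

Section Disc.
Variables (p : C -> C) (r : R).
Hypotheses (r0 : 0 < r) (r1 : r < 1).
Hypothesis hp : forall z, nrm z < 1 -> exists d, cderiv (Y := C^o) p z d.

Let rC0 : r%:C != 0 :> C := realC_neq0 r0.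

(** Removing the lower terms and dividing by [z^k] leaves a function that is continuous at 0 with
    value [c k], to which the mean value property applies. The removed terms return as averages of
    negative powers of [w], which tend to 0. *)
Lemma avg_coef c k : expands p c k ->
  seqlim (Y := C^o) (avg (fun w : C => w ^- k * p (r%:C * w) : C^o)) (c k * r%:C ^+ k).
Proof.
move=> pc.
pose psi (z : C) : C := if z == 0 then c k else z ^- k * (p z - \sum_(j < k) c j * z ^+ j).
have psid z : nrm z <= r -> z != 0 -> exists d, cderiv (Y := C^o) psi z d.
  move=> zr z0; have [d hd] := hp (le_lt_trans zr r1).
  have [d1 hd1] := cderiv_poly c k z.
  have [d2 hd2] := cderiv_expn k z.
  have hV := cderiv_comp hd2 (cderiv_inv (expf_neq0 k z0)).
  eexists; apply: cderiv_ext (cderivM hV (cderivD hd (cderivZ (-1) hd1))).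
  exists (nrm z); first exact: nrm_gt0.
  move=> y yz; rewrite /psi ifN ?scaleN1r//.
  by apply: contraTneq yz => ->; rewrite sub0r nrmN ltxx.
have psi0 : cont_at (X := C^o) (Y := C^o) psi 0.
  move=> e e0; have [s s0 hs] := pc _ e0; exists s => // z; rewrite subr0 => /hs.
  rewrite /psi eqxx; have [->|z0] := eqVneq z 0; first by move=> _; rewrite subrr nrm0 ltW.
  move=> h; have zk : 0 < nrm z ^+ k by rewrite exprn_gt0// nrm_gt0.
  rewrite -(ler_pM2r zk); apply: le_trans h.
  rewrite mulrC -nrmX -nrmM le_eqVlt; apply/orP; left; apply/eqP; congr nrm.
  rewrite mulrBr mulrA mulfV ?expf_neq0// mul1r big_ord_recr /= opprD addrA.
  by rewrite [z ^+ k * _]mulrC.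
have := cauchy_mean0 r0 psid psi0; rewrite {2}/psi eqxx => h.
have hsum m : (m <= k)%N -> seqlim (Y := C^o) (fun n => \sum_(j < m)
     (c j * r%:C ^+ j) *: avg (fun w => w ^- (k - j) : C^o) n) (\sum_(j < m) 0).
  elim: m => [_|m ih mk].
    by rewrite big_ord0; apply: seqlim_eq (seqlim_cst _) => n; rewrite big_ord0.
  rewrite big_ord_recr /=.
  apply: seqlim_eq (seqlimD (ih (ltnW mk)) _) => [n|]; first by rewrite big_ord_recr.
  rewrite -[X in seqlim _ X](scaler0 _ (c m * r%:C ^+ m)).
  by apply: seqlimZ; apply: avg_powV; rewrite subn_gt0.
have := seqlimD (seqlimZ (r%:C ^+ k) h) (hsum k (leqnn k)).
rewrite sumr_const mul0rn addr0 [_ *: _]mulrC; apply: seqlim_eq => n.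
rewrite -avgZ.
have -> : \sum_(j < k) (c j * r%:C ^+ j) *: avg (fun w => w ^- (k - j) : C^o) n =
    avg (fun w => \sum_(j < k) (c j * r%:C ^+ j) *: (w ^- (k - j) : C^o)) n.
  rewrite /avg exchange_big scaler_sumr; apply: eq_bigr => j _.
  by rewrite -scaler_sumr !scalerA mulrC.
rewrite -avgD; apply: avg_eq => w w1.
have w0 : w != 0 by apply: nrm_neq0; rewrite w1.
rewrite /psi ifN ?mulf_neq0// /GRing.scale /= mulrA exprMn invfM mulrA mulfV ?expf_neq0// mul1r.
rewrite mulrBr mulr_sumr -addrA [- _ + _]addrC -sumrB big1 ?addr0// => j _.
apply/eqP; rewrite subr_eq0; apply/eqP.
rewrite exprMn -[in w ^- k](subnK (ltnW (ltn_ord j))) exprD invfM.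
by field; rewrite !expf_neq0.
Qed.

Lemma avg_coefN k : (0 < k)%N ->
  seqlim (Y := C^o) (avg (fun w : C => w ^+ k * p (r%:C * w) : C^o)) 0.
Proof.
move=> k0.
have hd z : nrm z < 1 -> exists d, cderiv (Y := C^o) (fun z => z ^+ k * p z) z d.
  move=> z1; have [d hd] := hp z1; have [d' hd'] := cderiv_expn k z.
  by eexists; apply: cderivM hd' hd.
have z1 : nrm (0 : C) < 1 by rewrite nrm0.
have [d0 hd0] := hd 0 z1.
have := cauchy_mean0 r0 (fun z zr _ => hd z (le_lt_trans zr r1)) (cderiv_cont hd0).
rewrite expr0n gtn_eqF// mul0r => h.
have := seqlimZ (r%:C ^- k) h; rewrite scaler0; apply: seqlim_eq => n.
rewrite -avgZ; apply: avg_eq => w _.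
by rewrite /GRing.scale /= exprMn !mulrA mulVf ?expf_neq0// mul1r.
Qed.

Lemma seqlim_Re_ge0 (u : nat -> C^o) (l : C) : (forall n, 0 <= complex.Re (u n)) ->
  seqlim u l -> 0 <= complex.Re l.
Proof.
move=> u0 ul; apply/ler_addgt0Pr => e e0; have [N hN] := ul e e0.
have h1 := hN N (leqnn N); have h2 := Re_le_nrm (u N - l).
have : complex.Re (u N) - complex.Re l <= e.
  have -> : complex.Re (u N) - complex.Re l = complex.Re (u N - l) by rewrite raddfB.
  by apply: (le_trans (ler_norm _)); apply: le_trans h1.
by have := u0 N; lra.
Qed.

(** The average of [p(r w) |V(w)|^2] with [V(w) = x 0 + ... + x 3 w^3] has nonnegative real part. In
    the expanded product, [w^(i - j)] picks out the coefficient of index [j - i], which is 0 when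
    [j < i]. *)
Lemma toeplitz c : expands p c 3 -> (forall z, nrm z < 1 -> 0 <= complex.Re (p z)) ->
  forall x : nat -> C, 0 <= complex.Re (\sum_(i < 4) \sum_(j < 4)
    x i * (x j)^*%C * (if (i <= j)%N then c (j - i)%N * r%:C ^+ (j - i) else 0)).
Proof.
move=> pc pRe x.
pose V (w : C) := \sum_(i < 4) x i * w ^+ i.
apply: (@seqlim_Re_ge0 (avg (fun w => p (r%:C * w) * (V w * (V w)^*%C) : C^o))).
  move=> n; rewrite /avg.
  have -> : 2 ^- n *: (\sum_(k < 2 ^ n) p (r%:C * circ n k) * (V (circ n k) * (V (circ n k))^*%C) : C^o)
     = \sum_(k < 2 ^ n) p (r%:C * circ n k) * (2 ^- n * nrm (V (circ n k)) ^+ 2)%:C.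
    have e2 : (2 ^- n : C) = (2 ^- n : R)%:C by rewrite fmorphV rmorphXn /= (rmorph_nat _ 2).
    rewrite scaler_sumr; apply: eq_bigr => k _.
    by rewrite mul_conj e2 [(_ * nrm _ ^+ 2)%:C]rmorphM [_ *: _]mulrCA.
  rewrite raddf_sum; apply: sumr_ge0 => k _.
  rewrite [leRHS]Re_mul_real mulr_ge0//; last by rewrite mulr_ge0 ?sqr_ge0// invr_ge0 exprn_ge0.
  by apply: pRe; rewrite nrmM nrm_circ mulr1 nrm_real gtr0_norm.
have term (i j : nat) : (i < 4)%N -> (j < 4)%N ->
    seqlim (Y := C^o) (avg (fun w => x i * (x j)^*%C * (w ^+ i * w ^- j * p (r%:C * w)) : C^o))
     (x i * (x j)^*%C * (if (i <= j)%N then c (j - i)%N * r%:C ^+ (j - i) else 0)).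
  move=> i4 j4.
  have h : seqlim (Y := C^o) (avg (fun w => w ^+ i * w ^- j * p (r%:C * w) : C^o))
      (if (i <= j)%N then c (j - i)%N * r%:C ^+ (j - i) else 0).
    have w0 (w : C) : nrm w = 1 -> w != 0.
      by move=> w1; apply/eqP => w0; move: w1; rewrite w0 nrm0 => /eqP; rewrite eq_sym oner_eq0.
    case: leqP => ij.
      have ji : (j - i <= 3)%N by rewrite leq_subLR (leq_trans _ (leq_addl _ _)).
      apply: seqlim_eq (avg_coef (expands_le ji pc)) => n; apply: avg_eq => w /w0 wn.
      have -> : w ^+ j = w ^+ (j - i) * w ^+ i by rewrite -exprD subnK.
      by congr (_ * _); field; rewrite !expf_neq0.
    apply: seqlim_eq (avg_coefN (k := (i - j)%N) _) => [n|]; last by rewrite subn_gt0.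
    apply: avg_eq => w /w0 wn.
    have -> : w ^+ i = w ^+ (i - j) * w ^+ j by rewrite -exprD subnK// ltnW.
    by congr (_ * _); field; rewrite expf_neq0.
  have := seqlimZ (x i * (x j)^*%C) h; apply: seqlim_eq => n.
  by rewrite -avgZ.
have fin : seqlim (Y := C^o) (fun n => \sum_(i < 4) \sum_(j < 4)
    avg (fun w => x i * (x j)^*%C * (w ^+ i * w ^- j * p (r%:C * w)) : C^o) n)
   (\sum_(i < 4) \sum_(j < 4)
    x i * (x j)^*%C * (if (i <= j)%N then c (j - i)%N * r%:C ^+ (j - i) else 0)).
  rewrite !big_ord_recr !big_ord0 /= !add0r.
  apply: seqlim_eq; last first.
    by do 3 (apply: seqlimD; last by do 3 (apply: seqlimD; last exact: term); exact: term);
     do 3 (apply: seqlimD; last exact: term); exact: term.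
  by move=> n; rewrite !big_ord_recr !big_ord0 /= !add0r.
apply: seqlim_eq fin => n.
transitivity (avg (fun w => \sum_(i < 4) \sum_(j < 4)
    x i * (x j)^*%C * (w ^+ i * w ^- j * p (r%:C * w)) : C^o) n).
  by rewrite !big_ord_recr !big_ord0 /= !add0r -!avgD; apply: avg_eq => w _;
    rewrite !big_ord_recr !big_ord0 /= !add0r.
apply: avg_eq => w w1.
have -> : (V w)^*%C = \sum_(j < 4) (x j)^*%C * w ^- j.
  rewrite rmorph_sum; apply: eq_bigr => j _ /=.
  by rewrite rmorphM rmorphXn /= (conj_circle w1) exprVn.
rewrite /V !big_ord_recr !big_ord0 /=.
move: (w ^- 0) (w ^- 1) (w ^- 2) (w ^- 3) => a0 a1 a2 a3.
by ring.
Qed.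

End Disc.
End Coefficients.

(** * Schur parameters and the extremal problem for coefficients *)

Section SchurParameters.
Context {R : realType}.
Local Notation C := R[i].

Lemma sqr_nrm_reflect (x y : C) :
  nrm y ^+ 2 - nrm (y - 2 * x) ^+ 2 = 4 * complex.Re ((y - x) * x^*%C).
Proof. by rewrite !sqr_nrm; case: x => a b; case: y => c d /=; ring. Qed.

(** The lower triangular Toeplitz matrix with first column [b0, b1, b2] is a contraction: Schur's
    criterion for these to be the first coefficients of a function bounded by 1 on the disc. *)
Definition schur_contraction (b0 b1 b2 : C) := forall u0 u1 u2 : C,
  nrm (b0 * u0) ^+ 2 + nrm (b1 * u0 + b0 * u1) ^+ 2 + nrm (b2 * u0 + b1 * u1 + b0 * u2) ^+ 2
  <= nrm u0 ^+ 2 + nrm u1 ^+ 2 + nrm u2 ^+ 2.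

(* Cayley transform: if [L] is the lower triangular Toeplitz matrix of [1, c1, c2, c3], then
   [|(L + 1) x|^2 - |(L - 1) x|^2 = 4 Re <L x, x>], and [x] is chosen with [(L + 1) x = (u0, u1, u2, 0)]. *)
Lemma toeplitz_schur (c1 c2 c3 : C) :
  (forall x0 x1 x2 x3 : C, 0 <= complex.Re (x0 * x0^*%C + (c1 * x0 + x1) * x1^*%C
     + (c2 * x0 + c1 * x1 + x2) * x2^*%C + (c3 * x0 + c2 * x1 + c1 * x2 + x3) * x3^*%C)) ->
  let b0 := c1 / 2 in let b1 := c2 / 2 - b0 ^+ 2 in
  schur_contraction b0 b1 (c3 / 2 - 2 * b0 * b1 - b0 ^+ 3).
Proof.
move=> h b0 b1 u0 u1 u2.
(* The matrix [(L - 1) (L + 1)^-1] is strictly lower triangular, so a fourth component of [u] would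
   not enter the result: order 4 for positivity gives order 3 for contractivity. *)
pose x0 := u0 / 2; pose x1 := (u1 - c1 * x0) / 2; pose x2 := (u2 - c2 * x0 - c1 * x1) / 2.
pose x3 := - (c3 * x0 + c2 * x1 + c1 * x2) / 2.
have r0 := sqr_nrm_reflect x0 u0; have r1 := sqr_nrm_reflect x1 u1.
have r2 := sqr_nrm_reflect x2 u2; have r3 := sqr_nrm_reflect x3 0.
have e0 : u0 - 2 * x0 = 0 by rewrite /x0; field.
have e0' : u0 - x0 = x0 by rewrite /x0; field.
have e1 : u1 - 2 * x1 = b0 * u0 by rewrite /x1 /x0 /b0; field.
have e1' : u1 - x1 = c1 * x0 + x1 by rewrite /x1; field.
have e2 : u2 - 2 * x2 = b1 * u0 + b0 * u1 by rewrite /x2 /x1 /x0 /b1 /b0; field.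
have e2' : u2 - x2 = c2 * x0 + c1 * x1 + x2 by rewrite /x2; field.
have e3 : 0 - 2 * x3 = (c3 / 2 - 2 * b0 * b1 - b0 ^+ 3) * u0 + b1 * u1 + b0 * u2.
  by rewrite /x3 /x2 /x1 /x0 /b1 /b0; field.
have e3' : 0 - x3 = c3 * x0 + c2 * x1 + c1 * x2 + x3 by rewrite /x3; field.
rewrite e0 e0' nrm0 in r0; rewrite e1 e1' in r1; rewrite e2 e2' in r2.
rewrite e3 e3' nrm0 in r3.
rewrite expr0n /= in r0 r3.
have ReD (v w : C) : complex.Re (v + w) = complex.Re v + complex.Re w by rewrite raddfD.
have {}h := h x0 x1 x2 x3; rewrite !ReD in h.
by lra.
Qed.

(** With [x = b y] and [|g| < 1], this identity shows that [(b - g) / (1 - g^* b)] is bounded by 1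
    whenever [b] is. *)
Lemma sqr_nrm_schur (g x y : C) :
  nrm (y - g^*%C * x) ^+ 2 - nrm (x - g * y) ^+ 2 =
  (1 - nrm g ^+ 2) * (nrm y ^+ 2 - nrm x ^+ 2).
Proof. by rewrite !sqr_nrm; case: x => a b; case: y => c d; case: g => p q /=; ring. Qed.

(* One step of the Schur algorithm, [b |-> (b - g) / (z (1 - g^* b))] with [g = b0]. *)
Lemma schur_step (b0 b1 b2 : C) : schur_contraction b0 b1 b2 -> nrm b0 < 1 ->
  exists x e : C, [/\ b1 = (1 - nrm b0 ^+ 2)%:C * x,
    b2 = (1 - nrm b0 ^+ 2)%:C * (e - b0^*%C * x ^+ 2)
    & nrm e <= 1 - nrm x ^+ 2].
Proof.
move=> h b01; set s := 1 - nrm b0 ^+ 2.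
have s0 : 0 < s.
  by rewrite subr_gt0 expr_lt1// nrm_ge0.
have sC0 : s%:C != 0 :> C.
  exact: realC_neq0.
pose x := b1 / s%:C; pose e := b2 / s%:C + b0^*%C * x ^+ 2.
have sE : s%:C = 1 - b0 * b0^*%C by rewrite mul_conj rmorphB rmorph1.
have key m0 m1 : nrm (x * m0) ^+ 2 + nrm (e * m0 + x * m1) ^+ 2 <= nrm m0 ^+ 2 + nrm m1 ^+ 2.
  pose g := b0^*%C.
  (* With [b] read as a Toeplitz matrix, [u] solves [(1 - g b) u = (m0, m1, 0)]; then
     [(b - b0) u = (0, x m0, e m0 + x m1)], and the leading 0 is the division by [z]. *)
  pose u0 := m0 / s%:C; pose u1 := (m1 + g * b1 * u0) / s%:C.
  pose u2 := (g * b1 * u1 + g * b2 * u0) / s%:C.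
  have := h u0 u1 u2.
  have k0 := sqr_nrm_schur b0 (b0 * u0) u0.
  have k1 := sqr_nrm_schur b0 (b1 * u0 + b0 * u1) u1.
  have k2 := sqr_nrm_schur b0 (b2 * u0 + b1 * u1 + b0 * u2) u2.
  have s1 : 1 - b0 * g != 0 by rewrite -sE.
  have a0 : u0 - g * (b0 * u0) = m0 by rewrite /u0 sE -/g; field.
  have a0' : b0 * u0 - b0 * u0 = 0 by rewrite subrr.
  have a1 : u1 - g * (b1 * u0 + b0 * u1) = m1 by rewrite /u1 /u0 sE -/g; field.
  have a1' : b1 * u0 + b0 * u1 - b0 * u1 = x * m0 by rewrite /u1 /u0 /x sE -/g; field.
  have a2 : u2 - g * (b2 * u0 + b1 * u1 + b0 * u2) = 0.
    by rewrite /u2 /u1 /u0 sE -/g; field.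
  have a2' : b2 * u0 + b1 * u1 + b0 * u2 - b0 * u2 = e * m0 + x * m1.
    by rewrite /u2 /u1 /u0 /e /x sE -/g; field.
  rewrite -/g a0 a0' nrm0 -/s in k0; rewrite -/g a1 a1' -/s in k1.
  rewrite -/g a2 a2' nrm0 -/s in k2; rewrite expr0n /= in k0 k2.
  by nra.
have := key 1 0; rewrite !mulr1 mulr0 addr0 nrm1 nrm0 expr0n /= expr1n addr0 => k1.
(* At this vector, with [t = 1 - |x|^2], the second component of the image collapses to [e]. The
   inequality becomes [t |e|^2 <= t^3], which settles [t > 0]; the case [t = 0] follows from
   [k1]. *)
have k2 := key (1 - nrm x ^+ 2)%:C (x^*%C * e).
exists x, e; split.
- by rewrite /x mulrCA mulfV// mulr1.
- by rewrite /e addrK mulrCA mulfV// mulr1.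
clearbody e; clearbody x; set t := 1 - nrm x ^+ 2 in k2 *.
have t0 : 0 <= t by rewrite /t; have := sqr_ge0 (nrm e); lra.
have e2 : e * t%:C + x * (x^*%C * e) = e.
  by rewrite mulrA mul_conj /t rmorphB rmorph1; ring.
rewrite e2 !nrmM nrm_conj nrm_real (ger0_norm t0) in k2.
rewrite -(@ler_pXn2r _ 2) ?nnegrE ?nrm_ge0//.
have [t00|tn0] := eqVneq t 0; first by rewrite t00 expr0n /=; rewrite /t in t00; lra.
have tp : 0 < t by rewrite lt_neqAle eq_sym tn0.
rewrite -(ler_pM2l tp).
have xt : nrm x ^+ 2 = 1 - t by rewrite /t; ring.
move: k2; rewrite !exprMn xt; lra.
Qed.

(** The worst case is [y = 1], because [3 t <= 2 + t^2] amounts to [(1 - t) (2 - t) >= 0]. What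
    remains is a concave quadratic in [t^2], and the right-hand side is its maximum, seen by
    completing the square. *)
Lemma hankel_real_bound (mu t y : R) : 1 <= mu <= 3 / 2 -> 0 <= t <= 1 -> 0 <= y <= 1 ->
  t ^+ 4 * ((mu - 1) * (1 + 2 * mu)) + (2 + mu) * t ^+ 2 * (1 - t ^+ 2) * y
   + 3 * (1 - t ^+ 2) * t * (1 - y ^+ 2) + (1 - t ^+ 2) * (2 + t ^+ 2) * y ^+ 2
  <= (33 - 15 * mu) / (8 * (2 - mu)).
Proof.
move=> mu1 t01 y01.
have m2 : 0 < 2 - mu by lra.
have s0 : 0 <= 1 - t ^+ 2 by nra.
have c0 : 0 <= (1 - t) * (2 - t) by apply: mulr_ge0; lra.
have y2 : y ^+ 2 <= 1 by nra.
have h1 : 3 * t * (1 - y ^+ 2) + (2 + t ^+ 2) * y ^+ 2 <= 2 + t ^+ 2 by nra.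
have h2 := ler_wpM2l s0 h1.
have h3 : (2 + mu) * t ^+ 2 * (1 - t ^+ 2) * y <= (2 + mu) * t ^+ 2 * (1 - t ^+ 2).
  by rewrite ler_piMr//; [rewrite !mulr_ge0 ?sqr_ge0//; lra|lra].
have -> : (33 - 15 * mu) / (8 * (2 - mu)) = 2 * (1 + mu) * (2 - mu) * (t ^+ 2 - 1 / (4 * (2 - mu))) ^+ 2
   + (t ^+ 4 * ((mu - 1) * (1 + 2 * mu)) + (2 + mu) * t ^+ 2 * (1 - t ^+ 2) + (1 - t ^+ 2) * (2 + t ^+ 2)).
  by field; lra.
have h4 : 0 <= 2 * (1 + mu) * (2 - mu) * (t ^+ 2 - 1 / (4 * (2 - mu))) ^+ 2.
  by apply: mulr_ge0 (sqr_ge0 _); apply: mulr_ge0; lra.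
lra.
Qed.

(** In Schur parameters, [b1 ^+ 2] and the [x ^+ 2] part of [b2] merge into the single coefficient
    [- s (2 + |b0|^2)]. At [b0 = t], [x = -1], [e = 0] all terms have the same sign, so the triangle
    inequality loses nothing in the extremal case. If [|b0| = 1], the other coefficients vanish and
    there are no further parameters. *)
Lemma schur_hankel_bound (mu : R) (b0 b1 b2 : C) : 1 <= mu <= 3 / 2 ->
  schur_contraction b0 b1 b2 ->
  nrm (b0 ^+ 4 * ((1 - mu) * (1 + 2 * mu))%:C + (2 + mu)%:C * b0 ^+ 2 * b1 + 3 * b0 * b2 - 2 * b1 ^+ 2)
    <= (33 - 15 * mu) / (8 * (2 - mu)).
Proof.
move=> mu1 h.
have := h 1 0 0; rewrite !mulr1 !mulr0 !addr0 nrm1 !nrm0 !expr0n /= expr1n !addr0 => h1.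
have n0 := nrm_ge0 b0; have n1 := sqr_ge0 (nrm b1); have n2 := sqr_ge0 (nrm b2).
have b01 : nrm b0 <= 1 by nra.
have [b0e|b0n] := eqVneq (nrm b0) 1.
  rewrite b0e expr1n in h1.
  have b10 : b1 = 0 by apply: nrm_eq0; apply/eqP; rewrite -sqrf_eq0; apply/eqP; lra.
  have b20 : b2 = 0 by apply: nrm_eq0; apply/eqP; rewrite -sqrf_eq0; apply/eqP; lra.
  rewrite b10 b20 expr0n /= !mulr0 subr0 !addr0 nrmM nrmX b0e expr1n mul1r nrm_real.
  have := @hankel_real_bound mu 1 0 mu1 ltac:(lra) ltac:(lra).
  by rewrite ler0_norm; [lra|nra].
have b0lt : nrm b0 < 1 by rewrite lt_neqAle b0n.
have [x [e [-> -> ee]]] := schur_step h b0lt.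
have nx := nrm_ge0 x; have ne := nrm_ge0 e.
have x1 : nrm x <= 1 by nra.
set s := 1 - nrm b0 ^+ 2.
have s0 : 0 <= s by rewrite /s; nra.
have -> : b0 ^+ 4 * ((1 - mu) * (1 + 2 * mu))%:C + (2 + mu)%:C * b0 ^+ 2 * (s%:C * x) +
    3 * b0 * (s%:C * (e - b0^*%C * x ^+ 2)) - 2 * (s%:C * x) ^+ 2 =
  b0 ^+ 4 * ((1 - mu) * (1 + 2 * mu))%:C + (2 + mu)%:C * b0 ^+ 2 * s%:C * x +
    3 * s%:C * b0 * e - (s * (2 + nrm b0 ^+ 2))%:C * x ^+ 2.
  have -> : (s * (2 + nrm b0 ^+ 2))%:C = s%:C * (3 * (b0 * b0^*%C) + 2 * s%:C).
    by rewrite mul_conj rmorphM /s !(rmorphD, rmorphB) /= rmorph1; ring.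
  by ring.
apply: (le_trans (nrmB _ _)).
apply: (le_trans (lerD (nrmD _ _) (lexx _))).
apply: (le_trans (lerD (lerD (nrmD _ _) (lexx _)) (lexx _))).
rewrite !(nrmX, nrmM, nrm_real, nrm_nat).
have -> : `|(1 - mu) * (1 + 2 * mu)| = (mu - 1) * (1 + 2 * mu) by rewrite ler0_norm; [ring|nra].
rewrite (ger0_norm s0) ger0_norm; last lra.
rewrite ger0_norm; last by apply: mulr_ge0 => //; nra.
apply: (le_trans _ (@hankel_real_bound mu (nrm b0) (nrm x) mu1 ltac:(lra) ltac:(lra))).
rewrite -/s.
have : 3 * s * nrm b0 * nrm e <= 3 * s * nrm b0 * (1 - nrm x ^+ 2).
  by apply: ler_wpM2l => //; rewrite !mulr_ge0.
lra.
Qed.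

End SchurParameters.

(** * The upper bound *)

Section UpperBound.
Context {R : realType} {X : completeNormedModType R[i]}.
Local Notation C := R[i].

Lemma toeplitz4_expand (c : nat -> C) (x0 x1 x2 x3 : C) (r : C) : c 0%N = 1 ->
  \sum_(i < 4) \sum_(j < 4) nth 0 [:: x0; x1; x2; x3] i * (nth 0 [:: x0; x1; x2; x3] j)^*%C *
     (if (i <= j)%N then c (j - i)%N * r ^+ (j - i) else 0) =
  x0 * x0^*%C + (c 1%N * r * x0 + x1) * x1^*%C
     + (c 2 * r ^+ 2 * x0 + c 1%N * r * x1 + x2) * x2^*%C
     + (c 3 * r ^+ 3 * x0 + c 2 * r ^+ 2 * x1 + c 1%N * r * x2 + x3) * x3^*%C.
Proof.
move=> c0; rewrite !big_ord_recr !big_ord0 /=.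
rewrite !(subn0, subnn) -[(2 - 1)%N]/1%N -[(3 - 1)%N]/2%N -[(3 - 2)%N]/1%N c0.
move: (x0^*%C) (x1^*%C) (x2^*%C) (x3^*%C) => y0 y1 y2 y3.
by ring.
Qed.

Theorem hankel_upper_bound (lambda : R) (F : X -> X) (x0 : X) (T : X -> C^o) :
  1 / 2 <= lambda <= 1 ->
  locally_biholomorphic F -> radial_terms F -> class_F lambda F ->
  `|x0| = 1 -> support_functionals x0 T ->
  `|hankel22 F x0 T| <= ((1 + 2 * lambda) ^+ 2 * (17 - 10 * lambda) / (192 * (3 - 2 * lambda)))%:C.
Proof.
move=> l01 F_lb F_rad F_cl x01 T_sup.
have [mu muE] : exists mu, mu = lambda + 1 / 2 by eexists.
have mu1 : 1 <= mu <= 3 / 2 by rewrite muE; lra.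
have mu0 : 0 < mu by lra.
pose a2 := coef F x0 T 2; pose a3 := coef F x0 T 3; pose a4 := coef F x0 T 4.
have hH : hankel22 F x0 T = a2 * a4 - a3 ^+ 2 by [].
pose p := aux_function F x0 T.
have p0 : p 0 = 1 by rewrite /p /aux_function mul0r addr0.
have pexp := aux_function_expansion F_lb F_rad F_cl x01 T_sup.
rewrite -/a2 -/a3 -/a4 in pexp.
have pd := aux_function_deriv F_lb x01 T_sup.
have pRe := aux_function_Re F_lb F_cl x01 T_sup.
rewrite hH; move: a2 a3 a4 pexp {hH} => a2 a3 a4 pexp.
have muC : mu%:C != 0 :> C by exact: realC_neq0.
pose P (z : C) := mu%:C^-1 * p z + mu%:C^-1 * (lambda - 1 / 2)%:C.
pose c1 := mu%:C^-1 * (2 * a2).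
pose c2 := mu%:C^-1 * (6 * a3 - 4 * a2 ^+ 2).
pose c3 := mu%:C^-1 * (12 * a4 - 18 * a2 * a3 + 8 * a2 ^+ 3).
pose c := nth 0 [:: 1; c1; c2; c3] : nat -> C.
have Pd z : nrm z < 1 -> exists d, cderiv (Y := C^o) P z d.
  move=> /pd[d hd]; eexists.
  exact: cderivD (cderivZ mu%:C^-1 hd) (cderiv_cst (mu%:C^-1 * (lambda - 1 / 2)%:C : C^o) z).
have c0E : mu%:C^-1 + mu%:C^-1 * (lambda - 1 / 2)%:C = 1 :> C.
  rewrite -{1}[mu%:C^-1]mulr1 -mulrDr -(rmorph1 (real_complex R)) -rmorphD -fmorphV -rmorphM.
  by congr (_%:C); rewrite muE; field; lra.
have Pexp : expands P c 3.
  move=> e e0; have [s s0 hs] := pexp (e * mu) ltac:(exact: mulr_gt0).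
  exists s => // z /hs; rewrite !big_ord_recr big_ord0 /= expr0 expr1 => h.
  have -> : P z - (0 + 1 * 1 + c1 * z + c2 * z ^+ 2 + c3 * z ^+ 3) =
    mu%:C^-1 * (p z - (1 + 2 * a2 * z + (6 * a3 - 4 * a2 ^+ 2) * z ^+ 2
    + (12 * a4 - 18 * a2 * a3 + 8 * a2 ^+ 3) * z ^+ 3)).
    rewrite add0r mulr1 -{1}c0E /P /c1 /c2 /c3; ring.
  rewrite nrmM nrmV nrm_real gtr0_norm// mulrC ler_pdivrMr//.
  by apply: (le_trans h); rewrite mulrAC.
have PRe z : nrm z < 1 -> 0 <= complex.Re (P z).
  move=> z1.
  have -> : P z = (p z + (lambda - 1 / 2)%:C) * (mu^-1)%:C.
    by rewrite /P fmorphV; ring.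
  rewrite Re_mul_real mulr_ge0//; last by rewrite invr_ge0 ltW.
  have -> : complex.Re (p z + (lambda - 1 / 2)%:C) = complex.Re (p z) + (lambda - 1 / 2).
    by rewrite raddfD.
  have [->|z0] := eqVneq z 0; first by rewrite p0 /=; lra.
  by have := pRe z z1 z0; rewrite -/p; lra.
pose H := a2 * a4 - a3 ^+ 2.
pose B := (33 - 15 * mu) / (8 * (2 - mu)).
(* Replacing each coefficient [c k] by [c k * r ^+ k] multiplies the Hankel functional by [r ^+ 4],
   since it is isobaric of weight 4. *)
have main r : 0 < r -> r < 1 -> 18 / mu ^+ 2 * r ^+ 4 * nrm H <= B.
  move=> r0 r1.
  have tp := toeplitz r0 r1 Pd Pexp PRe.
  have {}tp (y0 y1 y2 y3 : C) := tp (nth 0 [:: y0; y1; y2; y3]).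
  have {}tp (y0 y1 y2 y3 : C) : 0 <= complex.Re (y0 * y0^*%C + (c1 * r%:C * y0 + y1) * y1^*%C
     + (c2 * r%:C ^+ 2 * y0 + c1 * r%:C * y1 + y2) * y2^*%C
     + (c3 * r%:C ^+ 3 * y0 + c2 * r%:C ^+ 2 * y1 + c1 * r%:C * y2 + y3) * y3^*%C).
    by have := tp y0 y1 y2 y3; rewrite toeplitz4_expand.
  have := schur_hankel_bound mu1 (toeplitz_schur tp).
  rewrite -/B; congr (_ <= _).
  rewrite [X in nrm X](_ : _ = (18 / mu ^+ 2 * r ^+ 4)%:C * H).
    rewrite nrmM nrm_real ger0_norm// !mulr_ge0 ?invr_ge0 ?exprn_ge0// ltW//.
  have -> : (18 / mu ^+ 2 * r ^+ 4)%:C = 18 / mu%:C ^+ 2 * r%:C ^+ 4 :> C.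
    by rewrite !rmorphM fmorphV !rmorphXn /= (natC 18).
  have -> : ((1 - mu) * (1 + 2 * mu))%:C = (1 - mu%:C) * (1 + 2 * mu%:C) :> C.
    rewrite rmorphM rmorphB rmorphD (rmorphM (real_complex R) 2) rmorph1.
    by congr (_ * (_ + _ * _)); exact: (natC 2).
  have -> : (2 + mu)%:C = 2 + mu%:C :> C.
    by rewrite rmorphD; congr (_ + _); exact: (natC 2).
  by rewrite /c1 /c2 /c3 /H; field.
have B0 : 0 < 18 / mu ^+ 2 by rewrite divr_gt0// exprn_gt0.
rewrite normE lecR -/H.
have nH := nrm_ge0 H.
have fin : 18 / mu ^+ 2 * nrm H <= B.
  apply/ler_addgt0Pr => e e0.
  pose K := 18 / mu ^+ 2 * nrm H.
  have K0 : 0 <= K by rewrite mulr_ge0// ltW.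
  (* The passage to [r = 1], with [r = 1 - d] and Bernoulli's inequality [(1 - d)^4 >= 1 - 4 d]. *)
  pose d := Num.min (1 / 2) (e / (4 * K + 1)).
  have d0 : 0 < d by rewrite lt_min divr_gt0//= divr_gt0//; lra.
  have d2 : d <= 1 / 2 by rewrite ge_min lexx.
  have dK : d * (4 * K + 1) <= e by rewrite -ler_pdivlMr ?ge_min ?lexx ?orbT//; lra.
  have := main (1 - d) ltac:(lra) ltac:(lra).
  rewrite mulrAC -/K.
  have : 1 - 4 * d <= (1 - d) ^+ 4 by nra.
  move=> /(ler_wpM2l K0); nra.
have -> : (1 + 2 * lambda) ^+ 2 * (17 - 10 * lambda) / (192 * (3 - 2 * lambda)) = B * (mu ^+ 2 / 18).
  by rewrite /B muE; field; lra.
rewrite mulrC in fin; rewrite -ler_pdivrMr ?divr_gt0 ?exprn_gt0//.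
by have -> : nrm H / (mu ^+ 2 / 18) = nrm H * (18 / mu ^+ 2) by field; rewrite gt_eqF.
Qed.

End UpperBound.

(** * The Hahn-Banach theorem *)

Section HahnBanach.
Context {R : realType} {X : normedModType R[i]}.
Local Notation C := R[i].
Implicit Types (q : X -> R) (x y : X).

Definition sublinear q :=
  (forall x y, q (x + y) <= q x + q y) /\ (forall (s : R) x, 0 <= s -> q (s%:C *: x) = s * q x).

Lemma sublinear_nrm : sublinear nrm.
Proof.
by split=> [|s x s0]; [exact: nrmD|rewrite nrmZ nrm_real ger0_norm].
Qed.

Lemma sublinear0 q : sublinear q -> q 0 = 0.
Proof. by move=> [_ /(_ 0 0 (lexx _))]; rewrite scaler0 mul0r. Qed.

Lemma sublinear_opp q x : sublinear q -> - q (- x) <= q x.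
Proof.
move=> sq; have := sq.1 x (- x); rewrite subrr sublinear0//; lra.
Qed.

Lemma sublinear_of_le q : q 0 = 0 -> (forall x y, q (x + y) <= q x + q y) ->
  (forall (s : R) x, 0 < s -> q (s%:C *: x) <= s * q x) -> sublinear q.
Proof.
move=> q0 qD qZ; split=> // s x; rewrite le_eqVlt => /orP[/eqP <-|s0].
  by rewrite scale0r mul0r.
apply/eqP; rewrite eq_le qZ//=.
have := qZ s^-1 (s%:C *: x); rewrite invr_gt0 => /(_ s0).
rewrite scalerA -rmorphM mulVf ?gt_eqF// scale1r => /(ler_wpM2l (ltW s0)).
by rewrite mulrA mulfV ?gt_eqF// mul1r.
Qed.

(** The classical way to lower a sublinear [q]: the result is sublinear, lies below [q], and is at
    most [- q y] at [- y]. *)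
Definition shift_functional q y x : R :=
  inf [set q (x + t%:C *: y) - t * q y | t in [set t : R | 0 <= t]].

Section Shift.
Variables (q : X -> R) (y : X).
Hypothesis sq : sublinear q.

Let S x := [set q (x + t%:C *: y) - t * q y | t in [set t : R | 0 <= t]].

Let S_lb x : lbound (S x) (- q (- x)).
Proof.
move=> _ [t /= t0 <-]; rewrite -sq.2//.
have := sq.1 (x + t%:C *: y) (- x); rewrite addrAC subrr add0r; lra.
Qed.

Let S_inf x : has_inf (S x).
Proof. by split; [exists (q (x + (0 : R)%:C *: y) - 0 * q y), 0 => /=|exists (- q (- x))]. Qed.

Lemma shift_functional_le x (t : R) : 0 <= t -> shift_functional q y x <= q (x + t%:C *: y) - t * q y.
Proof. by move=> t0; apply: (ge_inf (S_inf x).2); exists t. Qed.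

Lemma shift_functional_approx x (e : R) : 0 < e ->
  exists2 t : R, 0 <= t & q (x + t%:C *: y) - t * q y < shift_functional q y x + e.
Proof.
by move=> e0; have [_ [t t0 <-] h] := inf_adherent e0 (S_inf x); exists t.
Qed.

Lemma shift_functional_le_self x : shift_functional q y x <= q x.
Proof. by have := shift_functional_le x (lexx 0); rewrite scale0r addr0 mul0r subr0. Qed.

Lemma shift_functional_opp : shift_functional q y (- y) <= - q y.
Proof.
by have := shift_functional_le (- y) ler01; rewrite scale1r addNr sublinear0// mul1r sub0r.
Qed.

Lemma sublinear_shift : sublinear (shift_functional q y).
Proof.
have sub x z : shift_functional q y (x + z) <= shift_functional q y x + shift_functional q y z.
  apply/ler_addgt0Pr => e e0.
  have [s s0 hs] := shift_functional_approx x (ltac:(lra) : 0 < e / 2).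
  have [t t0 ht] := shift_functional_approx z (ltac:(lra) : 0 < e / 2).
  have := shift_functional_le (x + z) (addr_ge0 s0 t0).
  have := sq.1 (x + s%:C *: y) (z + t%:C *: y).
  rewrite [x + _ + _](_ : _ = x + z + (s + t)%:C *: y); first lra.
  by rewrite rmorphD; module_eq; ring.
have le_scale (s : R) x : 0 < s -> shift_functional q y (s%:C *: x) <= s * shift_functional q y x.
  move=> s0; apply/ler_addgt0Pr => e e0.
  have [t t0 ht] := shift_functional_approx x (divr_gt0 e0 s0).
  have := shift_functional_le (s%:C *: x) (mulr_ge0 (ltW s0) t0).
  rewrite [s%:C *: x + _](_ : _ = s%:C *: (x + t%:C *: y)).
    rewrite sq.2; last exact: ltW.
    move: ht; rewrite -(ltr_pM2l s0) [ltRHS]mulrDr [s * (e / s)]mulrC divfK ?gt_eqF//; lra.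
  by rewrite rmorphM; module_eq; ring.
apply: sublinear_of_le => //; apply/eqP; rewrite eq_le; apply/andP; split.
  by rewrite (le_trans (shift_functional_le_self 0))// sublinear0.
apply: lb_le_inf; first exact: (S_inf 0).1.
by move=> z /S_lb; rewrite oppr0 sublinear0// oppr0.
Qed.

End Shift.

(* A minimal sublinear functional [q] satisfies [q <= shift_functional q y] for all [y],
   hence is odd, hence linear. *)
Lemma hahn_banach_real x0 : exists u : X -> R,
  [/\ forall x y, u (x + y) = u x + u y, forall (s : R) x, u (s%:C *: x) = s * u x,
      forall x, u x <= nrm x & nrm x0 <= u x0].
Proof.
(* Starting below this functional rather than below the norm forces [u (- x0) <= - |x0|], which is
   the norming property. *)
pose q0 := shift_functional nrm x0.
have sq0 : sublinear q0 := sublinear_shift x0 sublinear_nrm.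
pose T := {q : X -> R | sublinear q /\ forall x, q x <= q0 x}.
pose t0 : T := exist _ q0 (conj sq0 (fun x => lexx _)).
(* The order is reversed, so that a maximal element for Zorn's lemma is a minimal functional. *)
pose rel (p q : T) : bool := `[< forall x, sval q x <= sval p x >].
have relP (p q : T) : reflect (forall x, sval q x <= sval p x) (rel p q) by apply: asboolP.
have [|p q r /relP pq /relP qr|A tA|[q [sq qq0]] qmax] := @ZL_preorder T t0 rel.
- by move=> p; apply/relP.
- by apply/relP => x; apply: le_trans (qr x) (pq x).
- have [[a Aa]|nA] := pselect (exists a, A a); last first.
    by exists t0 => s As; exfalso; apply: nA; exists s.
  pose V x := [set sval p x | p in A].
  have V_inf x : has_inf (V x).
    split; first by exists (sval a x), a.
    exists (- q0 (- x)) => _ [p Ap <-].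
    by have := sublinear_opp x (svalP p).1; have := (svalP p).2 (- x); lra.
  pose v x := inf (V x).
  have v_le p x : A p -> v x <= sval p x.
    by move=> Ap; apply: (ge_inf (V_inf x).2); exists p.
  have v_app x (e : R) : 0 < e -> exists2 p, A p & sval p x < v x + e.
    by move=> e0; have [_ [p Ap <-] h] := inf_adherent e0 (V_inf x); exists p.
  have v_sub x y : v (x + y) <= v x + v y.
    apply/ler_addgt0Pr => e e0.
    have [p1 A1 h1] := v_app x (e / 2) ltac:(lra).
    have [p2 A2 h2] := v_app y (e / 2) ltac:(lra).
    have [p [Ap h3 h4]] : exists p, [/\ A p, sval p x <= sval p1 x & sval p y <= sval p2 y].
      by case: (tA p1 p2 A1 A2) => /relP h; [exists p2|exists p1].
    by have := v_le p (x + y) Ap; have := (svalP p).1.1 x y; lra.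
  have v_scale_le (s : R) x : 0 < s -> v (s%:C *: x) <= s * v x.
    move=> s0; apply/ler_addgt0Pr => e e0.
    have [p Ap hp] := v_app x (e / s) (divr_gt0 e0 s0).
    have := v_le p (s%:C *: x) Ap; rewrite (svalP p).1.2; last exact: ltW.
    by move: hp; rewrite -(ltr_pM2l s0) [ltRHS]mulrDr [s * (e / s)]mulrC divfK ?gt_eqF//; lra.
  have v0 : v 0 = 0.
    apply/eqP; rewrite eq_le; apply/andP; split.
      by have := v_le a 0 Aa; rewrite (sublinear0 (svalP a).1).
    apply: lb_le_inf; first exact: (V_inf 0).1.
    by move=> _ [p Ap <-]; rewrite (sublinear0 (svalP p).1).
  have sv : sublinear v by exact: sublinear_of_le.
  have vq0 x : v x <= q0 x by apply: le_trans (v_le a x Aa) ((svalP a).2 x).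
  by exists (exist _ v (conj sv vq0)) => p Ap; apply/relP => x; exact: v_le.
have qshift y x : q x <= shift_functional q y x.
  have le1 z : shift_functional q y z <= q0 z.
    by apply: le_trans (shift_functional_le_self y sq z) (qq0 z).
  pose p : T := exist _ _ (conj (sublinear_shift y sq) le1).
  have /qmax/relP : rel (exist _ q (conj sq qq0)) p.
    by apply/relP => z; exact: shift_functional_le_self.
  by apply.
have qodd y : q (- y) = - q y.
  apply/eqP; rewrite eq_le; apply/andP; split.
    by apply: le_trans (qshift y (- y)) (shift_functional_opp y sq).
  by have := sublinear_opp (- y) sq; rewrite opprK.
exists q; split.
- move=> x y; apply/eqP; rewrite eq_le sq.1/=.
  by have := sq.1 (- x) (- y); rewrite -opprD !qodd; lra.
- move=> s x; have [s0|s0] := leP 0 s; first exact: sq.2.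
  have := sq.2 (- s) x; rewrite rmorphN scaleNr qodd oppr_ge0 => /(_ (ltW s0)).
  by rewrite mulNr => /oppr_inj.
- by move=> x; apply: le_trans (qq0 x) (shift_functional_le_self x0 sublinear_nrm x).
- have := qq0 (- x0); rewrite qodd => h.
  by have := le_trans h (shift_functional_opp x0 sublinear_nrm); rewrite lerN2.
Qed.

(** Complexification [T x = u x - i u(i x)]. For the norm, [v] is rotated until [T v] is real, where
    [T] agrees with [u]. Finally [Re (T x0) = 1] and [|T x0| <= 1] leave no room for an imaginary
    part. *)
Lemma exists_support (x0 : X) : `|x0| = 1 -> exists T : X -> C^o,
  [/\ linear T, forall v, nrm (T v) <= nrm v & T x0 = 1].
Proof.
move=> x01; have nx0 : nrm x0 = 1 by rewrite /nrm x01.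
have [u [uD uZ un ux0]] := hahn_banach_real x0.
pose I : C := 'i%C.
pose T (x : X) : C := Complex (u x) (- u (I *: x)).
have uI x : u (I *: (I *: x)) = - u x.
  rewrite scalerA (_ : I * I = (- 1 : R)%:C) ?uZ ?mulN1r//.
  by rewrite /I -expr2 sqr_i rmorphN rmorph1.
have TD x y : T (x + y) = T x + T y.
  by apply/eqP; rewrite eq_complex /= scalerDr !uD opprD !eqxx.
have TR (s : R) x : T (s%:C *: x) = s%:C * T x.
  apply/eqP; rewrite eq_complex /= scalerA [I * _]mulrC -scalerA !uZ.
  by apply/andP; split; apply/eqP; ring.
have TI x : T (I *: x) = I * T x.
  by apply/eqP; rewrite eq_complex /= uI /I /=; apply/andP; split; apply/eqP; ring.
have TZ (a : C) x : T (a *: x) = a * T x.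
  by rewrite (ReIm_complex a) -/I scalerDl -scalerA TD TI !TR; ring.
have Tn v : nrm (T v) <= nrm v.
  have [->|T0] := eqVneq (T v) 0; first by rewrite nrm0 nrm_ge0.
  have nT := nrm_gt0 T0.
  pose k := (nrm (T v))%:C / T v.
  have nk : nrm k = 1.
    by rewrite nrmM nrmV nrm_real ger0_norm ?nrm_ge0// mulfV// gt_eqF.
  have Tk : T (k *: v) = (nrm (T v))%:C by rewrite TZ /k divfK.
  have := un (k *: v); rewrite nrmZ nk mul1r.
  by have -> : u (k *: v) = nrm (T v) by move: Tk => /(congr1 (@complex.Re R)).
exists T; split=> //; first by move=> a x y; rewrite TD TZ.
have h := Tn x0; rewrite nx0 in h.
have h2 := sqr_nrm (T x0).
rewrite /= nx0 in ux0 h2; rewrite /= in h2.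
have Re1 : u x0 = 1 by apply/eqP; rewrite eq_le ux0 andbT -nx0 un.
have h3 : nrm (T x0) ^+ 2 <= 1 by rewrite expr_le1// nrm_ge0.
have Im0 : u (I *: x0) = 0.
  by apply/eqP; rewrite -sqrf_eq0 eq_le sqr_ge0 andbT; rewrite h2 Re1 expr1n sqrrN in h3; lra.
by apply/eqP; rewrite eq_complex /= Re1 Im0 oppr0 !eqxx.
Qed.

End HahnBanach.

(** * Primitives *)

Section Primitive.
Context {R : realType}.
Local Notation C := R[i].

Lemma real_cauchy (u : nat -> R) :
  (forall e : R, 0 < e -> exists N, forall m n, (N <= m)%N -> (N <= n)%N -> `|u m - u n| <= e) ->
  exists l, forall e : R, 0 < e -> exists N, forall n, (N <= n)%N -> `|u n - l| <= e.
Proof.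
move=> uc.
have cu : cauchy (u @ \oo).
  apply: cauchy_exP => e e0.
  have [N hN] := uc (e / 2) ltac:(lra).
  exists (u N), N => // n /= Nn.
  rewrite -ball_normE /ball_ /=.
  by have := hN N n (leqnn _) Nn; lra.
have /cvgrPdist_le ul : u @ \oo --> lim (u @ \oo) by apply/cauchy_cvgP.
exists (lim (u @ \oo)) => e e0.
have [N _ hN] := ul e e0.
by exists N => n /hN; rewrite distrC.
Qed.

Lemma seqlim_cauchyC (u : nat -> C^o) :
  (forall e : R, 0 < e -> exists N, forall m n, (N <= m)%N -> (N <= n)%N ->
     nrm (u m - u n) <= e) -> exists l : C, seqlim u l.
Proof.
move=> uc.
have ReB (a b : C) : complex.Re (a - b) = complex.Re a - complex.Re b by rewrite raddfB.
have ImB (a b : C) : complex.Im (a - b) = complex.Im a - complex.Im b by rewrite raddfB.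
have [|l1 hl1] := @real_cauchy (fun n => complex.Re (u n)).
  move=> e /uc[N hN]; exists N => m n Nm Nn; rewrite -ReB.
  exact: le_trans (Re_le_nrm _) (hN m n Nm Nn).
have [|l2 hl2] := @real_cauchy (fun n => complex.Im (u n)).
  move=> e /uc[N hN]; exists N => m n Nm Nn; rewrite -ImB.
  exact: le_trans (Im_le_nrm _) (hN m n Nm Nn).
exists (Complex l1 l2) => e e0.
have [N1 h1] := hl1 (e / 2) ltac:(lra); have [N2 h2] := hl2 (e / 2) ltac:(lra).
exists (maxn N1 N2) => n; rewrite geq_max => /andP[/h1 k1 /h2 k2].
apply: (le_trans (nrm_le_ReIm _)); rewrite ReB ImB /=; lra.
Qed.

(** Compactness of the closed disc as an induction principle, transported from the unit square by
    the affine map [p]. Around a point outside the disc, small cells miss the disc and [P set0]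
    suffices; cells of side [l] stay within [4 r l] of any of their points, hence the divisor
    [5 r]. *)
Lemma disc_induction (r : R) (P : set C -> Prop) : 0 < r ->
  (forall A B : set C, A `<=` B -> P B -> P A) ->
  (forall A B : set C, P A -> P B -> P (A `|` B)) ->
  (forall z, nrm z <= r -> exists2 d : R, 0 < d & P [set w | nrm (w - z) < d]) ->
  P [set z | nrm z <= r].
Proof.
move=> r0 Pmono PU Ploc.
pose p (s t : R) : C := Complex (r * (2 * s - 1)) (r * (2 * t - 1)).
have pB s t x y (l : R) : `|x - s| <= l -> `|y - t| <= l -> nrm (p x y - p s t) <= 4 * r * l.
  move=> xs yt; apply: (le_trans (nrm_le_ReIm _)); rewrite /p /=.
  rewrite (_ : r * _ - _ = 2 * r * (x - s)); last by ring.
  rewrite (_ : r * _ - _ = 2 * r * (y - t)); last by ring.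
  rewrite !normrM !(gtr0_norm r0) ger0_norm// -mulrDr.
  by have := ler_wpM2l (ltW r0) xs; have := ler_wpM2l (ltW r0) yt; lra.
pose cell s t l := [set z | nrm z <= r /\
  exists x y, [/\ s <= x <= s + l, t <= y <= t + l & z = p x y]].
have P0 : P set0.
  by have [|d _] := Ploc 0; [rewrite nrm0 ltW|apply: Pmono].
have : P (cell 0 0 1).
  apply: (cousin_square (P := fun s t l => P (cell s t l))).
    move=> s t l l0 h1 h2 h3 h4; apply: Pmono (PU _ _ (PU _ _ h1 h2) (PU _ _ h3 h4)).
    move=> z [zr [x [y [xs yt zE]]]].
    have [xl|xl] := leP x (s + l / 2); have [yl|yl] := leP y (t + l / 2);
      [left; left|right; left|left; right|right; right];
      by split=> //; exists x, y; split=> //; lra.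
  move=> s t _ _.
  have near a b l x y : a <= s <= a + l -> b <= t <= b + l -> a <= x <= a + l ->
      b <= y <= b + l -> nrm (p x y - p s t) <= 4 * r * l.
    by move=> *; apply: pB; rewrite ler_norml; lra.
  have r5 : 0 < 5 * r by lra.
  have [pr|pr] := leP (nrm (p s t)) r.
    have [d d0 hd] := Ploc _ pr; exists (d / (5 * r)); first exact: divr_gt0.
    move=> a b l; rewrite ltr_pdivlMr// => /andP[l0 ld] sa tb _ _ _ _.
    apply: Pmono hd => z [_ [x [y [xa yb ->]]]] /=.
    by have := near a b l x y sa tb xa yb; have := mulr_gt0 r0 l0; lra.
  exists ((nrm (p s t) - r) / (5 * r)); first by rewrite divr_gt0// subr_gt0.
  move=> a b l; rewrite ltr_pdivlMr// => /andP[l0 ld] sa tb _ _ _ _.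
  apply: Pmono P0 => z [zr [x [y [xa yb zE]]]]; exfalso; rewrite zE in zr.
  have := near a b l x y sa tb xa yb; rewrite nrmBC; have := mulr_gt0 r0 l0.
  by have := nrmD (p s t - p x y) (p x y); rewrite subrK; lra.
apply: Pmono => z zr; split=> //.
exists ((complex.Re z / r + 1) / 2), ((complex.Im z / r + 1) / 2).
have Reb := le_trans (Re_le_nrm z) zr; have Imb := le_trans (Im_le_nrm z) zr.
have e (x : R) : `|x| <= r -> 0 <= (x / r + 1) / 2 <= 0 + 1.
  rewrite ler_norml => /andP[h1 h2].
  have : - 1 <= x / r by rewrite ler_pdivlMr//; lra.
  have : x / r <= 1 by rewrite ler_pdivrMr//; lra.
  lra.
split; rewrite ?e//.
by rewrite /p; case: (z) => a b /=; congr Complex; field; rewrite gt_eqF.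
Qed.

Lemma bounded_on_disc (g : C -> C^o) (r : R) : 0 < r ->
  (forall z, nrm z <= r -> cont_at (X := C^o) g z) ->
  exists M : R, forall z, nrm z <= r -> nrm (g z) <= M.
Proof.
move=> r0 cg.
apply: (disc_induction (P := fun A => exists M : R, forall z, A z -> nrm (g z) <= M)) => //.
- by move=> A B AB [M h]; exists M => z /AB/h.
- move=> A B [M h] [N k]; exists (Num.max M N).
  by move=> z [/h|/k] hz; rewrite le_max hz ?orbT.
- move=> z zr; have [d d0 hd] := cg z zr 1 ltr01; exists d => //.
  exists (nrm (g z) + 1) => w /= /hd h.
  by have := nrmD (g w - g z) (g z); rewrite subrK; lra.
Qed.

(** A dyadic left-endpoint Riemann sum in recursive form, so that splitting the interval is mere
    conversion. *)
Fixpoint rsum (f : R -> C) n (a l : R) : C^o :=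
  if n is m.+1 then rsum f m a (l / 2) + rsum f m (a + l / 2) (l / 2) else l%:C * f a.

Lemma rsumD f g n a l : rsum (fun s => f s + g s) n a l = rsum f n a l + rsum g n a l.
Proof.
elim: n a l => [|n ih] a l /=; first by rewrite mulrDr.
by rewrite !ih addrACA.
Qed.

Lemma rsumZ (k : C) f n a l : rsum (fun s => k * f s) n a l = k * rsum f n a l.
Proof.
elim: n a l => [|n ih] a l /=; first by rewrite mulrCA.
by rewrite !ih mulrDr.
Qed.

Lemma nrm_rsum f n a l (M : R) : 0 <= l ->
  (forall s : R, a <= s <= a + l -> nrm (f s) <= M) -> nrm (rsum f n a l) <= l * M.
Proof.
elim: n a l => [|n ih] a l l0 fM /=.
  rewrite nrmM nrm_real ger0_norm// ler_wpM2l//; apply: fM; lra.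
apply: (le_trans (nrmD _ _)).
have -> : l * M = l / 2 * M + l / 2 * M by field.
by apply: lerD; apply: ih => [|s s1]; rewrite ?fM//; lra.
Qed.

Lemma rsum_step f n a l (L : R) : 0 <= l ->
  (forall s t : R, a <= s <= a + l -> a <= t <= a + l -> nrm (f s - f t) <= L * `|s - t|) ->
  nrm (rsum f n.+1 a l - rsum f n a l) <= L * l ^+ 2 / 4 * 2^-1 ^+ n.
Proof.
elim: n a l => [|n ih] a l l0 fL.
  rewrite /= (_ : _ - _ = (l / 2)%:C * (f (a + l / 2) - f a)); last first.
    have -> : l%:C = (l / 2)%:C + (l / 2)%:C :> C by rewrite -rmorphD -splitr.
    by ring.
  rewrite nrmM nrm_real ger0_norm; last lra.
  have := fL (a + l / 2) a ltac:(lra) ltac:(lra).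
  rewrite addrAC subrr add0r ger0_norm; last lra.
  move=> h; have := ler_wpM2l (ltac:(lra) : 0 <= l / 2) h.
  by rewrite expr0 mulr1; lra.
rewrite -[rsum f n.+2 a l]/(rsum f n.+1 a (l / 2) + rsum f n.+1 (a + l / 2) (l / 2)).
rewrite -[rsum f n.+1 a l]/(rsum f n a (l / 2) + rsum f n (a + l / 2) (l / 2)).
rewrite opprD addrACA; apply: (le_trans (nrmD _ _)).
have -> : L * l ^+ 2 / 4 * 2^-1 ^+ n.+1 =
    L * (l / 2) ^+ 2 / 4 * 2^-1 ^+ n + L * (l / 2) ^+ 2 / 4 * 2^-1 ^+ n :> R.
  by rewrite [2^-1 ^+ n.+1]exprS; move: (2^-1 ^+ n) => p; field.
by apply: lerD; apply: ih => [|s t s1 t1]; rewrite ?fL//; lra.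
Qed.

Lemma rsum_cvg f (L : R) : 0 <= L ->
  (forall s t : R, 0 <= s <= 1 -> 0 <= t <= 1 -> nrm (f s - f t) <= L * `|s - t|) ->
  exists l : C, seqlim (fun n => rsum f n 0 1) l.
Proof.
move=> L0 fL; apply: seqlim_cauchyC.
have step n : nrm (rsum f n.+1 0 1 - rsum f n 0 1) <= L / 4 * 2^-1 ^+ n.
  have -> : L / 4 = L * 1 ^+ 2 / 4 by rewrite expr1n mulr1.
  by apply: rsum_step => // s t; rewrite add0r => *; apply: fL.
have far n k : nrm (rsum f (k + n) 0 1 - rsum f n 0 1) <= L / 2 * (2^-1 ^+ n - 2^-1 ^+ (k + n)).
  elim: k => [|k ih]; first by rewrite !subrr nrm0 mulr0.
  apply: (le_trans (nrm_tri (rsum f (k + n) 0 1) _ _)).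
  have := step (k + n)%N; rewrite addSn [2^-1 ^+ (k + n).+1]exprS; lra.
move=> e e0; have [N hN] := half_expn_mul L0 e0.
have farN n : (N <= n)%N -> nrm (rsum f n 0 1 - rsum f N 0 1) <= e / 2.
  move=> Nn; have := far N (n - N)%N; rewrite subnK//.
  have : 0 <= L * (2^-1 : R) ^+ n by rewrite mulr_ge0// exprn_ge0// invr_ge0.
  have := hN N (leqnn N); lra.
exists N => m n /farN h1 /farN h2; apply: (le_trans (nrm_tri (rsum f N 0 1) _ _)).
by rewrite [nrm (rsum f N 0 1 - _)]nrmBC; lra.
Qed.

(** The increments of [v] telescope. At level [n] there are [2^n] steps, each with an error at most
    [K 4^-n], so the total error is at most [K 2^-n]. *)
Lemma rsum_deriv (v v' : R -> C) (K d0 : R) : 0 < d0 -> 0 <= K ->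
  (forall s d : R, 0 <= s -> 0 <= d -> s + d <= 1 -> d <= d0 ->
     nrm (v (s + d) - v s - d%:C * v' s) <= K * d ^+ 2) ->
  seqlim (fun n => rsum v' n 0 1) (v 1 - v 0 : C^o).
Proof.
move=> d00 K0 hv e e0.
have key n a l : 0 <= a -> 0 <= l -> a + l <= 1 -> l * 2^-1 ^+ n <= d0 ->
    nrm (v (a + l) - v a - rsum v' n a l) <= K * l ^+ 2 * 2^-1 ^+ n.
  elim: n a l => [|n ih] a l a0 l0 al ld /=.
    rewrite expr0 mulr1 in ld; rewrite expr0 mulr1. by apply: hv.
  have ld' : l / 2 * 2^-1 ^+ n <= d0 by rewrite -mulrA -exprS.
  have h1 := ih a (l / 2) a0 ltac:(lra) ltac:(lra) ld'.
  have h2 := ih (a + l / 2) (l / 2) ltac:(lra) ltac:(lra) ltac:(lra) ld'.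
  rewrite -[a + l / 2 + l / 2]addrA -splitr in h2.
  rewrite (_ : _ - _ = (v (a + l / 2) - v a - rsum v' n a (l / 2)) +
    (v (a + l) - v (a + l / 2) - rsum v' n (a + l / 2) (l / 2))); last by ring.
  apply: (le_trans (nrmD _ _)); rewrite [2^-1 ^+ n.+1]exprS; lra.
have [N1 h1] := half_expn_mul ler01 d00.
have [N2 h2] := half_expn_mul K0 e0.
exists (maxn N1 N2) => n; rewrite geq_max => /andP[/h1 k1 /h2 k2].
rewrite nrmBC; have := key n 0 1 (lexx 0) ler01 ltac:(by rewrite add0r) k1.
by rewrite add0r expr1n mulr1 => /le_trans; apply.
Qed.

(* [h z] is the integral of [g (s z)] over [0 <= s <= 1]; the equation comes from
   [d/ds (s g(s z)) = g(s z) + z s g'(s z)]. *)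
Lemma disc_primitive (g : C -> C^o) :
  (forall z, nrm z < 1 -> exists d, cderiv g z d) ->
  exists h : C -> C^o, forall z, nrm z < 1 -> exists2 d : C, cderiv h z d & h z + z * d = g z.
Proof.
move=> gd.
pose h (z : C) : C := xget 0 [set l | seqlim (fun n => rsum (fun s => g (s%:C * z)) n 0 1) l].
exists h => z0 z01.
pose g' (z : C) : C := xget 0 [set d | cderiv g z d].
have gE z : nrm z < 1 -> cderiv g z (g' z) by move=> /gd /(xgetPex 0).
(* Equally spaced radii [|z0| < r1 < r2 < 1]: segments from 0 to points near [z0] stay in the disc
   of radius [r1], and the gap [r] leaves room for Cauchy estimates with the bound on the disc of
   radius [r2]. *)
pose r1 := (1 + 2 * nrm z0) / 3; pose r2 := (2 + nrm z0) / 3; pose r := r2 - r1.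
have nz0 := nrm_ge0 z0.
have r0 : 0 < r by rewrite /r /r1 /r2; lra.
have r11 : r1 < 1 by rewrite /r1; lra.
have r21 : r2 < 1 by rewrite /r2; lra.
have z0r1 : nrm z0 < r1 by rewrite /r1; lra.
have r10 : 0 <= r1 by lra.
have r20 : 0 < r2 by rewrite /r2; lra.
have [M0 hM0] := bounded_on_disc r20 (fun z zr => cderiv_cont (gE z (le_lt_trans zr r21))).
pose M := Num.max M0 1.
have hM z : nrm z <= r2 -> nrm (g z) <= M by move=> /hM0 h1; rewrite le_max h1.
have M1 : 1 <= M by rewrite le_max lexx orbT.
have gshift (a : C) : nrm a <= r1 -> holo_disc (fun b => g (a + b)) r.
  move=> ar b br; exists (1 *: g' (a + b) : C^o).
  apply: (cderiv_comp (k := fun b => a + b)); last first.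
    by apply: gE; apply: (le_lt_trans (nrmD _ _)); rewrite /r in br; lra.
  by apply: (cderiv_eq (cderivD (cderiv_cst (a : C^o) b) (cderiv_id b))); rewrite add0r.
have gshift0 (a : C) : nrm a <= r1 -> cderiv (fun b => g (a + b)) 0 (g' a).
  move=> ar; rewrite -[g' a]scale1r.
  apply: (cderiv_comp (k := fun b => a + b)); last first.
    by rewrite addr0; apply: gE; lra.
  by apply: (cderiv_eq (cderivD (cderiv_cst (a : C^o) 0) (cderiv_id 0))); rewrite add0r.
have gM (a b : C) : nrm a <= r1 -> nrm b = r -> nrm (g (a + b)) <= M.
  by move=> ar br; apply: hM; apply: (le_trans (nrmD _ _)); rewrite br /r; lra.
pose K1 := 2 * M / r.
have K10 : 0 <= K1 by rewrite divr_ge0 ?(ltW r0)//; lra.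
have g'b a : nrm a <= r1 -> nrm (g' a) <= K1.
  by move=> ar; exact: (cauchy_bound1 r0 (gshift a ar) (fun b => gM a b ar) (gshift0 a ar)).
pose K2 := 8 * M / r ^+ 2.
have K20 : 0 <= K2 by rewrite divr_ge0 ?exprn_ge0 ?(ltW r0)//; lra.
have taylor a b : nrm a <= r1 -> nrm b <= r / 2 ->
    nrm (g (a + b) - g a - b * g' a) <= K2 * nrm b ^+ 2.
  move=> ar br.
  have := cauchy_bound2 r0 (gshift a ar) (fun b => gM a b ar) (gshift0 a ar) br.
  by rewrite addr0 /K2 mulrAC.
have glip a b : nrm a <= r1 -> nrm b <= r1 -> nrm (g b - g a) <= K1 * nrm (b - a).
  move=> ar br; apply: mean_value_bound => s s01.
  have sr : nrm (a + s%:C * (b - a)) <= r1.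
    have -> : a + s%:C * (b - a) = (1 - s)%:C * a + s%:C * b.
      by rewrite rmorphB rmorph1; ring.
    apply: (le_trans (nrmD _ _)); rewrite !nrmM !nrm_real !ger0_norm; [nra|lra|lra].
  by exists (g' (a + s%:C * (b - a))); [apply: gE; lra|exact: g'b].
have sz (z : C) (s : R) : nrm z <= r1 -> 0 <= s <= 1 -> nrm (s%:C * z) <= r1.
  move=> zr s01; rewrite nrmM nrm_real ger0_norm; last lra.
  by have := nrm_ge0 z; nra.
have hlim z : nrm z <= r1 -> seqlim (Y := C^o) (fun n => rsum (fun s => g (s%:C * z)) n 0 1) (h z).
  move=> zr; apply: (xgetPex 0).
  apply: (@rsum_cvg _ K1) => // s t s01 t01.
  apply: (le_trans (glip _ _ (sz _ _ zr t01) (sz _ _ zr s01))).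
  rewrite -mulrBl -rmorphB nrmM nrm_real ler_wpM2l//.
  by rewrite ler_piMr//; lra.
have z0r1' := ltW z0r1.
(* The derivative of [h] is the integral of [s g'(s z0)]. For [z0 != 0] its existence and the
   equation come together: the sums of [g(s z0) + z0 s g'(s z0)] tend to [g z0], those of [g(s z0)]
   to [h z0], and the difference is divided by [z0]. This is why 0 is treated apart. *)
have Dlim : exists d : C, seqlim (Y := C^o) (fun n => rsum (fun s => s%:C * g' (s%:C * z0)) n 0 1) d /\
    h z0 + z0 * d = g z0.
  have [->|z0n] := eqVneq z0 0.
    pose v (s : R) : C := (s ^+ 2 / 2)%:C.
    have lv : seqlim (fun n => rsum (fun s => s%:C) n 0 1) (v 1 - v 0 : C^o).
      apply: (@rsum_deriv v (fun s => s%:C) 1 1) => // s d s0 d0 _ _.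
      have -> : v (s + d) - v s - d%:C * s%:C = (d ^+ 2 / 2)%:C.
        by rewrite /v -rmorphM -!rmorphB; congr (_%:C); field.
      rewrite nrm_real ger0_norm; last by rewrite divr_ge0 ?sqr_ge0.
      by have := sqr_ge0 d; lra.
    exists (g' 0 * (v 1 - v 0)); split.
      apply: seqlim_eq (seqlimZ (g' 0) lv) => n.
      rewrite -[LHS]rsumZ; congr (rsum _ n 0 1); apply/funext => s.
      by rewrite mulr0 mulrC.
    rewrite mul0r addr0.
    have r10' : nrm (0 : C) <= r1 by rewrite nrm0.
    have l1 := hlim 0 r10'.
    have l2 : seqlim (Y := C^o) (fun n => rsum (fun s => g (s%:C * 0)) n 0 1) (g 0).
      apply: seqlim_eq (seqlim_cst (g 0)) => n.
      have aux m a l : rsum (fun s => g (s%:C * 0)) m a l = l%:C * g 0.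
        elim: m a l => [|m ih] a l /=; first by rewrite mulr0.
        by rewrite !ih -mulrDl -rmorphD -splitr.
      by rewrite aux rmorph1 mul1r.
    exact: seqlim_unique l1 l2.
  pose v (s : R) : C := s%:C * g (s%:C * z0).
  have lv : seqlim (Y := C^o) (fun n => rsum (fun s => g (s%:C * z0) + z0 * (s%:C * g' (s%:C * z0))) n 0 1)
      (v 1 - v 0).
    apply: (@rsum_deriv v _ (K2 + K1) (r / 2)) => [|| s d s0 d0 sd dr]; first by lra.
      by rewrite addr_ge0.
    have n1 : nrm z0 <= 1 by lra.
    have s1 : nrm (s%:C * z0) <= r1 by apply: sz => //; lra.
    have sd1 : nrm ((s + d)%:C * z0) <= r1 by apply: sz => //; lra.
    have dz : nrm (d%:C * z0) <= d.
      by rewrite nrmM nrm_real ger0_norm// ler_piMr.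
    have t1 := taylor (s%:C * z0) (d%:C * z0) s1 (le_trans dz dr).
    have t2 := glip _ _ s1 sd1.
    have e1 : (s + d)%:C * z0 = s%:C * z0 + d%:C * z0 by rewrite rmorphD mulrDl.
    rewrite e1 [_ + _ - _]addrC addKr in t2.
    rewrite /v e1.
    rewrite (_ : _ - _ - _ = s%:C * (g (s%:C * z0 + d%:C * z0) - g (s%:C * z0) -
      d%:C * z0 * g' (s%:C * z0)) + d%:C * (g (s%:C * z0 + d%:C * z0) - g (s%:C * z0))); last first.
      by rewrite rmorphD; ring.
    apply: (le_trans (nrmD _ _)); rewrite !(nrmM, nrm_real) !(ger0_norm s0, ger0_norm d0).
    have i1 : nrm (d%:C * z0) ^+ 2 <= d ^+ 2 by rewrite ler_pXn2r// nnegrE nrm_ge0.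
    have i2 := ler_wpM2l K20 i1; have i3 := ler_wpM2l K10 dz.
    have i4 := ler_wpM2l d0 (le_trans t2 i3).
    have i5 : s * nrm (g (s%:C * z0 + d%:C * z0) - g (s%:C * z0) - d%:C * z0 * g' (s%:C * z0)) <=
       1 * (K2 * d ^+ 2).
      by apply: ler_pM; rewrite ?nrm_ge0//; [clear -sd d0; lra|exact: le_trans t1 i2].
    rewrite /= in i5; clear -i4 i5; lra.
  have := seqlimZ z0^-1 (seqlimD lv (seqlimZ (-1) (hlim z0 z0r1'))).
  set d := _ *: _ => ld; exists d; split.
    apply: seqlim_eq ld => n; rewrite rsumD rsumZ scaleN1r addrAC subrr add0r.
    by rewrite /GRing.scale /= mulrA mulVf// mul1r.
  rewrite /d /GRing.scale /= /v rmorph0 rmorph1 mul0r subr0 mul1r mul1r mulrA mulfV// mul1r.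
  by ring.
have [d [ld hd]] := Dlim; exists d => //.
move=> e e0.
exists (Num.min (Num.min (r1 - nrm z0) (r / 2)) (e / (K2 + 1))).
  by rewrite !lt_min !divr_gt0// ?andbT; lra.
move=> z; rewrite !lt_min => /andP[/andP[k1 k2] k3].
rewrite ltr_pdivlMr in k3; last lra.
have nz := nrm_ge0 (z - z0).
have zr : nrm z <= r1 by have := nrmD (z - z0) z0; rewrite subrK; clear -k1; lra.
have l := seqlimD (seqlimD (hlim z zr) (seqlimZ (-1) (hlim z0 z0r1'))) (seqlimZ (- (z - z0)) ld).
have -> : h z - h z0 - (z - z0) *: (d : C^o) = h z + -1 *: (h z0 : C^o) + - (z - z0) *: (d : C^o).
  by rewrite scaleN1r scaleNr.
apply: (@seqlim_le _ _ _ _ _ 0) l => n _.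
rewrite /GRing.scale /= -!rsumZ -!rsumD.
have -> : e * nrm (z - z0) = 1 * (e * nrm (z - z0)) by rewrite mul1r.
apply: nrm_rsum => // s; rewrite add0r => s01.
have := taylor (s%:C * z0) (s%:C * (z - z0)) (sz _ _ z0r1' s01) _.
have ns : nrm (s%:C * (z - z0)) <= nrm (z - z0).
  by clear -s01 nz; rewrite nrmM nrm_real ger0_norm ?ler_piMl//; lra.
move=> /(_ (le_trans ns (ltW k2))).
have -> : s%:C * z0 + s%:C * (z - z0) = s%:C * z by ring.
have -> : g (s%:C * z) + -1 * g (s%:C * z0) + - (z - z0) * (s%:C * g' (s%:C * z0)) =
   g (s%:C * z) - g (s%:C * z0) - s%:C * (z - z0) * g' (s%:C * z0) by ring.
move=> /le_trans; apply.
have i1 : nrm (s%:C * (z - z0)) ^+ 2 <= nrm (z - z0) ^+ 2 by rewrite ler_pXn2r// nnegrE nrm_ge0.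
apply: (le_trans (ler_wpM2l K20 i1)); rewrite expr2 mulrA ler_wpM2r//; clear -k3 nz; lra.
Qed.

End Primitive.

(** * The complex exponential *)

Section ComplexExp.
Context {R : realType}.
Local Notation C := R[i].

Definition cexp (z : C) : C := (expR (complex.Re z))%:C * cis (complex.Im z).

Lemma cexpD z w : cexp (z + w) = cexp z * cexp w.
Proof.
rewrite /cexp !raddfD /= expRD cisD rmorphM; ring.
Qed.

Lemma cexp0 : cexp 0 = 1.
Proof. by rewrite /cexp /= expR0 cis0 mul1r. Qed.

Lemma cexp_neq0 z : cexp z != 0.
Proof.
by apply/eqP => h; have := cexpD z (- z); rewrite h mul0r subrr cexp0 => /eqP; rewrite oner_eq0.
Qed.

Lemma cos_bound (x : R) : `|cos x - 1| <= x ^+ 2.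
Proof.
have [c cx] := mvt (@is_derive_cos R) x 0; rewrite !subr0 in cx *; rewrite cos0 => ->.
have [b bc] := mvt (@is_derive_sin R) c 0; rewrite !subr0 in bc *; rewrite sin0 subr0 => ->.
rewrite !(normrM, normrN) -[x ^+ 2]ger0_norm ?sqr_ge0// expr2 normrM ler_wpM2r//.
by apply: le_trans cx; rewrite ler_piMl// cos_max.
Qed.

Lemma sin_bound (x : R) : `|x| <= 1 -> `|sin x - x| <= x ^+ 2.
Proof.
move=> x1.
have [c cx] := mvt (@is_derive_sin R) x 0; rewrite !subr0 in cx *; rewrite sin0 subr0 => ->.
have -> : cos c * x - x = (cos c - 1) * x by ring.
rewrite normrM -[x ^+ 2]ger0_norm ?sqr_ge0// expr2 normrM ler_wpM2r//.
apply: (le_trans (cos_bound c)); apply: (le_trans _ cx).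
by rewrite -[c ^+ 2]ger0_norm ?sqr_ge0// expr2 normrM ler_piMr// (le_trans cx).
Qed.

Lemma expR_bound (x : R) : `|x| <= 1 -> `|expR x - 1 - x| <= expR 1 * x ^+ 2.
Proof.
move=> x1.
have [c cx] := mvt (@is_derive_expR R) x 0; rewrite !subr0 in cx *; rewrite expR0 => ->.
have [b bc] := mvt (@is_derive_expR R) c 0; rewrite !subr0 in bc *; rewrite expR0 => e.
have -> : expR c * x - x = expR b * c * x by rewrite -e; ring.
have b1 : b <= 1 by apply: (le_trans (ler_norm b)); lra.
rewrite !normrM ger0_norm ?expR_ge0// -mulrA.
rewrite -[x ^+ 2]ger0_norm ?sqr_ge0// expr2 normrM.
by apply: ler_pM; rewrite ?expR_ge0 ?mulr_ge0 ?ler_expR// ler_wpM2r.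
Qed.

Lemma cexp_bound (h : C) : nrm h <= 1 -> nrm (cexp h - 1 - h) <= 6 * expR 1 * nrm h ^+ 2.
Proof.
move=> h1.
pose x := complex.Re h; pose y := complex.Im h.
have hx : `|x| <= nrm h := Re_le_nrm h.
have hy : `|y| <= nrm h := Im_le_nrm h.
have e1 : 1 <= expR 1 :> R by rewrite -expR0 ler_expR.
have n0 := nrm_ge0 h.
pose N := nrm h ^+ 2; have N0 : 0 <= N by exact: sqr_ge0.
have sq (a : R) : `|a| <= nrm h -> a ^+ 2 <= N.
  by move=> ah; rewrite -[a ^+ 2]ger0_norm ?sqr_ge0// normrX ler_pXn2r// nnegrE.
have x2 := sq x hx; have y2 := sq y hy.
have bx := expR_bound (le_trans hx h1); have by' := sin_bound (le_trans hy h1).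
have bc := cos_bound y.
have bx' : `|expR x - 1 - x| <= expR 1 * N.
  by apply: (le_trans bx); rewrite ler_wpM2l// expR_ge0.
have bs : `|sin y - y| <= N by exact: le_trans by' y2.
have bc' : `|cos y - 1| <= N by exact: le_trans bc y2.
have ex : 0 <= expR x <= expR 1.
  rewrite expR_ge0 ler_expR; apply: (le_trans (ler_norm x)); exact: le_trans hx h1.
have ex1 : `|expR x - 1| <= 2 * expR 1 * nrm h.
  have -> : expR x - 1 = (expR x - 1 - x) + x by ring.
  apply: (le_trans (ler_normD _ _)).
  have : expR 1 * N <= expR 1 * nrm h.
    by rewrite ler_wpM2l ?expR_ge0// /N expr2 ler_piMl.
  by have := ler_wpM2r n0 e1; lra.
apply: (le_trans (nrm_le_ReIm _)).
have -> : complex.Re (cexp h - 1 - h) = expR x * (cos y - 1) + (expR x - 1 - x).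
  by rewrite /cexp /x /y; case: (h) => a b /=; ring.
have -> : complex.Im (cexp h - 1 - h) = expR x * (sin y - y) + (expR x - 1) * y.
  by rewrite /cexp /x /y; case: (h) => a b /=; ring.
apply: (le_trans (lerD (ler_normD _ _) (ler_normD _ _))); rewrite !normrM (@ger0_norm _ (expR x)); last lra.
have i1 : expR x * `|cos y - 1| <= expR 1 * N by apply: ler_pM => //; lra.
have i2 : expR x * `|sin y - y| <= expR 1 * N by apply: ler_pM => //; lra.
have i3 : `|expR x - 1| * `|y| <= 2 * expR 1 * nrm h * nrm h by apply: ler_pM.
have e3 : 2 * expR 1 * nrm h * nrm h = 2 * expR 1 * N by rewrite /N; ring.
rewrite e3 in i3; rewrite -/N; have := ler_wpM2r N0 e1.
lra.
Qed.

Lemma cderiv_cexp (z : C) : cderiv (Y := C^o) cexp z (cexp z).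
Proof.
move=> e e0; pose K := 6 * expR 1 * nrm (cexp z).
have K0 : 0 <= K by rewrite !mulr_ge0 ?expR_ge0 ?nrm_ge0.
exists (Num.min 1 (e / (K + 1))); first by rewrite lt_min ltr01 divr_gt0//; lra.
move=> w; rewrite lt_min => /andP[w1]; rewrite ltr_pdivlMr; last lra.
move=> we; have nw := nrm_ge0 (w - z).
have -> : cexp w - cexp z - (w - z) *: (cexp z : C^o) = cexp z * (cexp (w - z) - 1 - (w - z)).
  have -> : cexp w = cexp z * cexp (w - z) by rewrite -cexpD subrKC.
  by rewrite /GRing.scale /=; ring.
rewrite nrmM.
have := ler_wpM2l (nrm_ge0 (cexp z)) (cexp_bound (ltW w1)).
move=> /le_trans; apply.
have -> : nrm (cexp z) * (6 * expR 1 * nrm (w - z) ^+ 2) = K * nrm (w - z) * nrm (w - z).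
  by rewrite /K; ring.
by rewrite ler_wpM2r//; lra.
Qed.

End ComplexExp.

(** * Positivity of the real part by a first boundary contact *)

Section FirstZero.
Context {R : realType}.
Local Notation C := R[i].

(* A point [z0] of smallest modulus with [Re (f z0) <= 0] minimizes [Re f] on the disc
   of radius [|z0|], so that [z0 f'(z0)] is real and nonpositive. *)
Lemma Re_gt0_on_disc (f f' : C -> C) :
  (forall z, nrm z < 1 -> cderiv (Y := C^o) f z (f' z)) ->
  0 < complex.Re (f 0) ->
  (forall z, nrm z < 1 -> complex.Re (f z) = 0 -> complex.Im (z * f' z) = 0 ->
    complex.Re (z * f' z) <= 0 -> False) ->
  forall z, nrm z < 1 -> 0 < complex.Re (f z).
Proof.
move=> fd f0 hz z1 z11; apply: contrapT => /negP; rewrite -leNgt => fz1.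
pose bad r := exists2 z, nrm z <= r & complex.Re (f z) <= 0.
pose S := [set r : R | 0 <= r <= nrm z1 /\ bad r].
have S_inf : has_inf S.
  split; first by exists (nrm z1); split; [rewrite nrm_ge0/=|exists z1].
  by exists 0 => r [/andP[]].
pose r0 := inf S.
have r0z1 : r0 <= nrm z1.
  by apply: (ge_inf S_inf.2); split; [rewrite nrm_ge0/=|exists z1].
have below z : nrm z < r0 -> 0 < complex.Re (f z).
  move=> zr; rewrite ltNge; apply/negP => fz.
  have : r0 <= nrm z.
    apply: (ge_inf S_inf.2); split; last by exists z.
    by rewrite nrm_ge0/= (le_trans (ltW zr)).
  lra.
have ReB (a b : C) : complex.Re (a - b) = complex.Re a - complex.Re b by rewrite raddfB.
have cont z : nrm z < 1 -> forall e : R, 0 < e -> exists2 d : R, 0 < d &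
    forall w, nrm (w - z) < d -> `|complex.Re (f w) - complex.Re (f z)| <= e.
  move=> zz e e0; have [d d0 hd] := cderiv_cont (fd z zz) e0.
  by exists d => // w /hd; rewrite -ReB; apply: le_trans; exact: Re_le_nrm.
have [z0 z0r fz0] : exists2 z0, nrm z0 <= r0 & complex.Re (f z0) <= 0.
  apply: contrapT => nz0.
  have good z : nrm z <= r0 -> 0 < complex.Re (f z).
    by move=> zr; rewrite ltNge; apply/negP => fz; apply: nz0; exists z.
  have nz1 : 0 < nrm z1.
    apply: nrm_gt0; apply: contraTneq fz1 => ->; rewrite -ltNge.
    exact: f0.
  (* If the infimum were not attained, [Re f] would be positive on the closed disc of radius [r0],
     hence, by compactness, on a slightly larger one within [|z| <= |z1|], against the choice of
     [r0]. *)
  have [||z zr|e e0 he] := @disc_induction R (nrm z1) (fun A => exists2 e : R, 0 < e &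
      forall z, A z -> nrm z < r0 + e -> 0 < complex.Re (f z)) nz1.
  - by move=> A B AB [e e0 h]; exists e => // z /AB/h.
  - move=> A B [e1 e10 h1] [e2 e20 h2]; exists (Num.min e1 e2); first by rewrite lt_min e10.
    by move=> z Az; rewrite -ltrBlDl lt_min !ltrBlDl => /andP[k1 k2]; case: Az => [/h1|/h2]; apply.
  - have [zr0|zr0] := leP (nrm z) r0.
      have fz := good _ zr0.
      have [d d0 hd] := cont _ (le_lt_trans zr z11) _ (ltac:(lra) : 0 < complex.Re (f z) / 2).
      by exists d => //; exists 1 => // w /= /hd; rewrite ler_norml; lra.
    exists ((nrm z - r0) / 2); first lra.
    exists ((nrm z - r0) / 2); first lra.
    move=> w /=; rewrite nrmBC => zw wr.
    by have := nrmD (z - w) w; rewrite subrK; lra.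
  have [r [/andP[r00 rz1] [z zr fz]] rr0] := inf_adherent e0 S_inf.
  have := he z (le_trans zr rz1) (le_lt_trans zr rr0); lra.
have z01 : nrm z0 < 1 by lra.
have z0n : z0 != 0 by apply: contraTneq fz0 => ->; rewrite -ltNge.
have nz0 := nrm_gt0 z0n.
have fz00 : complex.Re (f z0) = 0.
  apply/eqP; rewrite eq_le fz0/=; apply/ler_addgt0Pr => e e0.
  have [d d0 hd] := cont z0 z01 e e0.
  pose s := Num.min (1 / 2) (d / 2).
  have s0 : 0 < s by rewrite lt_min; lra.
  have s2 : s <= 1 / 2 by rewrite ge_min lexx.
  have sd : s <= d / 2 by rewrite ge_min lexx orbT.
  have h1 := below ((1 - s)%:C * z0).
  have h2 := hd ((1 - s)%:C * z0).
  have e1 : (1 - s)%:C * z0 - z0 = (- s)%:C * z0 by rewrite rmorphB rmorphN rmorph1; ring.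
  have a1 : `|1 - s| = 1 - s by clear -s2; rewrite ger0_norm; lra.
  have a2 : `|- s| = s by rewrite normrN gtr0_norm.
  rewrite e1 !nrmM !nrm_real a2 in h2; rewrite nrmM nrm_real a1 in h1.
  have := h1 ltac:(clear -s0 s2 z0r nz0; nra).
  have := h2 ltac:(clear -s0 sd z01 nz0 d0; nra); rewrite ler_norml; clear -e0; lra.
pose d := z0 * f' z0.
(* For [Re eta < 0] and small [s > 0], the point [z0 (1 + s eta)] lies strictly inside the disc of
   radius [|z0|], where [Re f > 0]; so [Re f] cannot decrease to first order in that direction. *)
have inward (eta : C) : complex.Re eta < 0 -> 0 <= complex.Re (d * eta).
  move=> eta0; have n0 : 0 < nrm eta.
    by apply: nrm_gt0; apply: contraTneq eta0 => ->; rewrite ltxx.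
  apply/ler_addgt0Pr => e e0.
  pose K := nrm z0 * nrm eta.
  have K0 : 0 < K by rewrite mulr_gt0.
  have [r rr0 hr] := fd z0 z01 (e / K) (divr_gt0 e0 K0).
  pose s := Num.min (r / 2 / K) (- complex.Re eta / nrm eta ^+ 2).
  have s0 : 0 < s by rewrite lt_min !divr_gt0 ?exprn_gt0// oppr_gt0.
  have s1 : s * nrm eta ^+ 2 <= - complex.Re eta.
    by rewrite -ler_pdivlMr ?exprn_gt0// ge_min lexx orbT.
  have s2 : s * K <= r / 2 by rewrite -ler_pdivlMr// ge_min lexx.
  have one (x : C) : nrm (1 + s%:C * x) ^+ 2 = 1 + 2 * s * complex.Re x + s ^+ 2 * nrm x ^+ 2.
    by rewrite !sqr_nrm; case: x => a b /=; ring.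
  have n1 : nrm (1 + s%:C * eta) < 1.
    rewrite -(expr_lt1 (n := 2))// ?nrm_ge0// one.
    have : s * (s * nrm eta ^+ 2) <= s * - complex.Re eta by rewrite ler_pM2l.
    have : s * complex.Re eta < 0 by rewrite pmulr_rlt0.
    clear -s0; lra.
  have h1 := below (z0 * (1 + s%:C * eta)).
  have h2 := hr (z0 * (1 + s%:C * eta)).
  have e1 : z0 * (1 + s%:C * eta) - z0 = s%:C * (z0 * eta) by ring.
  rewrite e1 !nrmM nrm_real (gtr0_norm s0) -/K in h2.
  have {}h1 : 0 < complex.Re (f (z0 * (1 + s%:C * eta))).
    by apply: h1; rewrite nrmM; clear -n1 z0r nz0; nra.
  have {}h2 := h2 (le_lt_trans s2 (ltac:(clear -rr0; lra) : r / 2 < r)).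
  have h3 := le_trans (Re_le_nrm _) h2.
  rewrite !ReB fz00 subr0 in h3.
  have e2 : complex.Re (s%:C * (z0 * eta) *: (f' z0 : C^o)) = s * complex.Re (d * eta).
    rewrite /d /GRing.scale /=.
    have -> : s%:C * (z0 * eta) * f' z0 = s%:C * (z0 * f' z0 * eta) by ring.
    by case: (z0 * f' z0 * eta) => a b /=; rewrite mul0r subr0.
  rewrite e2 in h3.
  have e3 : e / K * (s * K) = s * e by field; rewrite gt_eqF.
  rewrite e3 ler_norml in h3.
  rewrite -(ler_pM2l s0) mulr0; clear -h1 h3; lra.
have dRe : complex.Re d <= 0.
  have := inward (- 1 : R)%:C ltac:(by rewrite /= ltrN10).
  by case: (d) => a b /=; lra.
apply: (hz z0 z01 fz00) => //.
rewrite -/d; apply/eqP; rewrite -normr_le0; apply/ler_addgt0Pr => e e0.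
(* The directions [- q + i] and [- q - i] with small [q] are inward and nearly tangential; together
   they give [|Im d| <= - q Re d <= e]. *)
pose q := e / (1 - complex.Re d).
have q0 : 0 < q by rewrite divr_gt0//; lra.
have qe : q * - complex.Re d <= e.
  by rewrite /q mulrAC ler_pdivrMr; clear -dRe e0; [rewrite ler_pM2l//; lra|lra].
have i1 := inward (Complex (- q) 1) ltac:(by rewrite /= oppr_lt0).
have i2 := inward (Complex (- q) (-1)) ltac:(by rewrite /= oppr_lt0).
rewrite add0r ler_norml; move: qe i1 i2.
by case: (d) => a b /=; lra.
Qed.

End FirstZero.

(** * The extremal function *)

Section Extremal.
Context {R : realType}.
Local Notation C := R[i].

Lemma Re_div_gt0 (a b : C) : b != 0 -> 0 < complex.Re (a * b^*%C) -> 0 < complex.Re (a / b).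
Proof.
move=> b0 ab; have nb : 0 < nrm b ^+ 2 by rewrite exprn_gt0// nrm_gt0.
have nbC : (nrm b ^+ 2)%:C != 0 :> C by apply/eqP => /(congr1 (@complex.Re R)) /=; lra.
have -> : a / b = (a * b^*%C) * ((nrm b ^+ 2)^-1)%:C.
  have bc0 : b^*%C != 0 by rewrite conjc_eq0.
  by rewrite fmorphV /= -mul_conj; field; rewrite b0 bc0.
by rewrite Re_mul_real mulr_gt0// invr_gt0.
Qed.

Lemma one_sub_Re (w : C) : nrm w < 1 -> 0 < complex.Re (1 - w).
Proof.
move=> w1; rewrite raddfB /=.
by have := Re_le_nrm w; rewrite ler_norml; lra.
Qed.

Lemma one_sub_neq0 (w : C) : nrm w < 1 -> 1 - w != 0.
Proof. by move=> /one_sub_Re h; apply/eqP => e; move: h; rewrite e ltxx. Qed.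

Lemma cayley_Re (w : C) : nrm w < 1 -> 0 < complex.Re ((1 + w) / (1 - w)).
Proof.
move=> w1; apply: Re_div_gt0; first exact: one_sub_neq0.
have -> : complex.Re ((1 + w) * (1 - w)^*%C) = 1 - nrm w ^+ 2.
  by rewrite sqr_nrm; case: w {w1} => a b /=; ring.
by rewrite subr_gt0 expr_lt1// nrm_ge0.
Qed.

Lemma cderiv_zero_const (f : C -> C^o) : (forall z, nrm z < 1 -> cderiv f z 0) ->
  forall z, nrm z < 1 -> f z = f 0.
Proof.
move=> fd z z1; apply/eqP; rewrite -subr_eq0; apply/eqP/nrm_eq0/eqP.
rewrite eq_le nrm_ge0 andbT -(mul0r (nrm (z - 0))).
apply: mean_value_bound => s s01; exists 0; last by rewrite nrm0.
apply: fd; rewrite subr0 add0r nrmM nrm_real ger0_norm; last lra.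
by have := nrm_ge0 z; nra.
Qed.

Lemma cderiv_affine (a b z : C) : cderiv (Y := C^o) (fun z => a + b * z) z b.
Proof.
have h := cderivD (cderiv_cst (a : C^o) z) (cderivM (cderiv_cst (b : C^o) z) (cderiv_id z)).
by apply: (cderiv_eq h); rewrite mul0r mulr1 !add0r.
Qed.

(** [L] is a primitive of the logarithmic derivative, and [(1 - eps z) exp (- L z)] has derivative
    0. Since [Re (1 - eps z) > 0], the cosine of [Im L] never vanishes; hence [Im L], starting from
    0, cannot reach [pi / 2] or [- pi / 2], by [Re_gt0_on_disc] applied to [pi / 2 + i L] and
    [pi / 2 - i L]. *)
Lemma disc_log (eps : C) : nrm eps = 1 -> exists L : C -> C^o,
  [/\ L 0 = 0, forall z, nrm z < 1 -> cderiv L z (- eps / (1 - eps * z)),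
      forall z, nrm z < 1 -> cexp (L z) = 1 - eps * z
    & forall z, nrm z < 1 -> `|complex.Im (L z)| < pi / 2].
Proof.
move=> e1.
have ez (z : C) : nrm z < 1 -> nrm (eps * z) < 1 by rewrite nrmM e1 mul1r.
have wd z : cderiv (Y := C^o) (fun z => 1 - eps * z) z (- eps).
  apply: cderiv_ext (cderiv_affine 1 (- eps) z).
  by exists 1 => // y _; rewrite mulNr.
have [z|h hh] := @disc_primitive R (fun z => - eps / (1 - eps * z)).
  move=> /ez/one_sub_neq0 w0.
  have := cderivZ (- eps) (cderiv_comp (wd z) (cderiv_inv w0)).
  by eexists; eassumption.
pose L (z : C) : C := z * h z.
have Ld z : nrm z < 1 -> cderiv (Y := C^o) L z (- eps / (1 - eps * z)).
  move=> z1; have [d hd hE] := hh z z1.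
  by apply: (cderiv_eq (cderivM (cderiv_id z) hd)); rewrite mul1r hE.
have L0 : L 0 = 0 by rewrite /L mul0r.
have LE z : nrm z < 1 -> cexp (L z) = 1 - eps * z.
  move=> z1.
  have cst : (1 - eps * z) * cexp (- 1 * L z) = (1 - eps * 0) * cexp (- 1 * L 0).
    apply: (cderiv_zero_const (f := fun z => (1 - eps * z) * cexp (- 1 * L z))) => // w w1.
    have w0 := one_sub_neq0 (ez w w1).
    have hyp := cderivM (wd w) (cderiv_comp (f := cexp : C -> C^o) (cderivZ (-1) (Ld w w1)) (cderiv_cexp _)).
    by apply: (cderiv_eq hyp); rewrite /GRing.scale /=; field.
  move: cst; rewrite L0 !mulr0 subr0 cexp0 mulr1 mulN1r => cst.
  have := cexpD (L z) (- L z); rewrite subrr cexp0 => e.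
  have n0 := cexp_neq0 (- L z).
  by apply: (mulIf n0); rewrite cst -e.
exists L; split=> //.
have Re_cos z : nrm z < 1 -> cos (complex.Im (L z)) != 0.
  move=> z1; apply/eqP => c0; have := one_sub_Re (ez z z1).
  by rewrite -LE// /cexp /= c0 mulr0 mul0r subr0 ltxx.
have pi0 : 0 < pi / 2 :> R by rewrite divr_gt0// pi_gt0.
have upper (s : C) (z : C) : s = 'i%C \/ s = - 'i%C -> nrm z < 1 ->
    0 < complex.Re ((pi / 2)%:C + s * L z).
  move=> si; move: z.
  apply: (@Re_gt0_on_disc R _ (fun z => s * (- eps / (1 - eps * z)))).
  - move=> z z1; have hyp := cderivD (cderiv_cst ((pi / 2)%:C : C^o) z) (cderivZ s (Ld z z1)).
    by apply: (cderiv_eq hyp); rewrite add0r.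
  - by rewrite L0 mulr0 addr0.
  - move=> z z1 Re0 _ _; have /eqP := Re_cos z z1; apply.
    case: si Re0 => ->; case: (L z) => a b /=; rewrite ?oppr0 !mul0r ?mul1r ?mulN1r ?sub0r ?opprK => hb.
      have -> : b = pi / 2 by lra.
      by rewrite cos_pihalf.
    have -> : b = - (pi / 2) by lra.
    by rewrite cosN cos_pihalf.
move=> z z1; have := upper 'i%C z (or_introl erefl) z1; have := upper (- 'i%C) z (or_intror erefl) z1.
by case: (L z) => a b /=; rewrite ?oppr0 !mul0r ltr_norml; lra.
Qed.

Section Construction.
Variables (mu t : R).
Hypotheses (mu1 : 1 <= mu <= 3 / 2) (t0 : 0 <= t < 1).

Definition ext_Q (z : C) : C := 1 - 2 * t%:C * z + z ^+ 2.
(** The logarithmic derivative of [ext_Q] raised to the power [- mu]. *)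
Definition ext_R (z : C) : C := 2 * mu%:C * (t%:C - z) / ext_Q z.

(** The point of the unit circle with real part [t]; [ext_Q] factors through it and its conjugate,
    so its zeros lie on the circle. *)
Let eps : C := Complex t (Num.sqrt (1 - t ^+ 2)).

Let sqt : Num.sqrt (1 - t ^+ 2) ^+ 2 = 1 - t ^+ 2.
Proof. by rewrite sqr_sqrtr//; move: t0 => /andP[h1 h2]; nra. Qed.

Let eps1 : nrm eps = 1.
Proof.
apply/eqP; rewrite -(@eqrXn2 _ 2) ?nrm_ge0 ?ler01// sqr_nrm /= sqt expr1n.
by apply/eqP; ring.
Qed.

Let epsc1 : nrm eps^*%C = 1. Proof. by rewrite nrm_conj. Qed.

Let eps_mul : eps * eps^*%C = 1. Proof. by rewrite mul_conj eps1 expr1n. Qed.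
Let eps_add : eps + eps^*%C = 2 * t%:C. Proof. by rewrite addcJ. Qed.

Let QE z : ext_Q z = (1 - eps * z) * (1 - eps^*%C * z).
Proof.
have -> : (1 - eps * z) * (1 - eps^*%C * z) =
    1 - (eps + eps^*%C) * z + eps * eps^*%C * z ^+ 2 by ring.
by rewrite eps_mul eps_add mul1r.
Qed.

Let ez z : nrm z < 1 -> nrm (eps * z) < 1. Proof. by rewrite nrmM eps1 mul1r. Qed.
Let ecz z : nrm z < 1 -> nrm (eps^*%C * z) < 1. Proof. by rewrite nrmM epsc1 mul1r. Qed.

Lemma ext_Q_neq0 z : nrm z < 1 -> ext_Q z != 0.
Proof.
by move=> z1; rewrite QE mulf_neq0// one_sub_neq0// ?ez ?ecz.
Qed.

Lemma cderiv_ext_Q z : cderiv (Y := C^o) ext_Q z (2 * (z - t%:C)).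
Proof.
have := cderivD (cderiv_affine 1 (- (2 * t%:C)) z) (cderivM (cderiv_id z) (cderiv_id z)).
move=> h; apply: cderiv_ext (cderiv_eq h _); last by ring.
by exists 1 => // y _; rewrite /ext_Q mulNr expr2.
Qed.

(** A two-point Herglotz formula: the quotient is the mean of the Cayley transforms of [eps z] and
    of its conjugate counterpart. *)
Lemma herglotz_Re z : nrm z < 1 -> 0 < complex.Re ((1 - z ^+ 2) / ext_Q z).
Proof.
move=> z1; have w1 := one_sub_neq0 (ez z1); have w2 := one_sub_neq0 (ecz z1).
have -> : (1 - z ^+ 2) / ext_Q z = ((1 + eps * z) / (1 - eps * z) +
   (1 + eps^*%C * z) / (1 - eps^*%C * z)) * (2^-1 : R)%:C.
  have -> : (2^-1 : R)%:C = 2^-1 :> C by rewrite fmorphV (rmorph_nat (real_complex R) 2).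
  rewrite QE.
  have -> : 1 - z ^+ 2 = 1 - (eps * eps^*%C) * z ^+ 2 by rewrite eps_mul mul1r.
  by field; rewrite w1 w2.
have := cayley_Re (ez z1); have := cayley_Re (ecz z1).
by move=> k1 k2; rewrite Re_mul_real mulr_gt0 ?invr_gt0// raddfD addr_gt0.
Qed.

Lemma ext_R_Re z : nrm z < 1 -> 1 - mu < complex.Re (1 + z * ext_R z).
Proof.
move=> z1; have Q0 := ext_Q_neq0 z1.
have -> : 1 + z * ext_R z = (1 - mu)%:C + (1 - z ^+ 2) / ext_Q z * mu%:C.
  rewrite rmorphB rmorph1 /ext_R; move: Q0; rewrite /ext_Q => Q0; field; exact: Q0.
by rewrite raddfD /= ltrDl Re_mul_real mulr_gt0 ?herglotz_Re//; move: mu1; lra.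
Qed.

(* [h0] and [h] are the integrals of [1/Q] and [G = Q^(-mu)]. First [u = Q h0] satisfies
   [1 = u P + z u'] with [Re P > 0], hence [Re u > 0]; then [w = h / h0] satisfies
   [Q^(1 - mu) = w + u z w'] with [Re Q^(1 - mu) > 0], hence [Re w > 0]. *)
Lemma extremal_function : exists h G : C -> C,
  [/\ forall z, nrm z < 1 -> exists2 d, cderiv (Y := C^o) h z d & h z + z * d = G z,
      forall z, nrm z < 1 -> h z != 0 /\ G z != 0,
      forall z, nrm z < 1 -> cderiv (Y := C^o) G z (G z * ext_R z)
    & G 0 = 1].
Proof.
have [L1 [L10 L1d L1E L1i]] := disc_log eps1.
have [L2 [L20 L2d L2E L2i]] := disc_log epsc1.
have mu1' := mu1.
pose k : C := (1 - mu)%:C.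
pose q (z : C) : C := cexp (k * (L1 z + L2 z)).
have qd z : nrm z < 1 -> cderiv (Y := C^o) q z (q z * (k * (2 * (z - t%:C) / ext_Q z))).
  move=> z1; have w1 := one_sub_neq0 (ez z1); have w2 := one_sub_neq0 (ecz z1).
  have hyp := cderiv_comp (f := cexp : C -> C^o) (cderivZ k (cderivD (L1d z z1) (L2d z z1))) (cderiv_cexp _).
  apply: (cderiv_eq hyp); rewrite -/(q z) [_ *: q z]mulrC; congr (q z * (k * _)).
  have -> : 2 * (z - t%:C) = 2 * (eps * eps^*%C) * z - (eps + eps^*%C) by rewrite eps_mul eps_add; ring.
  by rewrite QE; field; rewrite w1 w2.
have qRe z : nrm z < 1 -> 0 < complex.Re (q z).
  move=> z1; rewrite /q /cexp.
  have -> : complex.Im (k * (L1 z + L2 z)) = (1 - mu) * (complex.Im (L1 z) + complex.Im (L2 z)).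
    by rewrite /k; case: (L1 z) => a b; case: (L2 z) => c d /=; ring.
  (* Each [Im L] is below [pi / 2] in modulus, and [mu <= 3 / 2], so the argument of [Q^(1 - mu)]
     stays below [pi / 2] in modulus. *)
  set x := (1 - mu) * _.
  have xb : `|x| < pi / 2.
    rewrite /x normrM ler0_norm; last lra.
    have := L1i z z1; have := L2i z z1.
    have := ler_normD (complex.Im (L1 z)) (complex.Im (L2 z)).
    have := normr_ge0 (complex.Im (L1 z) + complex.Im (L2 z)).
    by have := pi_gt0 R; nra.
  rewrite /= mul0r subr0 mulr_gt0 ?expR_gt0//.
  by apply: cos_gt0_pihalf; move: xb; rewrite ltr_norml.
pose G (z : C) : C := q z / ext_Q z.
have Vd z : nrm z < 1 -> cderiv (Y := C^o) (fun z => (ext_Q z)^-1) z (- (2 * (z - t%:C)) / ext_Q z ^+ 2).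
  move=> z1; have hyp := cderiv_comp (cderiv_ext_Q z) (cderiv_inv (ext_Q_neq0 z1)).
  by apply: (cderiv_eq hyp); rewrite /GRing.scale /= mulrN mulNr.
have Gd z : nrm z < 1 -> cderiv (Y := C^o) G z (G z * ext_R z).
  move=> z1; have Q0 := ext_Q_neq0 z1.
  have hyp := cderivM (qd z z1) (Vd z z1); apply: (cderiv_eq hyp).
  by rewrite /G /ext_R /k rmorphB rmorph1; field.
have [z z1|h0 hh0] := @disc_primitive R (fun z => (ext_Q z)^-1).
  by eexists; apply: Vd.
have [z z1|h hh] := @disc_primitive R G.
  by eexists; apply: Gd.
have G0 : G 0 = 1.
  by rewrite /G /q L10 L20 addr0 mulr0 cexp0 /ext_Q mulr0 subr0 expr0n addr0 divr1.
have o1 : nrm (0 : C) < 1 by rewrite nrm0.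
have uRe : forall z, nrm z < 1 -> 0 < complex.Re (ext_Q z * h0 z).
  (* The derivative of [h0] is read off from [h0 z + z h0'(z) = 1 / Q], except at 0, where that
     equation does not determine it. *)
  apply: (@Re_gt0_on_disc R _ (fun z => 2 * (z - t%:C) * h0 z + ext_Q z *
     (if z == 0 then xget 0 [set d | cderiv h0 0 d] else ((ext_Q z)^-1 - h0 z) / z))).
  - move=> z z1; have [d hd hE] := hh0 z z1.
    have hyp := cderivM (cderiv_ext_Q z) hd; apply: (cderiv_eq hyp); congr (_ + _ * _).
    case: eqVneq => [z0|z0]; last by rewrite -hE addrAC subrr add0r mulrAC mulfV// mul1r.
    by rewrite z0 in hd; apply: (cderiv_unique hd); exact: (xgetPex 0 (ex_intro _ d hd)).
  - have [d _] := hh0 0 o1; rewrite mul0r addr0 => ->.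
    by rewrite mulfV ?ext_Q_neq0// ltr01.
  - move=> z z1; have Q0 := ext_Q_neq0 z1.
    set rho := z * _.
    have key : ext_Q z * h0 z * ((1 - z ^+ 2) / ext_Q z) + rho = 1.
      rewrite /rho; case: eqVneq => [->|z0].
        have [d _] := hh0 0 o1; rewrite mul0r addr0 => ->.
        have -> : ext_Q 0 = 1 by rewrite /ext_Q mulr0 subr0 expr0n addr0.
        by rewrite mul0r addr0 expr0n subr0 invr1 !mulr1.
      move: Q0; rewrite /ext_Q => Q0; field.
      by rewrite Q0 z0.
    set u := ext_Q z * h0 z in key *.
    move=> u0 rho_im rho_re.
    have P0 := herglotz_Re z1; set P := _ / _ in key P0.
    have uP : u * P = (1 - complex.Re rho)%:C.
      have -> : u * P = 1 - rho by rewrite -key addrK.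
      by case: (rho) rho_im => a b /= ->; apply/eqP; rewrite eq_complex /= subrr !eqxx.
    have un : u = 0.
      have e1 : complex.Re P * nrm u ^+ 2 = 0.
        have -> : complex.Re P * nrm u ^+ 2 = complex.Re (u * P * u^*%C).
          by rewrite sqr_nrm; case: (u) => a b; case: (P) => c d /=; ring.
        by rewrite uP; case: (u) u0 => a b /= ->; ring.
      move/eqP: e1; rewrite mulf_eq0 gt_eqF//= sqrf_eq0 => /eqP; exact: nrm_eq0.
    by move: uP => /(congr1 (@complex.Re R)); rewrite un mul0r /=; lra.
have h0n z : nrm z < 1 -> h0 z != 0.
  by move=> /uRe; apply: contraTneq => ->; rewrite mulr0 ltxx.
have wRe : forall z, nrm z < 1 -> 0 < complex.Re (h z / h0 z).
  have ratio_deriv z : nrm z < 1 -> exists2 d, cderiv (Y := C^o) (fun z => h z / h0 z) z d &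
      h z / h0 z + (ext_Q z * h0 z) * (z * d) = q z.
    move=> z1; have [d hd hE] := hh z z1; have [d0 hd0 hE0] := hh0 z z1.
    have n0 := h0n z z1; have Q0 := ext_Q_neq0 z1.
    have hV := cderiv_comp hd0 (cderiv_inv n0).
    exists (d * (h0 z)^-1 + h z * (d0 *: (- (h0 z ^- 2) : C^o))); first exact: cderivM hd hV.
    have qE : q z = ext_Q z * (h z + z * d) by rewrite hE /G mulrCA mulfV// mulr1.
    have QV : ext_Q z * (h0 z + z * d0) = 1 by rewrite hE0 mulfV.
    rewrite qE /GRing.scale /=.
    have -> : h z / h0 z = ext_Q z * (h0 z + z * d0) * (h z / h0 z) by rewrite QV mul1r.
    by field.
  pose w' (z : C) : C := xget 0 [set d | cderiv (Y := C^o) (fun z => h z / h0 z) z d].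
  have w'd z : nrm z < 1 -> cderiv (Y := C^o) (fun z => h z / h0 z) z (w' z).
    move=> z1; have [d hd _] := ratio_deriv z z1.
    exact: (xgetPex 0 (ex_intro _ d hd)).
  apply: (@Re_gt0_on_disc R _ w') => //.
    have [d _] := hh0 0 o1; have [d' _] := hh 0 o1; rewrite !mul0r !addr0 G0 => -> ->.
    by rewrite invrK mul1r /ext_Q mulr0 subr0 expr0n addr0 ltr01.
  move=> z z1 w0 im0 re0.
  have [d hd hE] := ratio_deriv z z1.
  have dE : w' z = d := cderiv_unique (w'd z z1) hd.
  rewrite dE in im0 re0; have := qRe z z1; rewrite -hE raddfD /= w0 add0r.
  (* Here [Re w = 0] and [z w'] is real and nonpositive, so the equation gives
     [Re q = Re u * (z w') <= 0], a contradiction. *)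
  have := uRe z z1; case: (ext_Q z * h0 z) => a b; case: (z * d) im0 re0 => c e /= -> re0.
  by move=> a0; rewrite mulr0 subr0; nra.
exists h, G; split=> //.
move=> z z1; split.
  by have := wRe z z1; apply: contraTneq => ->; rewrite mul0r ltxx.
by rewrite mulf_neq0 ?invr_neq0 ?ext_Q_neq0//; apply: cexp_neq0.
Qed.

End Construction.
End Extremal.

(** * The extremal map on the ball *)

Section Sharpness.
Context {R : realType} {X : completeNormedModType R[i]}.
Local Notation C := R[i].

Lemma support_of_bound (T : X -> C^o) (x0 : X) : `|x0| = 1 -> linear T ->
  (forall v, nrm (T v) <= nrm v) -> T x0 = 1 -> support_functionals x0 T.
Proof.
move=> x01 lT Tn Tx0; have nx0 : nrm x0 = 1 by rewrite /nrm x01.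
split=> //; last 2 first.
- by rewrite x01.
- have ub : ubound [set complex.Re `|T v| | v in [set v : X | `|v| <= 1]] 1.
    move=> _ [v /= v1 <-]; rewrite -/(nrm _); apply: (le_trans (Tn v)).
    by move: v1; rewrite normE (_ : 1 = 1%:C)// lecR.
  have mem : [set complex.Re `|T v| | v in [set v : X | `|v| <= 1]] 1.
    by exists x0; rewrite /= ?x01// Tx0; exact: nrm1.
  apply/eqP; rewrite eq_le; apply/andP; split.
    by apply: ge_sup => //; exists 1.
  by apply: ub_le_sup => //; exists 1.
apply/(bounded_continuous lT); exists 1; split=> // v; by rewrite mul1r.
Qed.

Lemma homogeneous_power (T : X -> C^o) (c : C) k : linear T ->
  homogeneous_poly k (fun x => c * T x ^+ k : C^o).
Proof.
move=> lT; have [_ _ TD TZ] := linearB0 lT.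
exists (fun v : 'I_k -> X => c * \prod_(i < k) T (v i) : C^o); last first.
  by move=> x; rewrite prodr_const card_ord.
move=> v i a u w.
have E y : \prod_(j < k) T (@dfwith _ (fun=> X) v i y j) =
    T y * \prod_(j < k | j != i) T (v j).
  rewrite (bigD1 i)//= dfwithin; congr (_ * _); apply: eq_bigr => j ji.
  by rewrite dfwithout// eq_sym.
rewrite !E TD TZ /GRing.scale /=; ring.
Qed.

Section Map.
Variables (mu t : R) (h G : C -> C) (T : X -> C^o).
Hypotheses (mu1 : 1 <= mu <= 3 / 2) (t0 : 0 <= t < 1) (lT : linear T)
  (Tn : forall v, nrm (T v) <= nrm v).
Hypotheses
  (hG : forall z, nrm z < 1 -> exists2 d, cderiv (Y := C^o) h z d & h z + z * d = G z)
  (hG0 : forall z, nrm z < 1 -> h z != 0 /\ G z != 0)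
  (Gd : forall z, nrm z < 1 -> cderiv (Y := C^o) G z (G z * ext_R mu t z))
  (G01 : G 0 = 1).

Definition radial_map (y : X) : X := h (T y) *: y.
Local Notation F := radial_map.

Let TD u v : T (u + v) = T u + T v. Proof. by have [_ _ -> _] := linearB0 lT. Qed.
Let TM (a : C) v : T (a *: v) = a * T v. Proof. by have [_ _ _ ->] := linearB0 lT. Qed.

Let T_ball y : unit_ball y -> nrm (T y) < 1.
Proof. by move=> /unit_ballP; apply: le_lt_trans. Qed.

Lemma radial_map_frechet y d : cderiv (Y := C^o) h (T y) d ->
  frechet F y (fun v => (T v * d) *: y + h (T y) *: v).
Proof.
move=> hd.
have T1 : bounded_by T 1 by split=> // v; rewrite mul1r.
have Tk := tangent_comp (tangent_linear y lT) T1 hd (scale_linear d) (bounded_scale d).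
have Ab : bounded_by (fun v => T v *: (d : C^o)) (nrm d).
  split=> [|v]; first exact: nrm_ge0.
  by rewrite nrmZ mulrC ler_wpM2l ?nrm_ge0.
have idb : bounded_by (fun v : X => v) 1 by split=> // v; rewrite mul1r.
have lid : linear (fun v : X => v) by [].
split.
- by move=> a u v; rewrite TD TM; module_eq; ring.
- exists (nrm d * nrm y + nrm (h (T y))); split=> [|v].
    by rewrite addr_ge0 ?mulr_ge0 ?nrm_ge0.
  apply: (le_trans (nrmD _ _)); rewrite !nrmZ nrmM mulrDl lerD2r.
  have -> : nrm d * nrm y * nrm v = nrm v * nrm d * nrm y by ring.
  by rewrite !ler_wpM2r ?nrm_ge0// Tn.
- exact: tangent_scale Tk Ab (tangent_linear y lid) idb.
Qed.

Lemma radial_map_holo : holomorphic_on_ball F.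
Proof.
move=> y /T_ball/hG[d hd _].
by have [] := frechet_differentiable (radial_map_frechet hd).
Qed.

Lemma radial_map_locally_biholomorphic : locally_biholomorphic F.
Proof.
split; first exact: radial_map_holo.
move=> y yU; have y1 := T_ball yU; have [d hd hE] := hG y1; have [h0 g0] := hG0 y1.
have [_ DE] := frechet_differentiable (radial_map_frechet hd).
(* [DF(y)] is [h(T y)] times the identity plus a rank-one map, and [T (DF(y) v) = G(T y) * T v].
   Recovering [T v] from this determines the inverse, which needs [h] and [G] to be nonzero. *)
pose S (w : X) : X := (h (T y))^-1 *: (w + (- (d / G (T y) * T w)) *: y).
have TS w : T (S w) = T w / G (T y).
  rewrite /S TM TD TM.
  by move: g0; rewrite -hE => g0; field; rewrite ?h0 ?g0.
have LS : cancel S ('d F y).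
  move=> w; rewrite DE TS /S scalerA mulfV// scale1r.
  by module_eq; ring.
have SL : cancel ('d F y) S.
  move=> v; rewrite DE /S TD !TM.
  have -> : T v * d * T y + h (T y) * T v = T v * G (T y) by rewrite -hE; ring.
  rewrite (_ : d / G (T y) * (T v * G (T y)) = T v * d); last by field.
  rewrite [X in _ *: X](_ : _ = h (T y) *: v); last by module_eq; ring.
  by rewrite scalerA mulVf// scale1r.
have bF : bijective ('d F y) by exists S.
split=> //.
have [BA AB] := DinvK bF.
have -> : Dinv F y = S by apply/funext => w; rewrite -{1}(LS w) AB.
have lS : linear S.
  by move=> a u v; rewrite /S TD TM; module_eq; ring.
apply/(bounded_continuous lS).
exists (nrm (h (T y))^-1 * (1 + nrm (d / G (T y)) * nrm y)); split=> [|w].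
  by rewrite mulr_ge0 ?addr_ge0 ?mulr_ge0 ?nrm_ge0.
rewrite /S nrmZ -[leRHS]mulrA ler_wpM2l ?nrm_ge0//.
apply: (le_trans (nrmD _ _)); rewrite nrmZ nrmN nrmM mulrDl mul1r lerD2l.
by rewrite mulrAC ler_wpM2l ?Tn// mulr_ge0 ?nrm_ge0.
Qed.

Let ray_near (x : X) (z : C) : unit_ball (z *: x) ->
  exists2 r : R, 0 < r & forall w, nrm (w - z) < r -> unit_ball (w *: x).
Proof.
move=> zU; have [r r0 hr] := open_unit_ball zU.
have nx := nrm_ge0 x.
exists (r / (nrm x + 1)); first by rewrite divr_gt0//; lra.
move=> w; rewrite ltr_pdivlMr; last lra.
move=> wz; apply: hr; rewrite -scalerBl nrmZ.
by have := nrm_ge0 (w - z); lra.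
Qed.

(** The inductive step: along a ray the derivatives remain multiples of [x], so they reduce to
    scalar derivatives of [z h(z T x)], the first of which is [G(z T x)]. *)
Lemma radial_map_ray n (phi : C -> C) (x : X) (z c : C) :
  (forall w, unit_ball (w *: x) -> ray_Dn F x n w = phi w *: x) ->
  unit_ball (z *: x) -> cderiv (Y := C^o) phi z c -> ray_Dn F x n.+1 z = c *: x.
Proof.
move=> hphi zU phid; have [r r0 hr] := ray_near zU.
have D1 := ray_Dn_deriv n radial_map_holo zU.
have D2 : cderiv (fun z => phi z *: x) z (c *: x).
  by apply: (cderiv_eq (cderiv_scale phid (cderiv_cst x z))); rewrite scaler0 addr0.
apply: (cderiv_unique D1); apply: cderiv_ext D2.
by exists r => // w /hr wU; rewrite hphi.
Qed.

Let Rf := ext_R mu t.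
Let Q := ext_Q t.
(** The derivative of [ext_R]. *)
Definition ext_R1 (z : C) : C := 2 * mu%:C * (2 * (t%:C - z) ^+ 2 / ext_Q t z ^+ 2 - (ext_Q t z)^-1).
Let R1 := ext_R1.

Let sub_deriv z : cderiv (Y := C^o) (fun z => t%:C - z) z (-1).
Proof.
apply: cderiv_ext (cderiv_affine t%:C (-1) z); exists 1 => // y _.
by rewrite mulN1r.
Qed.

Let QV_deriv z : nrm z < 1 -> cderiv (Y := C^o) (fun z => (Q z)^-1) z (2 * (t%:C - z) / Q z ^+ 2).
Proof.
move=> z1; have hyp := cderiv_comp (cderiv_ext_Q t z) (cderiv_inv (ext_Q_neq0 t0 z1)).
by apply: (cderiv_eq hyp); rewrite /GRing.scale /= mulrN -mulNr; congr (_ / _); ring.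
Qed.

Let Rf_deriv z : nrm z < 1 -> cderiv (Y := C^o) Rf z (R1 z).
Proof.
move=> z1; have Q0 := ext_Q_neq0 t0 z1.
have hyp := cderivM (cderivZ (2 * mu%:C) (sub_deriv z)) (QV_deriv z1).
apply: (cderiv_eq hyp); rewrite /R1 /ext_R1 /Q /GRing.scale /=; field; exact: Q0.
Qed.

Let Q01 : Q 0 = 1. Proof. by rewrite /Q /ext_Q mulr0 subr0 expr0n addr0. Qed.

Let o1 : nrm (0 : C) < 1. Proof. by rewrite nrm0. Qed.

Let R1_deriv : cderiv (Y := C^o) R1 0 (2 * mu%:C * (8 * t%:C ^+ 3 - 6 * t%:C)).
Proof.
have V := QV_deriv o1; have S := sub_deriv 0.
have h1 := cderivZ 2 (cderivM (cderivM S S) (cderivM V V)).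
have h2 := cderivZ (2 * mu%:C) (cderivD h1 (cderivZ (-1) V)).
apply: cderiv_ext (cderiv_eq h2 _).
  exists 1 => // y _; rewrite /R1 /ext_R1 /GRing.scale /= -/Q mulN1r !mulrA.
  by rewrite -exprVn; congr (_ * (_ - _)); ring.
by rewrite /GRing.scale /= Q01 subr0 expr1n invr1; ring.
Qed.

Let ball_arg x z : unit_ball (z *: x) -> nrm (z * T x) < 1.
Proof. by move=> /T_ball; have [_ _ _ ->] := linearB0 lT. Qed.

Let arg_deriv x z : cderiv (Y := C^o) (fun z => z * T x) z (T x).
Proof.
apply: cderiv_ext (cderiv_affine 0 (T x) z); exists 1 => // y _.
by rewrite add0r mulrC.
Qed.

Let chain (g : C -> C) x z c : cderiv (Y := C^o) g (z * T x) c ->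
  cderiv (Y := C^o) (fun z => g (z * T x)) z (T x * c).
Proof. exact: cderiv_comp (arg_deriv x z). Qed.

Let G1 z := G z * Rf z.
Let G2 z := G1 z * Rf z + G z * R1 z.

Let G1_deriv z : nrm z < 1 -> cderiv (Y := C^o) G1 z (G2 z).
Proof. by move=> z1; exact: cderivM (Gd z1) (Rf_deriv z1). Qed.

Lemma radial_map_ray0 x z : ray_Dn F x 0 z = (z * h (z * T x)) *: x.
Proof.
rewrite /ray_Dn /= /radial_map scalerA mulrC.
by have [_ _ _ ->] := linearB0 lT.
Qed.

Lemma radial_map_ray1 x z : unit_ball (z *: x) -> ray_Dn F x 1 z = G (z * T x) *: x.
Proof.
move=> zU; have z1 := ball_arg zU; have [d hd hE] := hG z1.
apply: (radial_map_ray (phi := fun z => z * h (z * T x))) => //.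
  by move=> w _; exact: radial_map_ray0.
by apply: (cderiv_eq (cderivM (cderiv_id z) (chain hd))); rewrite mul1r mulrA hE.
Qed.

Lemma radial_map_ray2 x z : unit_ball (z *: x) -> ray_Dn F x 2 z = (T x * G1 (z * T x)) *: x.
Proof.
move=> zU; apply: (radial_map_ray (phi := fun z => G (z * T x))) => //.
  by move=> w; exact: radial_map_ray1.
by apply: chain; apply: Gd; exact: ball_arg.
Qed.

Lemma radial_map_ray3 x z : unit_ball (z *: x) -> ray_Dn F x 3 z = (T x ^+ 2 * G2 (z * T x)) *: x.
Proof.
move=> zU; apply: (radial_map_ray (phi := fun z => T x * G1 (z * T x))) => //.
  by move=> w; exact: radial_map_ray2.
rewrite expr2 -mulrA.
by apply: (cderivZ (T x)); apply: chain; apply: G1_deriv; exact: ball_arg.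
Qed.

(** [ext_g2], [ext_g3], [ext_g4] are the first three derivatives of [G] at 0, found by iterating
    [G' = G * ext_R]; divided by [n!], they are the coefficients [A_n] when [T x0 = 1]. *)
Definition ext_g2 : R := 2 * mu * t.
Definition ext_g3 : R := ext_g2 ^+ 2 + 2 * mu * (2 * t ^+ 2 - 1).
Definition ext_g4 : R := ext_g3 * ext_g2 + 2 * ext_g2 * (2 * mu * (2 * t ^+ 2 - 1))
   + 2 * mu * (8 * t ^+ 3 - 6 * t).

Let c2 : (2 : R)%:C = 2 :> C. Proof. exact: (natC 2). Qed.

Let Rf0 : Rf 0 = ext_g2%:C.
Proof. by rewrite /Rf /ext_R -/Q Q01 subr0 divr1 /ext_g2 -c2 -!rmorphM. Qed.

Let R10 : R1 0 = (2 * mu * (2 * t ^+ 2 - 1))%:C.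
Proof.
rewrite /R1 /ext_R1 -/Q Q01 subr0 expr1n !invr1 mulr1 -c2 -(rmorph1 (real_complex R)).
by rewrite -rmorphXn -!rmorphM -rmorphB -rmorphM.
Qed.

Let G10 : G1 0 = ext_g2%:C. Proof. by rewrite /G1 G01 mul1r Rf0. Qed.

Let G20 : G2 0 = ext_g3%:C.
Proof. by rewrite /G2 G10 G01 mul1r Rf0 R10 -rmorphM -rmorphD. Qed.

Let ball0 (x : X) : unit_ball ((0 : C) *: x).
Proof. by apply/unit_ballP; rewrite scale0r nrm0. Qed.

Lemma radial_map_ray4 x : ray_Dn F x 4 0 = (T x ^+ 3 * ext_g4%:C) *: x.
Proof.
apply: (radial_map_ray (phi := fun z => T x ^+ 2 * G2 (z * T x))) => //.
  by move=> w; exact: radial_map_ray3.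
have -> : T x ^+ 3 * ext_g4%:C = T x ^+ 2 * (T x * ext_g4%:C) by ring.
apply: (cderivZ (T x ^+ 2)); apply: chain; rewrite mul0r.
have h1 := cderivD (cderivM (G1_deriv o1) (Rf_deriv o1)) (cderivM (Gd o1) R1_deriv).
apply: (cderiv_eq h1); rewrite -/(Rf 0) -/(G1 0) G20 Rf0 G10 R10 G01 mul1r.
have c6 : (6 : R)%:C = 6 :> C := natC 6.
have c8 : (8 : R)%:C = 8 :> C := natC 8.
rewrite -c2 -c6 -c8 -!rmorphXn -!rmorphM -!rmorphB -!rmorphM -!rmorphD; congr (_%:C).
by rewrite /ext_g4; ring.
Qed.

Lemma radial_map_ray_at0 x n : (2 <= n <= 4)%N ->
  ray_Dn F x n 0 = (T x ^+ n.-1 * (nth 0 [:: ext_g2; ext_g3; ext_g4] (n - 2))%:C) *: x.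
Proof.
case: n => [|[|[|[|[|//]]]]]// _.
- by rewrite radial_map_ray2// mul0r G10 expr1.
- by rewrite radial_map_ray3// mul0r G20.
- by rewrite radial_map_ray4.
Qed.

Lemma radial_map_radial_terms : radial_terms F.
Proof.
move=> k k3; pose c : C := k.+1`!%:R^-1 * (nth 0 [:: ext_g2; ext_g3; ext_g4] (k.+1 - 2))%:C.
exists (fun x => c * T x ^+ k : C^o); first exact: homogeneous_power.
move=> x; have := @radial_map_ray_at0 x k.+1 k3.
rewrite /ray_Dn scale0r => ->; rewrite scalerA /c; congr (_ *: _).
by rewrite /=; ring.
Qed.

Lemma radial_map_class lambda : mu = lambda + 1 / 2 -> class_F lambda F.
Proof.
move=> muE; split; last 1 first.
- move=> x xU x0 T' [lT' _ T'x _].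
  have xU1 : unit_ball ((1 : C) *: x) by rewrite scale1r.
  have D1 : 'd F x x = G (T x) *: x.
    have := radial_map_ray1 xU1; rewrite /ray_Dn scale1r mul1r Dn1_diff//.
    exact: radial_map_holo.
  have D2 : Dn F x (fun _ : 'I_2 => x) = (T x * (G (T x) * Rf (T x))) *: x.
    by have := radial_map_ray2 xU1; rewrite /ray_Dn scale1r mul1r.
  have [bF _] := radial_map_locally_biholomorphic.2 x xU.
  have [_ AB] := DinvK bF.
  have [_ _ _ BZ] := linearB0 (Dinv_linear bF).
  (* Both vectors are multiples of [x], so the sum is a multiple of [DF(x) x] and the inverse
     cancels. The class condition thereby becomes the same scalar inequality for every support
     functional at [x]. *)
  have E : Dn F x (fun _ : 'I_2 => x) + 'd F x x = (1 + T x * Rf (T x)) *: 'd F x x.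
    by rewrite D2 D1 scalerA -scalerDl; congr (_ *: _); ring.
  rewrite E BZ AB scalerA; have [_ _ _ TZ'] := linearB0 lT'.
  have nx : `|x| != 0 by rewrite normr_eq0.
  rewrite TZ' T'x /GRing.scale /= mulrAC mulVf// !mul1r.
  apply: (le_trans _ (ltW (ext_R_Re mu1 t0 (T_ball xU)))).
  by rewrite muE; lra.
- split; first by rewrite /radial_map scaler0.
  have [T0 _ _ _] := linearB0 lT.
  have U0 : unit_ball (0 : X) by apply/unit_ballP; rewrite nrm0.
  have [d hd hE] := hG (T_ball U0).
  have [_ ->] := frechet_differentiable (radial_map_frechet hd).
  move=> v; rewrite scaler0 add0r.
  by move: hE; rewrite T0 mul0r addr0 G01 => ->; rewrite scale1r.
- exact: radial_map_locally_biholomorphic.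
Qed.

Lemma radial_map_coef x0 n : T x0 = 1 -> (2 <= n <= 4)%N ->
  coef F x0 T n = (n`!%:R^-1 * nth 0 [:: ext_g2; ext_g3; ext_g4] (n - 2))%:C.
Proof.
move=> Tx0 n4; have := radial_map_ray_at0 x0 n4.
rewrite /ray_Dn scale0r /coef => ->; have [_ _ _ ->] := linearB0 lT.
by rewrite Tx0 expr1n mul1r [_ *: _]mulr1 rmorphM fmorphV /= natC.
Qed.

End Map.

(** The intermediate form is the functional of [schur_hankel_bound], times [mu^2 / 18], at the Schur
    parameters [t, -1]. Its value is negative, hence the sign. *)
Lemma sharp_hankel (mu t : R) : 1 <= mu <= 3 / 2 -> t ^+ 2 = 1 / (4 * (2 - mu)) ->
  2^-1 * ext_g2 mu t * (24^-1 * ext_g4 mu t) - (6^-1 * ext_g3 mu t) ^+ 2 =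
   - (mu ^+ 2 * (33 - 15 * mu) / (144 * (2 - mu))).
Proof.
move=> mu1 t2.
rewrite [LHS](_ : _ = mu ^+ 2 / 18 * ((t ^+ 2) ^+ 2 * ((1 - mu) * (1 + 2 * mu))
   - (2 + mu) * t ^+ 2 * (1 - t ^+ 2) - (1 - t ^+ 2) * (2 + t ^+ 2))).
  by rewrite t2; field; lra.
by rewrite /ext_g4 /ext_g3 /ext_g2; field.
Qed.

Theorem hankel_sharp (X_neq0 : exists x : X, x != 0) (lambda : R) :
  1 / 2 <= lambda <= 1 ->
  exists (F : X -> X) (x0 : X) (T : X -> C^o),
     [/\ locally_biholomorphic F, radial_terms F & class_F lambda F] /\
     [/\ `|x0| = 1, support_functionals x0 T &
         `|hankel22 F x0 T| =
           ((1 + 2 * lambda) ^+ 2 * (17 - 10 * lambda)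
              / (192 * (3 - 2 * lambda)))%:C].
Proof.
move=> l01; have [x xn0] := X_neq0; have nx := nrm_gt0 xn0.
pose x0 : X := ((nrm x)^-1)%:C *: x.
have x01 : `|x0| = 1.
  by rewrite normE nrmZ nrm_real ger0_norm ?invr_ge0 ?(ltW nx)// mulVf ?gt_eqF.
have [T [lT Tn Tx0]] := exists_support x01.
have [mu muE] : exists mu, mu = lambda + 1 / 2 by eexists.
have mu1 : 1 <= mu <= 3 / 2 by rewrite muE; lra.
have m2 : 0 < 2 - mu by lra.
pose t : R := Num.sqrt (1 / (4 * (2 - mu))).
have s0 : 0 <= 1 / (4 * (2 - mu)) by rewrite divr_ge0//; lra.
have t2 : t ^+ 2 = 1 / (4 * (2 - mu)) by rewrite sqr_sqrtr.
(* As [mu <= 3 / 2], in fact [t^2 <= 1 / 2]. *)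
have t0 : 0 <= t < 1.
  rewrite sqrtr_ge0/= -(expr_lt1 (n := 2))// ?sqrtr_ge0// t2.
  by rewrite ltr_pdivrMr; lra.
have [h [G [hG hG0 Gd G01]]] := extremal_function mu1 t0.
exists (radial_map h T), x0, T; split.
  split; [exact: radial_map_locally_biholomorphic lT Tn hG hG0|
          exact: radial_map_radial_terms t0 lT Tn hG Gd G01|
          refine (radial_map_class mu1 t0 lT Tn hG hG0 Gd G01 muE)].
split=> //; first exact: support_of_bound.
have cf n := @radial_map_coef _ _ _ _ _ t0 lT Tn hG Gd G01 x0 n Tx0.
rewrite /hankel22 (cf 2)// (cf 3)// (cf 4)// -rmorphXn -rmorphM -rmorphB.
rewrite -[2`!]/2%N -[3`!]/6%N -[4`!]/24%N [X in `|X%:C|](sharp_hankel mu1 t2).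
rewrite normE nrm_real normrN ger0_norm; last first.
  by rewrite divr_ge0 ?mulr_ge0 ?sqr_ge0//; lra.
by congr (_%:C); rewrite muE; field; lra.
Qed.

End Sharpness.

Unset Implicit Arguments.

Theorem theorem3p2 (R : realType) (X : completeNormedModType R[i])
    (X_neq0 : exists x : X, x != 0)
    (lambda : R) (lambda_bounds : 1 / 2 <= lambda <= 1) :
  (forall F : X -> X,
     locally_biholomorphic F -> radial_terms F -> class_F lambda F ->
     forall (x0 : X) (T : X -> R[i]^o),
       `|x0| = 1 -> support_functionals x0 T ->
       `|hankel22 F x0 T| <=
         ((1 + 2 * lambda) ^+ 2 * (17 - 10 * lambda)
            / (192 * (3 - 2 * lambda)))%:C) /\
  (exists (F : X -> X) (x0 : X) (T : X -> R[i]^o),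
     [/\ locally_biholomorphic F, radial_terms F & class_F lambda F] /\
     [/\ `|x0| = 1, support_functionals x0 T &
         `|hankel22 F x0 T| =
           ((1 + 2 * lambda) ^+ 2 * (17 - 10 * lambda)
              / (192 * (3 - 2 * lambda)))%:C]).
Proof.
split; last exact: hankel_sharp.
by move=> F F_lb F_rad F_cl x0 T; exact: hankel_upper_bound.
Qed.
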